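(* Let $s\in[0,1]$ and let $\lambda,\mu$ be the eigenvalues of $\mathbf Z$. If $\mathbf Z$ is diagonalizable, then the point spectra are $$\sigma_p(L^{(s)})=\{n\lambda+m\mu:n,m\in\mathbb N\},\qquad \sigma_p(L^{(s)*})=\{n\overline\lambda+m\overline\mu:n,m\in\mathbb N\}.$$ If $\mathbf Z$ is defective (so $\lambda=\mu$), then $$\sigma_p(L^{(s)})=\{n\lambda:n\in\mathbb N\},\qquad \sigma_p(L^{(s)*})=\{n\overline\lambda:n\in\mathbb N\}.$$ Every eigenvalue in these sets has finite multiplicity (its eigenspace is finite-dimensional).
   Context: $\mathbb N=\{0,1,2,\dots\}$. $\mathsf h=\Gamma(\mathbb C)$ is the one-mode bosonic Fock space with orthonormal basis $(e_n)_{n\ge0}$; $ae_n=\sqrt n\,e_{n-1}$ ($ae_0=0$), $a^\dagger e_n=\sqrt{n+1}\,e_{n+1}$, $N=a^\dagger a$; $W(z)=\exp(za^\dagger-\overline z a)$, $z\in\mathbb C$. $\mathcal B(\mathsf h)$, $\mathcal B_2(\mathsf h)$ are the bounded and Hilbert--Schmidt operators, with $\langle X,Y\rangle_2=\mathrm{Tr}(X^*Y)$. $\sigma_p$ denotes the point spectrum (set of eigenvalues). Gaussian QMS: let $\Omega\in\mathbb R$, $\kappa,\zeta,u_1,u_2,v_1,v_2\in\mathbb C$, $\gamma=\frac12\sum_{\ell=1}^2(|v_\ell|^2-|u_\ell|^2)$, and define real-linear operators on $\mathbb C$ by $Zz=(\mathrm i\Omega-\gamma)z+\mathrm i\kappa\overline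 z$ and $Cz=\sum_{\ell=1}^2\big((|u_\ell|^2+|v_\ell|^2)z+2v_\ell u_\ell\overline z\big)$. The Gaussian quantum Markov semigroup $(\mathcal T_t)_{t\ge0}$ is the weak$^*$-continuous semigroup of normal, completely positive, identity-preserving maps on $\mathcal B(\mathsf h)$ determined by $$\mathcal T_t(W(z))=\exp\Big\{-\tfrac12\int_0^t\Re\big(\overline{e^{rZ}z}\,C(e^{rZ}z)\big)dr+\mathrm i\int_0^t\Re\big(\overline\zeta\,e^{rZ}z\big)dr\Big\}W(e^{tZ}z).$$ Drift matrix: $\mathbf Z=\begin{pmatrix}-\gamma-\Im\kappa&\Re\kappa-\Omega\\ \Re\kappa+\Omega&-\gamma+\Im\kappa\end{pmatrix}$; ''defective'' means not diagonalizable. Standing assumptions: $\mathbf Z$ is stable (eigenvalues with strictly negative real parts); the unique normal invariant state $\rho$ is faithful; and (standardization) $\zeta=0$, $\kappa=\mathrm i\tanh(\beta/2)\sum_\ell u_\ell v_\ell$ with $\beta=-\log\big(\sum_\ell|u_\ell|^2/\sum_\ell|v_\ell|^2\big)>0$, so that $\rho=(1-e^{-\beta})e^{-\beta N}$. Induced semigroup: for $s\in[0,1]$, $T_t^{(s)}(\rho^{s/2}X\rho^{(1-s)/2})=\rho^{s/2}\mathcal T_t(X)\rho^{(1-s)/2}$, $X\in\mathcal B(\mathsf h)$, extends uniquely to a strongly continuous contraction semigroup on $\mathcal B_2(\mathsf h)$, with generator $L^{(s)}$. *)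

(* Defs.v *)
From HB Require Import structures.
From mathcomp Require Import all_boot all_order all_algebra.
From mathcomp Require Import all_classical all_reals all_analysis.
From mathcomp Require Import complex ring lra.

Set Implicit Arguments.
Unset Strict Implicit.
Unset Printing Implicit Defensive.
Import Order.TTheory GRing.Theory Num.Theory.
Import numFieldNormedType.Exports.
Import Normc.

Local Open Scope classical_set_scope.
Local Open Scope complex_scope.
Local Open Scope ring_scope.

(* The names [Re] and [Im] must not resolve to ['Re] and ['Im], which are
   valued in the complex field itself. *)
Local Notation Re := complex.Re.
Local Notation Im := complex.Im.

Section ComplexAnalysis.
Variable R : realType.
Implicit Type z : R[i].

Definition csum (f : nat -> R[i]) : R[i] :=
  limn (series (fun n => Re (f n) : R)) +i* limn (series (fun n => Im (f n) : R)).

Definition cexp z : R[i] := (expR (Re z))%:C * (cos (Im z) +i* sin (Im z)).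

(* [rexp A r z] is $e^{rA}z$ for a real-linear map [A] of the complex plane. *)
Definition rexp (A : R[i] -> R[i]) (r : R) z : R[i] :=
  csum (fun n => (r ^+ n / n`!%:R)%:C * iter n A z).

End ComplexAnalysis.

(* The one-mode Fock space is realized as $\ell^2(\mathbb N)$.  The values are
   taken in the regular module so that functions form a left module. *)
Section FockSpace.
Variable R : realType.
Local Notation C := R[i].
Local Notation cseq := (nat -> C^o).

Definition sqnorm (x : cseq) : \bar R :=
  (\sum_(0 <= n <oo) ((normc (x n)) ^+ 2)%:E)%E.

Definition square_summable : {pred cseq} := [pred x | (sqnorm x < +oo)%E].

Lemma sqnorm_ge0 x : (0 <= sqnorm x)%E.
Proof. by apply: nneseries_ge0 => n _ _; rewrite lee_fin sqr_ge0. Qed.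

Lemma sqnorm0 : sqnorm 0 = 0%E.
Proof. by apply: eseries0 => n _ _; rewrite normc0 expr0n. Qed.

Lemma sqnormZ (a : C) x : sqnorm (a *: x) = ((normc a ^+ 2)%:E * sqnorm x)%E.
Proof.
rewrite /sqnorm -nneseriesZl; last by move=> n _; rewrite lee_fin sqr_ge0.
by apply: eq_eseriesr => n _; rewrite -EFinM -exprMn -normcM.
Qed.

Lemma normc_ge0 (a : C) : 0 <= normc a.
Proof. by case: a => p q; exact: sqrtr_ge0. Qed.

Lemma sqr_normcD (a b : C) :
  normc (a + b) ^+ 2 <= 2 * normc a ^+ 2 + 2 * normc b ^+ 2.
Proof.
have E (c : C) : normc c ^+ 2 = Re c ^+ 2 + Im c ^+ 2.
  by case: c => p q /=; rewrite sqr_sqrtr // addr_ge0 ?sqr_ge0.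
rewrite !E; case: a b => [a1 a2] [b1 b2] /=.
have := sqr_ge0 (a1 - b1); have := sqr_ge0 (a2 - b2); lra.
Qed.

Lemma sqnormD (x y : cseq) : (sqnorm (x + y)%R <= 2%:E * sqnorm x + 2%:E * sqnorm y)%E.
Proof.
have ge0 (u : cseq) n : (0 <= ((normc (u n)) ^+ 2)%:E)%E.
  by rewrite lee_fin sqr_ge0.
rewrite /sqnorm -!nneseriesZl // -nneseriesD //; last 2 first.
- by move=> n _ _; rewrite mule_ge0.
- by move=> n _ _; rewrite mule_ge0.
apply: lee_nneseries => [n _ _|n _]; first exact: ge0.
by rewrite -!EFinM -EFinD lee_fin sqr_normcD.
Qed.

Fact square_summable_submod : submod_closed square_summable.
Proof.
split=> [|a x y]; rewrite !inE ?sqnorm0 ?ltry // => x2 y2.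
apply: le_lt_trans (sqnormD _ _) _; rewrite sqnormZ.
by apply: lte_add_pinfty; rewrite ?muleA -?EFinM; apply: lte_mul_pinfty;
  rewrite ?lee_fin ?mulr_ge0 ?normc_ge0.
Qed.

HB.instance Definition _ :=
  GRing.isSubmodClosed.Build C cseq square_summable square_summable_submod.

Record fock := Fock { fock_val :> cseq; _ : fock_val \in square_summable }.
HB.instance Definition _ := [isSub for fock_val].
HB.instance Definition _ := [Choice of fock by <:].
HB.instance Definition _ := [SubChoice_isSubLmodule of fock by <:].

Fact basis_subproof (k : nat) :
  (fun n => (n == k)%:R : C^o) \in square_summable.
Proof.
rewrite inE /sqnorm (@nneseriesD1 _ _ k) //=; last first.
  by move=> n; rewrite lee_fin sqr_ge0.
rewrite eseries0 ?adde0 ?ltry // => n _ /negPf ->.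
by rewrite normc0 expr0n.
Qed.

Definition basis (k : nat) : fock := Fock (basis_subproof k).

Definition inner (x y : fock) : C := csum (fun n => (x n)^* * y n).

Definition fnorm (x : fock) : R := Num.sqrt (fine (sqnorm x)).

Lemma fnormE (x : fock) : (fnorm x ^+ 2)%:E = sqnorm x.
Proof.
have /= := valP x; rewrite inE /fnorm => xoo.
rewrite sqr_sqrtr ?fine_ge0 ?sqnorm_ge0 // fineK // ge0_fin_numE //.
exact: sqnorm_ge0.
Qed.

Lemma fnorm_ge0 x : 0 <= fnorm x. Proof. exact: sqrtr_ge0. Qed.

Lemma fnorm0 : fnorm 0 = 0.
Proof. by rewrite /fnorm sqnorm0 sqrtr0. Qed.

Lemma fnormZ (a : C) (x : fock) : fnorm (a *: x) = normc a * fnorm x.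
Proof.
apply/eqP; rewrite -(@eqrXn2 _ 2) ?fnorm_ge0 ?mulr_ge0 ?fnorm_ge0 ?normc_ge0 //.
by apply/eqP/EFin_inj; rewrite fnormE exprMn [RHS]EFinM fnormE -sqnormZ.
Qed.

Lemma fnormD (x y : fock) :
  fnorm (x + y) ^+ 2 <= 2 * fnorm x ^+ 2 + 2 * fnorm y ^+ 2.
Proof. rewrite -lee_fin EFinD [X in (_ <= X + _)%E]EFinM [X in (_ <= _ + X)%E]EFinM.
by rewrite !fnormE sqnormD. Qed.

Definition bounded_linear : {pred fock -> fock} :=
  [pred f | `[< linear f /\ exists M, forall x, fnorm (f x) <= M * fnorm x >]].

Fact bounded_linear_submod : submod_closed bounded_linear.
Proof.
split=> [|a f g]; rewrite !inE.
  split=> [b x y|]; first by rewrite scaler0 addr0.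
  by exists 0 => x; rewrite mul0r fnorm0.
move=> [lf [M fM]] [lg [N gN]]; split.
  move=> b x y; rewrite !fctE lf lg !scalerDr !scalerA [b * a]mulrC.
  by rewrite addrACA.
exists (Num.sqrt (2 * (normc a * M) ^+ 2 + 2 * N ^+ 2)) => x.
have le_sqr h K : (forall x, fnorm (h x) <= K * fnorm x) ->
    fnorm (h x) ^+ 2 <= K ^+ 2 * fnorm x ^+ 2.
  by move=> hK; rewrite -exprMn lerXn2r ?nnegrE ?fnorm_ge0 // 
    (le_trans (fnorm_ge0 (h x))).
have c0 : 0 <= 2 * (normc a * M) ^+ 2 + 2 * N ^+ 2.
  by rewrite addr_ge0 // mulr_ge0 ?sqr_ge0.
rewrite -(@ler_pXn2r _ 2) ?nnegrE ?mulr_ge0 ?sqrtr_ge0 ?fnorm_ge0 //.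
apply: le_trans (fnormD _ _) _; rewrite [X in _ <= X]exprMn (sqr_sqrtr c0).
rewrite [X in _ <= X]mulrDl.
apply: lerD; rewrite -[X in _ <= X]mulrA ler_wpM2l //; last exact: le_sqr.
by rewrite fnormZ !exprMn -[X in _ <= X]mulrA ler_wpM2l ?sqr_ge0 // le_sqr.
Qed.

HB.instance Definition _ :=
  GRing.isSubmodClosed.Build C (fock -> fock) bounded_linear
    bounded_linear_submod.

Record bop := Bop { bop_val :> fock -> fock; _ : bop_val \in bounded_linear }.
HB.instance Definition _ := [isSub for bop_val].
HB.instance Definition _ := [Choice of bop by <:].
HB.instance Definition _ := [SubChoice_isSubLmodule of bop by <:].

Fact bop_id_subproof : (id : fock -> fock) \in bounded_linear.
Proof.
rewrite inE; split=> //.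
by exists 1 => x; rewrite mul1r.
Qed.

Definition bop_id : bop := Bop bop_id_subproof.

Fact bop_comp_subproof (A B : bop) :
  (fun x => A (B x)) \in bounded_linear.
Proof.
have := valP A; have := valP B; rewrite !inE /=.
move=> [lB [N BN]] [lA [M AM]]; split.
  by move=> a x y; rewrite lB lA.
exists (`|M| * N) => x; apply: le_trans (AM _) _.
rewrite -mulrA; apply: le_trans (_ : `|M| * fnorm (B x) <= _).
  by rewrite ler_wpM2r ?fnorm_ge0 // ler_norm.
by rewrite ler_wpM2l.
Qed.

Definition bop_comp (A B : bop) : bop := Bop (bop_comp_subproof A B).

Definition trace (A : bop) : C := csum (fun n => inner (basis n) (A (basis n))).

Definition positive (A : bop) : Prop := forall x, 0 <= inner x (A x).

(* [number_calc f] is $f(N)$, defined whenever [f] is bounded. *)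
Definition number_calc (f : nat -> R) : bop :=
  xget 0 [set A : bop | forall (x : fock) n, A x n = (f n)%:C * x n].

Lemma number_calcE (f : nat -> R) (M : R) : (forall n, `|f n| <= M) ->
  forall (x : fock) n, number_calc f x n = (f n)%:C * x n.
Proof.
move=> fM; rewrite /number_calc.
have M0 : 0 <= M by apply: le_trans (fM 0%N).
have ge0 (u : cseq) n : (0 <= ((normc (u n)) ^+ 2)%:E)%E.
  by rewrite lee_fin sqr_ge0.
have dle (x : cseq) :
    (sqnorm (fun n => (f n)%:C * x n : C^o)%R <= (M ^+ 2)%:E * sqnorm x)%E.
  rewrite /sqnorm -nneseriesZl //; apply: lee_nneseries => [n _ _|n _].
    by rewrite lee_fin sqr_ge0.
  rewrite -EFinM lee_fin normcM exprMn ler_wpM2r ?sqr_ge0 //.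
  by rewrite /= expr0n addr0 sqrtr_sqr lerXn2r ?nnegrE.
have dP (x : fock) :
    (fun n => ((f n)%:C * x n : C^o)) \in square_summable.
  rewrite inE; apply: le_lt_trans (dle x) _; apply: lte_mul_pinfty => //.
    by rewrite lee_fin sqr_ge0.
  by have := valP x; rewrite inE.
pose d x := Fock (dP x).
have lind : d \in bounded_linear.
  rewrite inE; split=> [a x y|].
    by apply: val_inj; apply/funext => n /=; rewrite mulrDr mulrCA.
  exists M => x.
  rewrite -(@ler_pXn2r _ 2) ?nnegrE ?mulr_ge0 ?fnorm_ge0 //.
  by rewrite exprMn -lee_fin [X in (_ <= X)%E]EFinM !fnormE dle.
by apply: (@xgetPex _ 0 [set A : bop | forall (x : fock) n, A x n = (f n)%:C * x n]);
  exists (Bop lind).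
Qed.

Definition hs_sqnorm (A : bop) : \bar R :=
  (\sum_(0 <= n <oo) sqnorm (A (basis n)))%E.

Definition hilbert_schmidt : {pred bop} := [pred A | (hs_sqnorm A < +oo)%E].

Fact hilbert_schmidt_submod : submod_closed hilbert_schmidt.
Proof.
have ge0 (A : bop) n : (0 <= sqnorm (A (basis n)))%E by exact: sqnorm_ge0.
split=> [|a A B]; rewrite !inE.
  by rewrite /hs_sqnorm eseries0 ?ltry // => n _ _; exact: sqnorm0.
move=> A2 B2; set b := normc a ^+ 2.
have b0 : 0 <= b by exact: sqr_ge0.
apply: (@le_lt_trans _ _ ((2 * b)%:E * hs_sqnorm A + 2%:E * hs_sqnorm B)%E).
  rewrite /hs_sqnorm -!nneseriesZl // -nneseriesD //; last 2 first.
  - by move=> n _ _; rewrite mule_ge0 // lee_fin mulr_ge0.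
  - by move=> n _ _; rewrite mule_ge0.
  apply: lee_nneseries => [n _ _|n _]; first exact: ge0.
  have E : (a *: A + B) (basis n) =
    a *: (A (basis n) : cseq) + (B (basis n) : cseq) :> cseq by [].
  rewrite E; apply: le_trans (sqnormD _ _) _.
  by rewrite [X in (_ * X + _)%E]sqnormZ EFinM muleA.
by apply: lte_add_pinfty; apply: lte_mul_pinfty;
  rewrite ?lee_fin ?mulr_ge0 ?normc_ge0.
Qed.

HB.instance Definition _ :=
  GRing.isSubmodClosed.Build C bop hilbert_schmidt hilbert_schmidt_submod.

Record hs := HS { hs_val :> bop; _ : hs_val \in hilbert_schmidt }.
HB.instance Definition _ := [isSub for hs_val].
HB.instance Definition _ := [Choice of hs by <:].
HB.instance Definition _ := [SubChoice_isSubLmodule of hs by <:].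

(* $\mathrm{Tr}(X^*Y)=\sum_n\langle e_n,X^*Ye_n\rangle$ *)
Definition hs_inner (X Y : hs) : C :=
  csum (fun n => inner (X (basis n)) (Y (basis n))).

Definition hs_norm (X : hs) : R := Num.sqrt (fine (hs_sqnorm X)).

(* The ladder operators act entrywise on all sequences, hence on the finite
   particle vectors they preserve. *)
Definition annihilation (x : cseq) : cseq :=
  fun n => (Num.sqrt n.+1%:R)%:C * x n.+1.

Definition creation (x : cseq) : cseq :=
  fun n => (Num.sqrt n%:R)%:C * x n.-1.

Definition weyl_generator (z : C) (x : cseq) : cseq :=
  z *: creation x - z^* *: annihilation x.

(* The basis vectors are analytic for $za^\dagger-\overline za$, so the
   exponential is the bounded operator given on them by the power series,
   which converges in norm. *)
Definition weyl (z : C) : bop :=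
  xget 0 [set W : bop | forall k,
    sqnorm ((W (basis k) : cseq) - \sum_(n < m)
      (n`!%:R : C)^-1 *: iter n (weyl_generator z) (basis k)) @[m --> \oo]
    --> 0%E].

End FockSpace.

Arguments bop_id {R}.

Section QuantumMarkovSemigroups.
Variable R : realType.
Local Notation C := R[i].

(* These are the functionals generating the weak$^*$ topology. *)
Definition normal_functional (phi : bop R -> C) : Prop :=
  exists x y : nat -> fock R,
    [/\ (\sum_(0 <= n <oo) sqnorm (x n) < +oo)%E,
        (\sum_(0 <= n <oo) sqnorm (y n) < +oo)%E &
        forall A, phi A = csum (fun n => inner (x n) (A (y n)))].

Definition normal_map (F : bop R -> bop R) : Prop :=
  forall phi, normal_functional phi -> normal_functional (phi \o F).

Definition positive_block n (A : 'I_n -> 'I_n -> bop R) : Prop :=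
  forall x : 'I_n -> fock R, 0 <= \sum_i \sum_j inner (x i) (A i j (x j)).

Definition completely_positive (F : bop R -> bop R) : Prop :=
  forall n (A : 'I_n -> 'I_n -> bop R),
    positive_block A -> positive_block (fun i j => F (A i j)).

Record quantum_markov_semigroup (T : R -> bop R -> bop R) : Prop := {
  qms_linear : forall t, 0 <= t -> linear (T t);
  qms_normal : forall t, 0 <= t -> normal_map (T t);
  qms_cp : forall t, 0 <= t -> completely_positive (T t);
  qms_unital : forall t, 0 <= t -> T t bop_id = bop_id;
  qms_0 : forall A, T 0 A = A;
  qms_add : forall t r A, 0 <= t -> 0 <= r -> T (t + r) A = T t (T r A);
  qms_continuous : forall phi A, normal_functional phi ->
    {within `[0, +oo[, continuous (fun t => Re (phi (T t A)))} /\
    {within `[0, +oo[, continuous (fun t => Im (phi (T t A)))}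
}.

Definition normal_state (rho : bop R) : Prop :=
  positive rho /\
  (\sum_(0 <= n <oo) (Re (inner (basis R n) (rho (basis R n))))%:E = 1)%E.

Definition invariant (T : R -> bop R -> bop R) (rho : bop R) : Prop :=
  forall t A, 0 <= t -> trace (bop_comp rho (T t A)) = trace (bop_comp rho A).

Definition unique_normal_invariant_state (T : R -> bop R -> bop R)
    (rho : bop R) : Prop :=
  [/\ normal_state rho, invariant T rho &
      forall rho', normal_state rho' -> invariant T rho' -> rho' = rho].

Definition faithful (rho : bop R) : Prop :=
  forall A, positive A -> trace (bop_comp rho A) = 0 -> A = 0.

Section Gaussian.
Variables (Omega : R) (kappa zeta : C) (u v : 'I_2 -> C).

Definition gamma : R := 2^-1 * \sum_l (normc (v l) ^+ 2 - normc (u l) ^+ 2).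

Definition drift_map (z : C) : C :=
  (- gamma +i* Omega) * z + (0 +i* 1) * kappa * z^*.

Definition noise_map (z : C) : C :=
  \sum_l ((normc (u l) ^+ 2 + normc (v l) ^+ 2)%:C * z
           + 2 * v l * u l * z^*).

Definition drift_mx : 'M[R]_2 :=
  \matrix_(i, j) nth 0 (nth [::]
    [:: [:: - gamma - Im kappa; Re kappa - Omega];
        [:: Re kappa + Omega; - gamma + Im kappa]] i) j.

Definition weyl_factor (t : R) (z : C) : C :=
  let e r := rexp drift_map r z in
  cexp (- (2^-1 * \int[lebesgue_measure]_(r in `[0, t])
             Re ((e r)^* * noise_map (e r)))
        +i* (\int[lebesgue_measure]_(r in `[0, t]) Re (zeta^* * e r))).

Definition gaussian_qms (T : R -> bop R -> bop R) : Prop :=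
  quantum_markov_semigroup T /\
  forall t z, 0 <= t ->
    T t (weyl z) = weyl_factor t z *: weyl (rexp drift_map t z).

End Gaussian.

(* Real matrices are regarded over the complex numbers for their eigenvalues
   and for diagonalizability. *)
Definition complexify n (M : 'M[R]_n) : 'M[C]_n := map_mx (real_complex R) M.

Definition stable n (M : 'M[R]_n) : Prop :=
  forall a, eigenvalue (complexify M) a -> Re a < 0.

Definition tanh (x : R) : R := (expR x - expR (- x)) / (expR x + expR (- x)).

Definition gibbs_weight (beta : R) (n : nat) : R :=
  (1 - expR (- beta)) * expR (- (beta * n%:R)).

Definition gibbs (beta : R) : bop R := number_calc (gibbs_weight beta).

Definition gibbs_pow (beta p : R) : bop R :=
  number_calc (fun n => gibbs_weight beta n `^ p).

End QuantumMarkovSemigroups.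

Section HilbertSchmidtSemigroups.
Variable R : realType.
Local Notation C := R[i].

Record contraction_semigroup (T : R -> hs R -> hs R) : Prop := {
  csg_linear : forall t, 0 <= t -> linear (T t);
  csg_0 : forall X, T 0 X = X;
  csg_add : forall t r X, 0 <= t -> 0 <= r -> T (t + r) X = T t (T r X);
  csg_contraction : forall t X, 0 <= t -> hs_norm (T t X) <= hs_norm X;
  csg_continuous : forall X, hs_norm (T t X - X) @[t --> 0^'+] --> (0 : R)
}.

(* [embed A] is $\rho^{s/2}A\rho^{(1-s)/2}$ with $\rho$ the Gibbs state; it is
   Hilbert-Schmidt for every bounded [A], so that [X] below always exists. *)
Definition induced_semigroup (T : R -> bop R -> bop R) (beta s : R)
    (Ts : R -> hs R -> hs R) : Prop :=
  let embed A := bop_comp (gibbs_pow beta (s / 2))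
                   (bop_comp A (gibbs_pow beta ((1 - s) / 2))) in
  contraction_semigroup Ts /\
  forall t (A : bop R) (X : hs R), 0 <= t ->
    X = embed A :> bop R -> Ts t X = embed (T t A) :> bop R.

(* Unbounded operators are represented by their graphs. *)
Definition generator (T : R -> hs R -> hs R) (X Y : hs R) : Prop :=
  hs_norm ((t^-1)%:C *: (T t X - X) - Y) @[t --> 0^'+] --> (0 : R).

Definition adjoint (G : hs R -> hs R -> Prop) (X Y : hs R) : Prop :=
  forall V W, G V W -> hs_inner X W = hs_inner Y V.

Definition eigenspace_of (G : hs R -> hs R -> Prop) (a : C) : set (hs R) :=
  [set X | G X (a *: X)].

Definition point_spectrum (G : hs R -> hs R -> Prop) : set C :=
  [set a | exists2 X, X != 0 & eigenspace_of G a X].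

Definition finite_dimensional (E : set (hs R)) : Prop :=
  exists n (b : 'I_n -> hs R), forall X, E X ->
    exists c : 'I_n -> C, X = \sum_i c i *: b i.

End HilbertSchmidtSemigroups.

(* Main.v *)
(* Write r = exp (- beta / 2), sg = sqrt (1 - r^2), w = exp (- beta s / 2).  Up to
   the factor exp (coth (beta / 2) |z|^2 / 2), the embedded Weyl operator
   rho^(s/2) W(z) rho^((1-s)/2) is a vector [coh z] whose expansion in powers of z
   and its conjugate is the sum over m, n of z^m (z^* )^n c_mn E_mn, where the E_mn
   are the columns of a two-mode squeezing matrix and form an orthonormal basis of
   the Hilbert-Schmidt operators, and c_mn <> 0.  Standardization makes the factor
   in the Gaussian formula absorb this normalization, so that the induced semigroup
   satisfies T_t (coh z) = coh (e^(tZ) z).  Comparing the terms of degree K in z, T_t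
   leaves each space span {E_mn : m + n = K} invariant and acts on it as the K-th
   symmetric power of the drift; its generator there is the derivation with
   eigenvalues d lambda + (K - d) mu, 0 <= d <= K.  Since the blocks are mutually
   orthogonal and span, they carry the whole point spectrum of the generator and of
   its adjoint, and stability leaves only finitely many blocks for each
   eigenvalue. *)
Require Import Defs.
From mathcomp Require Import all_boot all_order all_algebra.
From mathcomp Require Import all_classical all_reals all_analysis.
From mathcomp Require Import complex ring lra zify.

Set Implicit Arguments.
Unset Strict Implicit.
Unset Printing Implicit Defensive.
Import Order.TTheory GRing.Theory Num.Theory.
Import numFieldNormedType.Exports.
Import Normc.

Local Open Scope classical_set_scope.
Local Open Scope complex_scope.
Local Open Scope ring_scope.

(** Two obstacles shape the proof. The generator is unbounded and an eigenvector is a priori an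
    infinite combination of the E_mn, so the generator is never applied term by term to a series.
    Instead the block form of T_t is extended by density to the coordinates of every Hilbert-Schmidt
    operator, and the coordinates of an eigenvector in one block are then an eigenvector of a finite
    matrix. This needs the E_mn to be complete. Completeness follows from orthonormality: up to
    signs the squeezing matrix is its own transpose, so its rows have norm 1 too, and every matrix
    unit satisfies Parseval's identity.

    The map e^(tZ) is only real-linear. Real dilations of z therefore separate the degrees K, and
    evaluation at K + 1 points of the plane separates the monomials within one degree.

    The constant coth (beta / 2) is the ratio of noise to dissipation: with it, the integrand of the
    Gaussian factor is a multiple of the derivative of the squared modulus along the flow.

    Eigenvalues of a symmetric power are read off from the order of vanishing of a polynomial at a
    fixed point. That argument does not distinguish diagonalizable from defective drifts, so no
    Jordan form occurs. *)

Local Notation Re := (@complex.Re _).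
Local Notation Im := (@complex.Im _).

(** * Convergence of complex-valued functions, reduced to real limits of moduli *)

Section ComplexLimits.
Variable R : realType.
Local Notation C := R[i].
Implicit Types (z a b : C).

Lemma normrC z : `|z| = (normc z)%:C. Proof. by []. Qed.

Lemma normc_conj z : normc z^* = normc z.
Proof. by case: z => x y /=; rewrite sqrrN. Qed.

Lemma normcR (x : R) : normc (x%:C) = `|x|.
Proof. by rewrite /= expr0n addr0 sqrtr_sqr. Qed.

Lemma normcD a b : normc (a + b) <= normc a + normc b.
Proof. exact: le_normcD. Qed.

Lemma normc_opp a : normc (- a) = normc a.
Proof. exact: normcN. Qed.

Lemma normcX a n : normc (a ^+ n) = normc a ^+ n.
Proof. by elim: n => [|n IH]; rewrite ?expr0 ?normc1 // !exprS normcM IH. Qed.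

Lemma normc_sum (I : Type) (r : seq I) (P : pred I) (f : I -> C) :
  normc (\sum_(i <- r | P i) f i) <= \sum_(i <- r | P i) normc (f i).
Proof.
elim/big_rec2: _ => [|i x y _ h]; first by rewrite normc0.
by apply: le_trans (normcD _ _) _; rewrite lerD2l.
Qed.

Lemma sqr_normcE z : normc z ^+ 2 = Re z ^+ 2 + Im z ^+ 2.
Proof. by case: z => x y /=; rewrite sqr_sqrtr // addr_ge0 ?sqr_ge0. Qed.

Lemma rCM (x y : R) : (x * y)%:C = x%:C * y%:C :> C. Proof. exact: rmorphM. Qed.
Lemma rCD (x y : R) : (x + y)%:C = x%:C + y%:C :> C. Proof. exact: rmorphD. Qed.
Lemma rCN (x : R) : (- x)%:C = - x%:C :> C. Proof. exact: rmorphN. Qed.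
Lemma rCX (x : R) n : (x ^+ n)%:C = x%:C ^+ n :> C. Proof. exact: rmorphXn. Qed.
Lemma rCV (x : R) : (x^-1)%:C = x%:C^-1 :> C. Proof. exact: fmorphV. Qed.
Lemma rC_sum (I : Type) (r : seq I) (P : pred I) (F : I -> R) :
  (\sum_(i <- r | P i) F i)%:C = \sum_(i <- r | P i) (F i)%:C :> C.
Proof. exact: rmorph_sum. Qed.

Lemma conjM a b : (a * b)^* = a^* * b^*. Proof. exact: rmorphM. Qed.
Lemma conjD a b : (a + b)^* = a^* + b^*. Proof. exact: rmorphD. Qed.
Lemma conjB a b : (a - b)^* = a^* - b^*. Proof. exact: rmorphB. Qed.
Lemma conjN a : (- a)^* = - a^*. Proof. exact: rmorphN. Qed.
Lemma conj0 : (0 : C)^* = 0. Proof. exact: rmorph0. Qed.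
Lemma conj1 : (1 : C)^* = 1. Proof. exact: rmorph1. Qed.

Lemma conj_mulE z : z^* * z = (normc z ^+ 2)%:C.
Proof. by rewrite sqr_normcE; case: z => x y; simpc; congr (_ +i* _); ring. Qed.

Lemma normc_Re z : `|Re z| <= normc z.
Proof.
rewrite -(@ler_pXn2r _ 2) ?nnegrE ?normc_ge0 ?normr_ge0 // sqr_normcE.
by rewrite real_normK ?num_real // lerDl sqr_ge0.
Qed.

Lemma normc_Im z : `|Im z| <= normc z.
Proof.
rewrite -(@ler_pXn2r _ 2) ?nnegrE ?normc_ge0 ?normr_ge0 // sqr_normcE.
by rewrite real_normK ?num_real // lerDr sqr_ge0.
Qed.

Lemma normc_le_ReIm z : normc z <= `|Re z| + `|Im z|.
Proof.
rewrite -(@ler_pXn2r _ 2) ?nnegrE ?normc_ge0 ?addr_ge0 ?normr_ge0 // sqr_normcE.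
by rewrite sqrrD !real_normK ?num_real // lerD2r lerDl mulrn_wge0 // mulr_ge0 ?normr_ge0.
Qed.

Lemma ReM_real (x : R) z : Re (x%:C * z) = x * Re z.
Proof. by case: z => a b /=; ring. Qed.

Lemma ImM_real (x : R) z : Im (x%:C * z) = x * Im z.
Proof. by case: z => a b /=; ring. Qed.

Lemma ReD a b : Re (a + b) = Re a + Re b. Proof. by case: a; case: b. Qed.
Lemma ImD a b : Im (a + b) = Im a + Im b. Proof. by case: a; case: b. Qed.
Lemma ReB a b : Re (a - b) = Re a - Re b. Proof. by case: a; case: b. Qed.
Lemma ImB a b : Im (a - b) = Im a - Im b. Proof. by case: a; case: b. Qed.

Lemma Re_conjc z : Re z^* = Re z. Proof. by case: z. Qed.
Lemma Im_conjc z : Im z^* = - Im z. Proof. by case: z. Qed.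

Lemma complex_ext a b : Re a = Re b -> Im a = Im b -> a = b.
Proof. by case: a => x y; case: b => u v /= -> ->. Qed.

Lemma conj_real (x : R) : (x%:C : C)^* = x%:C.
Proof. by apply: complex_ext => /=; rewrite ?oppr0. Qed.

Lemma Re_sum (I : Type) (r : seq I) (P : pred I) (f : I -> C) :
  Re (\sum_(i <- r | P i) f i) = \sum_(i <- r | P i) Re (f i).
Proof. exact: (big_morph _ ReD). Qed.

Lemma Im_sum (I : Type) (r : seq I) (P : pred I) (f : I -> C) :
  Im (\sum_(i <- r | P i) f i) = \sum_(i <- r | P i) Im (f i).
Proof. exact: (big_morph _ ImD). Qed.

(* The topology of [R[i]] is only available through its [numFieldType]
   structure, which is why the cast is hidden in a definition; the lock keeps
   unification away from the underlying filters. *)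
Definition cvgc_def (T : Type) (F : set_system T) (f : T -> C) (l : C) : Prop :=
  (f : T -> (C : numFieldType)) @ F --> (l : (C : numFieldType)).
Fact cvgc_key : unit. Proof. by []. Qed.
Definition cvgc := locked_with cvgc_key cvgc_def.
Lemma cvgcE : cvgc = cvgc_def. Proof. exact: unlock. Qed.

Section Filtered.
Variables (T : Type) (F : set_system T).
Context {FF : Filter F}.
Implicit Types f g : T -> C.

Lemma cvgcP f l : cvgc F f l <-> (normc (f x - l) @[x --> F] --> (0 : R)).
Proof.
rewrite cvgcE; split=> h.
  apply/cvgr0Pnorm_lt => e e0.
  have /cvgrPdist_lt /(_ e%:C) := h; rewrite ltcR => /(_ e0).
  apply: filterS => x; rewrite normrC ltcR -normc_opp opprB.
  by rewrite ger0_norm ?normc_ge0.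
apply/cvgrPdist_lt => e e0.
have Ee : e = (Re e)%:C.
  by case: e e0 => a b; rewrite ltcE /= => /andP[/eqP ->].
move: e0; rewrite Ee ltcR => e0.
have /cvgr0Pnorm_lt /(_ _ e0) := h.
apply: filterS => x; rewrite normrC ltcR -normc_opp opprB.
by rewrite ger0_norm ?normc_ge0.
Qed.

Lemma cvgc_ext f g a : (forall x, f x = g x) -> cvgc F f a -> cvgc F g a.
Proof. by move=> /funext ->. Qed.

Lemma cvgcD f g a b : cvgc F f a -> cvgc F g b -> cvgc F (fun x => f x + g x) (a + b).
Proof. by rewrite cvgcE; exact: cvgD. Qed.

Lemma cvgcB f g a b : cvgc F f a -> cvgc F g b -> cvgc F (fun x => f x - g x) (a - b).
Proof. by rewrite cvgcE; exact: cvgB. Qed.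

Lemma cvgcM f g a b : cvgc F f a -> cvgc F g b -> cvgc F (fun x => f x * g x) (a * b).
Proof. by rewrite cvgcE; exact: cvgM. Qed.

Lemma cvgc_cst a : cvgc F (fun=> a) a.
Proof. by rewrite cvgcE; exact: cvg_cst. Qed.

Lemma cvgcZ f a c : cvgc F f a -> cvgc F (fun x => c * f x) (c * a).
Proof. by move=> h; apply: cvgcM => //; exact: cvgc_cst. Qed.

Lemma cvgcX f a n : cvgc F f a -> cvgc F (fun x => f x ^+ n) (a ^+ n).
Proof.
move=> h; elim: n => [|n IH]; first exact: cvgc_cst.
rewrite (_ : (fun x => _) = (fun x => f x * f x ^+ n)) ?exprS; first exact: cvgcM.
by apply/funext => x; rewrite exprS.
Qed.

Lemma cvgc_sum (I : Type) (r : seq I) (f : I -> T -> C) (a : I -> C) :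
  (forall i, cvgc F (f i) (a i)) ->
  cvgc F (fun x => \sum_(i <- r) f i x) (\sum_(i <- r) a i).
Proof.
move=> h; elim: r => [|i r IH].
  rewrite big_nil (_ : (fun x => _) = fun=> 0); first exact: cvgc_cst.
  by apply/funext => x; rewrite big_nil.
rewrite big_cons (_ : (fun x => _) = fun x => f i x + \sum_(j <- r) f j x).
  exact: cvgcD.
by apply/funext => x; rewrite big_cons.
Qed.

Lemma cvgc_Re f a : cvgc F f a -> Re (f x) @[x --> F] --> Re a.
Proof.
move=> /cvgcP /cvgr0Pnorm_lt h; apply/cvgrPdist_lt => e /h.
apply: filterS => x; rewrite (ger0_norm (normc_ge0 _)).
by apply: le_lt_trans; rewrite distrC -ReB normc_Re.
Qed.

Lemma cvgc_ReIm f a :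
  Re (f x) @[x --> F] --> Re a -> Im (f x) @[x --> F] --> Im a -> cvgc F f a.
Proof.
move=> hr hi; apply/cvgcP.
have h : `|Re (f x) - Re a| + `|Im (f x) - Im a| @[x --> F] --> (0 : R).
  rewrite -[0](addr0 0); apply: cvgD.
    rewrite -[0](normr0 R) -(subrr (Re a)).
    by apply: cvg_norm; apply: cvgB => //; exact: cvg_cst.
  rewrite -[0](normr0 R) -(subrr (Im a)).
  by apply: cvg_norm; apply: cvgB => //; exact: cvg_cst.
apply: squeeze_cvgr (cvg_cst 0) h.
by apply: nearW => x; rewrite normc_ge0 -ReB -ImB normc_le_ReIm.
Qed.

Lemma cvgc_conj f a : cvgc F f a -> cvgc F (fun x => (f x)^*) a^*.
Proof.
move=> /cvgcP h; apply/cvgcP; apply: cvg_trans h.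
by apply: near_eq_cvg; apply: nearW => x; rewrite -rmorphB normc_conj.
Qed.

Lemma cvgc_real (f : T -> R) (a : R) :
  f x @[x --> F] --> a -> cvgc F (fun x => (f x)%:C) a%:C.
Proof. by move=> h; apply: cvgc_ReIm => //=; exact: cvg_cst. Qed.

Lemma cvgc_normc f a : cvgc F f a -> normc (f x) @[x --> F] --> normc a.
Proof.
move=> /cvgcP h; apply/cvgrPdist_lt => e e0.
have /cvgr0Pnorm_lt /(_ _ e0) := h; apply: filterS => x.
rewrite (ger0_norm (normc_ge0 _)); apply: le_lt_trans; rewrite ler_norml.
apply/andP; split.
  rewrite lerNl opprB lerBlDl; apply: le_trans (normcD _ _).
  by rewrite addrC subrK.
rewrite lerBlDl -[normc (f x - a)]normc_opp opprB.
by apply: le_trans (normcD _ _); rewrite addrC subrK.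
Qed.

End Filtered.

Lemma cvgc_unique (T : Type) (F : set_system T) {FF : ProperFilter F}
  (f : T -> C) a b : cvgc F f a -> cvgc F f b -> a = b.
Proof. by rewrite cvgcE => ha hb; exact: (cvg_unique (@norm_hausdorff _ _) ha hb). Qed.

Lemma cvgc_normc_le (T : Type) (F : set_system T) {FF : ProperFilter F}
    (f : T -> C) a (M : R) :
  cvgc F f a -> (\forall x \near F, normc (f x) <= M) -> normc a <= M.
Proof. by move=> /cvgc_normc h hM; apply: (cvgr_to_le h). Qed.

End ComplexLimits.

(** * Absolutely summable complex series *)

Section ComplexSums.
Variable R : realType.
Local Notation C := R[i].
Implicit Types f g : nat -> C.

(** [csum] is a pair of [limn], whose value is meaningful only for convergent series; this is the
    side condition under which it behaves as a sum. *)
Definition asum f : Prop := exists M : R, forall N, \sum_(n < N) normc (f n) <= M.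

Lemma bounded_series_cvg (u : nat -> R) (M : R) :
  (forall N, \sum_(n < N) `|u n| <= M) -> cvgn (series u).
Proof.
move=> hM; apply: normed_cvg; apply: nondecreasing_is_cvgn.
  apply: nondecreasing_series => n _ _; exact: normr_ge0.
by exists M => _ [n _ <-]; have := hM n; rewrite /series /= -(big_mkord xpredT (fun i => `|u i|)).
Qed.

Lemma asum_cvg f : asum f -> cvgc \oo (fun N => \sum_(n < N) f n) (csum f).
Proof.
move=> [M hM]; apply: cvgc_ReIm.
  rewrite (_ : (fun x => _) = series (fun n => Re (f n))).
    apply: (@bounded_series_cvg _ M) => N; apply: le_trans (hM N).
    by apply: ler_sum => i _; exact: normc_Re.
  by apply/funext => N; rewrite Re_sum /series /= big_mkord.
rewrite (_ : (fun x => _) = series (fun n => Im (f n))).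
  apply: (@bounded_series_cvg _ M) => N; apply: le_trans (hM N).
  by apply: ler_sum => i _; exact: normc_Im.
by apply/funext => N; rewrite Im_sum /series /= big_mkord.
Qed.

Lemma csum_unique f l : asum f -> cvgc \oo (fun N => \sum_(n < N) f n) l -> csum f = l.
Proof. by move=> /asum_cvg h h'; exact: cvgc_unique h h'. Qed.

Lemma asumD f g : asum f -> asum g -> asum (fun n => f n + g n).
Proof.
move=> [M hM] [K hK]; exists (M + K) => N.
apply: le_trans (lerD (hM N) (hK N)); rewrite -big_split /=.
by apply: ler_sum => i _; exact: normcD.
Qed.

Lemma asumZ f c : asum f -> asum (fun n => c * f n).
Proof.
move=> [M hM]; exists (normc c * M) => N.
under eq_bigr do rewrite normcM.
by rewrite -mulr_sumr ler_wpM2l ?normc_ge0.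
Qed.

Lemma csumD f g : asum f -> asum g -> csum (fun n => f n + g n) = csum f + csum g.
Proof.
move=> af ag; apply: csum_unique; first exact: asumD.
rewrite (_ : (fun N => _) = fun N => \sum_(n < N) f n + \sum_(n < N) g n).
  by apply: cvgcD; exact: asum_cvg.
by apply/funext => N; rewrite big_split.
Qed.

Lemma csumZ f c : asum f -> csum (fun n => c * f n) = c * csum f.
Proof.
move=> af; apply: csum_unique; first exact: asumZ.
rewrite (_ : (fun N => _) = fun N => c * \sum_(n < N) f n).
  by apply: cvgcZ; exact: asum_cvg.
by apply/funext => N; rewrite mulr_sumr.
Qed.

Lemma csum_conj f : asum f -> csum (fun n => (f n)^*) = (csum f)^*.
Proof.
move=> af; apply: csum_unique.
  by case: af => M hM; exists M => N; under eq_bigr do rewrite normc_conj.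
rewrite (_ : (fun N => _) = fun N => (\sum_(n < N) f n)^*).
  by apply: cvgc_conj; exact: asum_cvg.
by apply/funext => N; rewrite rmorph_sum.
Qed.

Lemma asum_finite f K : (forall n, (K <= n)%N -> f n = 0) -> asum f.
Proof.
move=> h; exists (\sum_(n < K) normc (f n)) => N.
have [le|/ltnW le] := leqP N K.
  rewrite -!(big_mkord xpredT (fun n => normc (f n))) (@big_cat_nat _ _ _ N 0 K) //=.
  by rewrite lerDl sumr_ge0 // => i _; exact: normc_ge0.
rewrite -!(big_mkord xpredT (fun n => normc (f n))) (@big_cat_nat _ _ _ K 0 N) //=.
rewrite [X in _ + X]big_nat_cond [X in _ + X]big1 ?addr0 // => i.
by rewrite andbT => /andP[/h -> _]; rewrite normc0.
Qed.

Lemma csum_finite f K : (forall n, (K <= n)%N -> f n = 0) -> csum f = \sum_(n < K) f n.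
Proof.
move=> h; apply: csum_unique; first exact: asum_finite h.
apply/cvgcP; apply: (@cvg_near_cst _ _ (0 : R)); exists K => // N /= le.
rewrite -!(big_mkord xpredT (fun n => f n)) (@big_cat_nat _ _ _ K 0 N) //=.
rewrite [X in _ + X - _]big_nat_cond [X in _ + X - _]big1 ?addr0 ?subrr ?normc0 // => i.
by rewrite andbT => /andP[/h -> _].
Qed.

Lemma csum0 f : (forall n, f n = 0) -> csum f = 0.
Proof. by move=> h; rewrite (@csum_finite f 0) ?big_ord0. Qed.

Lemma cvgc_shiftS f l : cvgc \oo (fun N => f N.+1) l -> cvgc \oo f l.
Proof.
by move=> /cvgcP h; apply/cvgcP; rewrite -(cvg_shiftS (fun N => normc (f N - l))).
Qed.

Lemma asumS f : asum (fun n => f n.+1) <-> asum f.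
Proof.
split=> -[M hM].
  exists (normc (f 0%N) + M) => -[|N]; last by rewrite big_ord_recl lerD2l.
  by rewrite big_ord0 addr_ge0 ?normc_ge0 // (le_trans _ (hM 0%N)) ?big_ord0.
exists M => N; apply: le_trans (hM N.+1).
by rewrite big_ord_recl lerDr normc_ge0.
Qed.

Lemma csumS f : asum f -> csum f = f 0%N + csum (fun n => f n.+1).
Proof.
move=> af; have /asum_cvg := (asumS f).2 af => h.
apply: csum_unique => //; apply: cvgc_shiftS.
rewrite (_ : (fun x => _) = fun N => f 0%N + \sum_(n < N) f n.+1).
  by apply: cvgcD => //; exact: cvgc_cst.
by apply/funext => N; rewrite /= big_ord_recl.
Qed.

Lemma normc_csum_le f (M : R) : (forall N, \sum_(n < N) normc (f n) <= M) ->
  normc (csum f) <= M.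
Proof.
move=> hM; have af : asum f by exists M.
apply: (cvgc_normc_le (asum_cvg af)); apply: nearW => N; apply: le_trans (hM N).
exact: normc_sum.
Qed.

End ComplexSums.

(** * Absolutely summable double series *)

Section DoubleSums.
Variable R : realType.
Local Notation C := R[i].
Local Notation arr := (nat -> nat -> C).
Implicit Types f g : arr.

Definition asum2 f : Prop := exists M : R, forall N K,
  \sum_(k < K) \sum_(j < N) normc (f j k) <= M.

(** The order of summation is that of [hs_inner]: columns outside, entries of a column inside. *)
Definition csum2 f : C := csum (fun k => csum (fun j => f j k)).

Lemma cvg_bigsum (T : Type) (F : set_system T) {FF : Filter F} (I : Type)
    (r : seq I) (f : I -> T -> R) (a : I -> R) :
  (forall i, f i x @[x --> F] --> a i) ->
  \sum_(i <- r) f i x @[x --> F] --> \sum_(i <- r) a i.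
Proof.
move=> h; elim: r => [|i r IH].
  by under eq_fun do rewrite big_nil; rewrite big_nil; exact: cvg_cst.
under eq_fun do rewrite big_cons; rewrite big_cons.
by apply: cvgD.
Qed.

Lemma cvg0Z (T : Type) (F : set_system T) {FF : Filter F} (f : T -> R) (M : R) :
  f x @[x --> F] --> (0 : R) -> M * f x @[x --> F] --> (0 : R).
Proof.
move=> h; suff : M * f x @[x --> F] --> M * 0 by rewrite mulr0.
by apply: cvgM => //; exact: cvg_cst.
Qed.

Lemma cvg0_le (T : Type) (F : set_system T) {FF : Filter F} (f g : T -> R) :
  (forall x, 0 <= f x <= g x) -> g x @[x --> F] --> (0 : R) -> f x @[x --> F] --> (0 : R).
Proof. by move=> h; apply: squeeze_cvgr (cvg_cst 0); exact: nearW. Qed.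

Lemma asum2_col f k : asum2 f -> asum (fun j => f j k).
Proof.
move=> [M hM]; exists M => N; apply: le_trans (hM N k.+1).
rewrite big_ord_recr /= lerDr; apply: sumr_ge0 => i _; apply: sumr_ge0 => j _.
exact: normc_ge0.
Qed.

Lemma sum_normc_csum_le f (M : R) :
  (forall N K, \sum_(k < K) \sum_(j < N) normc (f j k) <= M) ->
  forall K, \sum_(k < K) normc (csum (fun j => f j k)) <= M.
Proof.
move=> hM K; have af : asum2 f by exists M.
have h : \sum_(k < K) normc (\sum_(j < N) f j k) @[N --> \oo]
    --> \sum_(k < K) normc (csum (fun j => f j k)).
  apply: cvg_bigsum => k; apply: cvgc_normc; apply: asum_cvg; exact: asum2_col.
apply: (cvgr_to_le h); apply: nearW => N; apply: le_trans (hM N K).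
by apply: ler_sum => k _; exact: normc_sum.
Qed.

Lemma asum2_row f : asum2 f -> asum (fun k => csum (fun j => f j k)).
Proof. by move=> [M hM]; exists M; exact: sum_normc_csum_le. Qed.

Lemma asum2Z f c : asum2 f -> asum2 (fun j k => c * f j k).
Proof.
move=> [M hM]; exists (normc c * M) => N K.
under eq_bigr do under eq_bigr do rewrite normcM.
by under eq_bigr do rewrite -mulr_sumr; rewrite -mulr_sumr ler_wpM2l ?normc_ge0.
Qed.

Lemma csum2D f g : asum2 f -> asum2 g ->
  csum2 (fun j k => f j k + g j k) = csum2 f + csum2 g.
Proof.
move=> af ag; rewrite /csum2 -csumD; [|exact: asum2_row|exact: asum2_row].
by congr csum; apply/funext => k; rewrite csumD //; exact: asum2_col.
Qed.

Lemma csum2Z f c : asum2 f -> csum2 (fun j k => c * f j k) = c * csum2 f.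
Proof.
move=> af; rewrite /csum2 -csumZ; last exact: asum2_row.
by congr csum; apply/funext => k; rewrite csumZ //; exact: asum2_col.
Qed.

Lemma csum2_conj f : asum2 f -> csum2 (fun j k => (f j k)^*) = (csum2 f)^*.
Proof.
move=> af; rewrite /csum2 -csum_conj; last exact: asum2_row.
by congr csum; apply/funext => k; rewrite csum_conj //; exact: asum2_col.
Qed.

Lemma csum2_shiftl f : asum2 f -> (forall k, f 0%N k = 0) ->
  csum2 f = csum2 (fun j k => f j.+1 k).
Proof.
move=> af f0; congr csum; apply/funext => k.
by rewrite csumS ?f0 ?add0r //; exact: asum2_col.
Qed.

Lemma csum2_shiftr f : asum2 f -> (forall j, f j 0%N = 0) ->
  csum2 f = csum2 (fun j k => f j k.+1).
Proof.
move=> af f0; rewrite /csum2 csumS; last exact: asum2_row.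
by rewrite [X in X + _]csum0 ?add0r.
Qed.

Lemma csum2_cvg f : asum2 f -> forall M : R, 
  (forall N K, Re (\sum_(k < K) \sum_(j < N) f j k) <= M) -> Re (csum2 f) <= M.
Proof.
move=> af M hM.
apply: (cvgr_to_le (cvgc_Re (asum_cvg (asum2_row af)))); apply: nearW => K.
have h : cvgc \oo (fun N => \sum_(k < K) \sum_(j < N) f j k)
    (\sum_(k < K) csum (fun j => f j k)).
  by apply: cvgc_sum => k; apply: asum_cvg; exact: asum2_col.
by apply: (cvgr_to_le (cvgc_Re h)); apply: nearW => N.
Qed.

Lemma csum2_ge f : asum2 f -> (forall j k, 0 <= Re (f j k)) ->
  forall N K, Re (\sum_(k < K) \sum_(j < N) f j k) <= Re (csum2 f).
Proof.
move=> af f0 N K.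
have h1 k : 0 <= Re (csum (fun j => f j k)) /\
    Re (\sum_(j < N) f j k) <= Re (csum (fun j => f j k)).
  have h : Re (\sum_(j < N) f j k) @[N --> \oo] --> Re (csum (fun j => f j k)).
    by apply: cvgc_Re; apply: asum_cvg; exact: asum2_col.
  split.
    apply: (cvgr_to_ge h); apply: nearW => L.
    by rewrite Re_sum sumr_ge0.
  apply: (cvgr_to_ge h); exists N => // L /= NL; rewrite !Re_sum.
  rewrite -!(big_mkord xpredT (fun j => Re (f j k))) (@big_cat_nat _ _ _ N 0 L) //=.
  by rewrite lerDl sumr_ge0.
apply: (@le_trans _ _ (\sum_(k < K) Re (csum (fun j => f j k)))).
  by rewrite Re_sum; apply: ler_sum => k _; case: (h1 k).
apply: (cvgr_to_ge (cvgc_Re (asum_cvg (asum2_row af)))); exists K => // L /= KL.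
rewrite !Re_sum -!(big_mkord xpredT (fun k => Re (csum (fun j => f j k)))).
rewrite (@big_cat_nat _ _ _ K 0 L) //=.
by rewrite lerDl sumr_ge0 // => i _; case: (h1 i).
Qed.

End DoubleSums.

(** * Arrays of geometric decay *)

Section RapidDecay.
Variable R : realType.
Local Notation C := R[i].
Local Notation arr := (nat -> nat -> C).
Implicit Types f g : arr.

(** A class of absolutely summable arrays that is stable under the unbounded ladder operators, so
    that these can be moved across an inner product without domain questions. *)
Definition rapid f : Prop := exists K t : R,
  [/\ 0 <= t, t < 1 & forall j k, normc (f j k) <= K * t ^+ (j + k)].

Lemma sum_geom_le (t : R) N : 0 <= t -> t < 1 -> \sum_(i < N) t ^+ i <= (1 - t)^-1.
Proof.
move=> t0 t1; have d0 : 0 < 1 - t by rewrite subr_gt0.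
rewrite -(ler_pM2r d0) mulVf ?gt_eqF // mulrC -opprB mulNr -subrX1 opprB.
by rewrite gerBl exprn_ge0.
Qed.

Lemma rapid_bound_ge0 f (K t : R) :
  (forall j k, normc (f j k) <= K * t ^+ (j + k)) -> 0 <= K.
Proof. by move=> /(_ 0%N 0%N); rewrite addn0 expr0 mulr1; apply: le_trans (normc_ge0 _). Qed.

Lemma rapid_asum2 f : rapid f -> asum2 f.
Proof.
move=> [K [t [t0 t1 h]]]; have K0 := rapid_bound_ge0 h.
exists (K * ((1 - t)^-1 * (1 - t)^-1)) => N L.
apply: (@le_trans _ _ (K * ((\sum_(k < L) t ^+ k) * (\sum_(j < N) t ^+ j)))).
  rewrite mulr_suml mulr_sumr; apply: ler_sum => k _.
  rewrite !mulr_sumr; apply: ler_sum => j _.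
  by apply: le_trans (h _ _) _; rewrite exprD [t ^+ k * _]mulrC.
rewrite ler_wpM2l // ler_pM ?sum_geom_le ?sumr_ge0 // => i _; exact: exprn_ge0.
Qed.

Lemma rapid_le f g : (forall j k, normc (f j k) <= normc (g j k)) -> rapid g -> rapid f.
Proof. by move=> h [K [t [t0 t1 hg]]]; exists K, t; split=> // j k; apply: le_trans (h _ _) _. Qed.

Lemma rapidD f g : rapid f -> rapid g -> rapid (fun j k => f j k + g j k).
Proof.
move=> [K [t [t0 t1 hf]]] [L [u [u0 u1 hg]]].
have K0 := rapid_bound_ge0 hf; have L0 := rapid_bound_ge0 hg.
exists (K + L), (Num.max t u); split.
- by rewrite le_max t0.
- by rewrite gt_max t1.
move=> j k; apply: le_trans (normcD _ _) _; rewrite mulrDl; apply: lerD.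
  apply: le_trans (hf _ _) _; rewrite ler_wpM2l // lerXn2r ?nnegrE //.
  - by rewrite le_max t0.
  - by rewrite le_max lexx.
apply: le_trans (hg _ _) _; rewrite ler_wpM2l // lerXn2r ?nnegrE //.
- by rewrite le_max t0.
- by rewrite le_max lexx orbT.
Qed.

Lemma rapidZ f c : rapid f -> rapid (fun j k => c * f j k).
Proof.
move=> [K [t [t0 t1 h]]]; exists (normc c * K), t; split=> // j k.
by rewrite normcM -mulrA ler_wpM2l ?normc_ge0.
Qed.

Lemma rapid_conj f : rapid f -> rapid (fun j k => (f j k)^*).
Proof. by apply: rapid_le => j k; rewrite normc_conj. Qed.

Lemma rapidM f g : rapid f -> rapid g -> rapid (fun j k => f j k * g j k).
Proof.
move=> [K [t [t0 t1 hf]]] [L [u [u0 u1 hg]]].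
have L0 := rapid_bound_ge0 hg; exists (K * L), t; split=> // j k.
rewrite normcM mulrAC ler_pM ?normc_ge0 //.
apply: le_trans (hg j k) _; rewrite ler_piMr // exprn_ile1 //; exact: ltW.
Qed.

(** For any rate [u] strictly between [t] and 1, the difference [u ^+ n.+1 - t ^+ n.+1] is [u - t]
    times a sum of [n.+1] products, each at least [t ^+ n]. *)
Lemma succ_geom_bound (t : R) : 0 <= t -> t < 1 ->
  exists K u : R, [/\ 0 <= u, u < 1 & forall n, n.+1%:R * t ^+ n <= K * u ^+ n].
Proof.
move=> t0 t1; pose u := (t + 1) / 2.
have tu : t < u by rewrite /u; lra.
have u1 : u < 1 by rewrite /u; lra.
have u0 : 0 < u by apply: le_lt_trans tu.
exists (u / (u - t)), u; split=> //; first exact: ltW.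
move=> n.
have d0 : 0 < u - t by rewrite subr_gt0.
rewrite mulrAC ler_pdivlMr // -exprS.
apply: (@le_trans _ _ (u ^+ n.+1 - t ^+ n.+1)); last by rewrite gerBl exprn_ge0.
rewrite subrXX mulrC; apply: ler_wpM2l; first exact: ltW.
have -> : n.+1%:R * t ^+ n = \sum_(i < n.+1) t ^+ n by rewrite sumr_const card_ord mulr_natl.
apply: ler_sum => i _.
have le_in : (i <= n)%N by rewrite -ltnS.
rewrite /= -{1}(subnK le_in) exprD; apply: ler_wpM2r; first exact: exprn_ge0.
by apply: lerXn2r; rewrite ?nnegrE // ltW.
Qed.

(* The weight absorbs the unbounded factors of the ladder operators. *)
Lemma rapid_weight f (g : arr) : rapid f ->
  (forall j k, normc (g j k) <= (j + k).+1%:R * normc (f j k)) -> rapid g.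
Proof.
move=> [K [t [t0 t1 hf]]] hg; have K0 := rapid_bound_ge0 hf.
have [L [u [u0 u1 hu]]] := succ_geom_bound t0 t1.
exists (K * L), u; split=> // j k; apply: le_trans (hg j k) _.
apply: (@le_trans _ _ ((j + k).+1%:R * (K * t ^+ (j + k)))).
  by rewrite ler_wpM2l.
by rewrite mulrCA -mulrA ler_wpM2l.
Qed.

Lemma rapid_shiftl f : rapid f -> rapid (fun j k => f j.+1 k).
Proof.
move=> [K [t [t0 t1 h]]]; have K0 := rapid_bound_ge0 h; exists K, t; split=> // j k.
apply: le_trans (h _ _) _; rewrite ler_wpM2l // addSn exprS ler_piMl ?exprn_ge0 //.
exact: ltW.
Qed.

Lemma rapid_shiftr f : rapid f -> rapid (fun j k => f j k.+1).
Proof.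
move=> [K [t [t0 t1 h]]]; have K0 := rapid_bound_ge0 h; exists K, t; split=> // j k.
apply: le_trans (h _ _) _; rewrite ler_wpM2l // addnS exprS ler_piMl ?exprn_ge0 //.
exact: ltW.
Qed.

(** Undoing a shift of an index divides the bound by the rate, which must then be positive; raising
    the rate to at least [2^-1] ensures this. *)
Lemma rapid_pos f : rapid f -> exists K t : R,
  [/\ 0 < t, t < 1 & forall j k, normc (f j k) <= K * t ^+ (j + k)].
Proof.
move=> [K [t [t0 t1 h]]]; have K0 := rapid_bound_ge0 h.
exists K, (Num.max t 2^-1); split.
- by rewrite lt_max; apply/orP; right; rewrite invr_gt0.
- by rewrite gt_max t1 /= invf_lt1 // ltr1n.
move=> j k; apply: le_trans (h _ _) _; rewrite ler_wpM2l // lerXn2r ?nnegrE //.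
- by rewrite le_max t0.
- by rewrite le_max lexx.
Qed.

Lemma rapid_unshiftl f : rapid f -> rapid (fun j k => if j is j'.+1 then f j' k else 0).
Proof.
move=> /rapid_pos [K [t [t0 t1 h]]]; have K0 := rapid_bound_ge0 h.
exists (K / t), t; split=> //; first exact: ltW.
move=> [|j] k; first by rewrite normc0 mulr_ge0 ?divr_ge0 ?exprn_ge0 // ltW.
apply: le_trans (h _ _) _; rewrite addSn exprS mulrA divfK ?gt_eqF //.
Qed.

Lemma rapid_unshiftr f : rapid f -> rapid (fun j k => if k is k'.+1 then f j k' else 0).
Proof.
move=> /rapid_pos [K [t [t0 t1 h]]]; have K0 := rapid_bound_ge0 h.
exists (K / t), t; split=> //; first exact: ltW.
move=> j [|k]; first by rewrite normc0 mulr_ge0 ?divr_ge0 ?exprn_ge0 // ltW.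
by apply: le_trans (h _ _) _; rewrite addnS exprS mulrA divfK ?gt_eqF.
Qed.

End RapidDecay.

(** * The Cauchy-Schwarz inequality and vectors of the Fock space *)

Section FockVectors.
Variable R : realType.
Local Notation C := R[i].
Local Notation basis := (@Defs.basis R).

Lemma cauchy_schwarz_real (a b : nat -> R) N :
  (\sum_(n < N) a n * b n) ^+ 2 <= (\sum_(n < N) a n ^+ 2) * (\sum_(n < N) b n ^+ 2).
Proof.
elim: N => [|N IH]; first by rewrite !big_ord0 expr0n mulr0.
rewrite !big_ord_recr /=; move: IH.
set S := \sum_(n < N) _; set A := \sum_(n < N) _; set B := \sum_(n < N) _ => IH.
have A0 : 0 <= A by apply: sumr_ge0 => i _; exact: sqr_ge0.
have B0 : 0 <= B by apply: sumr_ge0 => i _; exact: sqr_ge0.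
set x := a N; set y := b N.
(* The new cross term is controlled by [IH] and the arithmetic-geometric mean inequality for
   [A * y ^+ 2] and [x ^+ 2 * B]. *)
suff h : 2 * (S * (x * y)) <= A * y ^+ 2 + x ^+ 2 * B.
  move: IH h; set xy := x * y => IH h.
  have -> : (S + xy) ^+ 2 = S ^+ 2 + 2 * (S * xy) + x ^+ 2 * y ^+ 2 by rewrite /xy; ring.
  have -> : (A + x ^+ 2) * (B + y ^+ 2) = A * B + (A * y ^+ 2 + x ^+ 2 * B) + x ^+ 2 * y ^+ 2.
    by ring.
  by rewrite lerD2r lerD.
have P0 : 0 <= A * y ^+ 2 + x ^+ 2 * B by rewrite addr_ge0 // mulr_ge0 ?sqr_ge0.
apply: le_trans (ler_norm _) _; rewrite -(@ler_pXn2r _ 2) ?nnegrE //.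
rewrite real_normK ?num_real //.
have h1 : (2 * (S * (x * y))) ^+ 2 <= 4 * (A * B * (x ^+ 2 * y ^+ 2)).
  have -> : (2 * (S * (x * y))) ^+ 2 = 4 * (S ^+ 2 * (x ^+ 2 * y ^+ 2)) by ring.
  by rewrite ler_wpM2l // ler_wpM2r // mulr_ge0 ?sqr_ge0.
apply: le_trans h1 _; rewrite -subr_ge0.
have -> : (A * y ^+ 2 + x ^+ 2 * B) ^+ 2 - 4 * (A * B * (x ^+ 2 * y ^+ 2)) =
  (A * y ^+ 2 - x ^+ 2 * B) ^+ 2 by ring.
exact: sqr_ge0.
Qed.

Lemma sqnorm_le (x : nat -> C^o) (M : R) :
  (forall N, \sum_(n < N) normc (x n) ^+ 2 <= M) -> (sqnorm x <= M%:E)%E.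
Proof.
move=> h; apply: lime_le.
  by apply: is_cvg_nneseries => n _ _; rewrite lee_fin sqr_ge0.
by apply: nearW => N; rewrite sumEFin lee_fin big_mkord.
Qed.

Lemma square_summable_bounded (x : nat -> C^o) (M : R) :
  (forall N, \sum_(n < N) normc (x n) ^+ 2 <= M) -> x \in square_summable (R := R).
Proof. by move=> /sqnorm_le h; rewrite inE; apply: le_lt_trans h _; rewrite ltry. Qed.

Lemma sum_le_fnorm (x : fock R) N : \sum_(n < N) normc (x n) ^+ 2 <= fnorm x ^+ 2.
Proof.
rewrite -lee_fin fnormE -sumEFin -(big_mkord xpredT (fun n => (normc (x n) ^+ 2)%:E)).
by apply: nneseries_lim_ge => n _ _; rewrite lee_fin sqr_ge0.
Qed.

Lemma fnorm_le (x : fock R) (M : R) :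
  (forall N, \sum_(n < N) normc (x n) ^+ 2 <= M) -> fnorm x ^+ 2 <= M.
Proof. by move=> h; rewrite -lee_fin fnormE; exact: sqnorm_le. Qed.

Lemma fnorm_cvg (x : fock R) :
  \sum_(n < N) normc (x n) ^+ 2 @[N --> \oo] --> fnorm x ^+ 2.
Proof.
have c : cvgn (fun N => \sum_(n < N) normc (x n) ^+ 2).
  apply: nondecreasing_is_cvgn.
    apply/nondecreasing_seqP => n.
    by rewrite big_ord_recr /= lerDl sqr_ge0.
  by exists (fnorm x ^+ 2) => _ [n _ <-]; exact: sum_le_fnorm.
suff <- : limn (fun N => \sum_(n < N) normc (x n) ^+ 2) = fnorm x ^+ 2 by [].
apply/eqP; rewrite eq_le; apply/andP; split.
  by apply: limr_le => //; apply: nearW => N; exact: sum_le_fnorm.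
apply: fnorm_le => N; apply: nondecreasing_cvgn_le => //.
by apply/nondecreasing_seqP => n; rewrite big_ord_recr /= lerDl sqr_ge0.
Qed.

Lemma normc_le_fnorm (x : fock R) n : normc (x n) <= fnorm x.
Proof.
rewrite -(@ler_pXn2r _ 2) ?nnegrE ?normc_ge0 ?fnorm_ge0 //.
apply: le_trans (sum_le_fnorm x n.+1); rewrite big_ord_recr /= lerDr.
by apply: sumr_ge0 => i _; exact: sqr_ge0.
Qed.

Lemma fockE_sum n (F : 'I_n -> fock R) j : (\sum_(i < n) F i) j = \sum_(i < n) F i j.
Proof. by elim/big_rec2: _ => [|i y x _ <-]. Qed.

Lemma fockB (x y : fock R) j : (x - y) j = x j - y j. Proof. by []. Qed.
Lemma fockZ c (x : fock R) j : (c *: x) j = c * x j. Proof. by []. Qed.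
Lemma basisE k j : basis k j = (j == k)%:R. Proof. by []. Qed.

Lemma sum_delta (n : nat) (c : nat -> C) (j : nat) :
  \sum_(i < n) c i * (j == i :> nat)%:R = if (j < n)%N then c j else 0.
Proof.
elim: n => [|n IH]; first by rewrite big_ord0.
rewrite big_ord_recr /= IH ltnS; have [->|ne] := eqVneq j n.
  by rewrite ltnn leqnn mulr1 add0r.
by rewrite mulr0 addr0 [in RHS]leq_eqVlt (negPf ne).
Qed.

Lemma fnorm_truncation (x : fock R) :
  fnorm (x - \sum_(k < K) x k *: basis k) @[K --> \oo] --> (0 : R).
Proof.
have le K : fnorm (x - \sum_(k < K) x k *: basis k) ^+ 2 <=
    fnorm x ^+ 2 - \sum_(k < K) normc (x k) ^+ 2.
  apply: fnorm_le => N.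
  have E n : (x - \sum_(k < K) x k *: basis k) n = if (n < K)%N then 0 else x n.
    rewrite fockB fockE_sum; under eq_bigr do rewrite fockZ basisE.
    by rewrite sum_delta; case: ifP => _; rewrite ?subrr ?subr0.
  under eq_bigr do rewrite E; rewrite lerBrDl.
  apply: le_trans (sum_le_fnorm x (maxn K N)).
  rewrite -!(big_mkord xpredT (fun n => normc (x n) ^+ 2)).
  rewrite -(big_mkord xpredT (fun n => normc (if (n < K)%N then 0 else x n) ^+ 2)).
  rewrite (@big_cat_nat _ _ _ K 0 (maxn K N)) //= ?leq_maxl // lerD2l.
  have [NK|KN] := leqP N K.
    rewrite big_nat_cond big1; first by apply: sumr_ge0 => i _; exact: sqr_ge0.
    by move=> i; rewrite andbT => /andP[_ iN]; rewrite (leq_trans iN NK) normc0 expr0n.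
  rewrite (@big_cat_nat _ _ _ K 0 N _ _ (leq0n K) (ltnW KN)) /=.
  rewrite (@eq_big_nat _ _ _ 0 K _ (fun=> 0)); last first.
    by move=> i /andP[_ ->]; rewrite normc0 expr0n.
  rewrite big1 // add0r.
  rewrite le_eqVlt; apply/orP; left; apply/eqP; apply: eq_big_nat => i /andP[Ki _].
  by rewrite ltnNge Ki.
have h : Num.sqrt (fnorm x ^+ 2 - \sum_(k < K) normc (x k) ^+ 2) @[K --> \oo] --> (0 : R).
  have h0 : fnorm x ^+ 2 - \sum_(k < K) normc (x k) ^+ 2 @[K --> \oo] --> (0 : R).
    suff : fnorm x ^+ 2 - \sum_(k < K) normc (x k) ^+ 2 @[K --> \oo]
      --> fnorm x ^+ 2 - fnorm x ^+ 2 by rewrite subrr.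
    by apply: cvgB; [exact: cvg_cst|exact: fnorm_cvg].
  suff : Num.sqrt (fnorm x ^+ 2 - \sum_(k < K) normc (x k) ^+ 2) @[K --> \oo]
    --> Num.sqrt (0 : R) by rewrite sqrtr0.
  by apply: continuous_cvg => //; exact: sqrt_continuous.
apply: cvg0_le h => K.
rewrite fnorm_ge0 /= -(@ler_pXn2r _ 2) ?nnegrE ?fnorm_ge0 ?sqrtr_ge0 //.
rewrite [X in _ <= X]sqr_sqrtr; first exact: le.
by apply: le_trans (le K); exact: sqr_ge0.
Qed.

End FockVectors.

(** * Bounded operators and their matrices *)

Section Operators.
Variable R : realType.
Local Notation C := R[i].
Local Notation basis := (@Defs.basis R).
Implicit Types A B : bop R.

Lemma bop_linear A : linear A.
Proof. by have := valP A; rewrite inE /= => -[]. Qed.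

Lemma bop_bounded A : exists2 M, 0 <= M & forall x, fnorm (A x) <= M * fnorm x.
Proof.
have := valP A; rewrite inE /= => -[_ [M h]]; exists `|M| => // x.
by apply: le_trans (h x) _; rewrite ler_wpM2r ?fnorm_ge0 // ler_norm.
Qed.

Lemma bop0 A : A 0 = 0.
Proof.
by have := bop_linear A (-1) 0 0; rewrite scaler0 addr0 scaleN1r addNr.
Qed.

Lemma bopD A x y : A (x + y) = A x + A y.
Proof. by have := bop_linear A 1 x y; rewrite !scale1r. Qed.

Lemma bopZ A c x : A (c *: x) = c *: A x.
Proof. by have := bop_linear A c x 0; rewrite bop0 !addr0. Qed.

Lemma bopB A x y : A (x - y) = A x - A y.
Proof. by rewrite bopD -scaleN1r bopZ scaleN1r. Qed.

Lemma bop_sum A n (F : 'I_n -> fock R) : A (\sum_(i < n) F i) = \sum_(i < n) A (F i).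
Proof. exact: (big_morph _ (bopD A) (bop0 A)). Qed.

(** Boundedness carries the convergence of the truncations of [x] through [A]; entrywise convergence
    is enough to determine [A] from its matrix. *)
Lemma bop_coord A (x : fock R) j :
  cvgc \oo (fun K => \sum_(k < K) x k * A (basis k) j) (A x j).
Proof.
have [M M0 h] := bop_bounded A.
apply/cvgcP.
apply: cvg0_le (cvg0Z M (@fnorm_truncation _ x)) => K; rewrite normc_ge0 /=.
apply: le_trans (h _); apply: le_trans (normc_le_fnorm _ j).
rewrite bopB bop_sum -normc_opp opprB fockB fockE_sum.
by under [X in _ <= normc (_ - X)]eq_bigr do rewrite bopZ fockZ.
Qed.

Lemma bop_ext A B : (forall k j, A (basis k) j = B (basis k) j) -> A = B.
Proof.
move=> h; apply: val_inj; apply/funext => x; apply: val_inj; apply/funext => j.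
apply: (cvgc_unique (bop_coord A x j)).
apply: cvgc_ext (bop_coord B x j) => K.
by apply: eq_bigr => k _; rewrite h.
Qed.

End Operators.

(** * Hilbert-Schmidt operators as square-summable matrices *)

Section HilbertSchmidt.
Variable R : realType.
Local Notation C := R[i].
Local Notation basis := (@Defs.basis R).
Implicit Types X Y V W : hs R.

Definition square_bounded (f : nat -> nat -> C) (M : R) : Prop := forall N K,
  \sum_(k < K) \sum_(j < N) normc (f j k) ^+ 2 <= M.

Lemma square_bounded_row f M j K : square_bounded f M ->
  \sum_(k < K) normc (f j k) ^+ 2 <= M.
Proof.
move=> h; apply: le_trans (h j.+1 K); apply: ler_sum => k _.
by rewrite big_ord_recr /= lerDr; apply: sumr_ge0 => i _; exact: sqr_ge0.
Qed.

Lemma amgm (a b : R) : a * b <= 2^-1 * a ^+ 2 + 2^-1 * b ^+ 2.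
Proof. by have := sqr_ge0 (a - b); lra. Qed.

(** The bound on rows makes each coordinate series converge, and the bound on truncations passes to
    the limit. No Hilbert-Schmidt bound is assumed, so that isometries such as the Weyl operators
    are covered as well. *)
Lemma bop_of_matrix (f : nat -> nat -> C) (L M : R) :
  (forall j K, \sum_(k < K) normc (f j k) ^+ 2 <= L) ->
  (forall (x : fock R) N K,
    \sum_(j < N) normc (\sum_(k < K) x k * f j k) ^+ 2 <= M * fnorm x ^+ 2) ->
  exists A : bop R, forall j k, A (basis k) j = f j k.
Proof.
move=> hL hM.
have af (x : fock R) j : asum (fun k => x k * f j k).
  exists (2^-1 * fnorm x ^+ 2 + 2^-1 * L) => K.
  apply: (@le_trans _ _ (\sum_(k < K) (2^-1 * normc (x k) ^+ 2 + 2^-1 * normc (f j k) ^+ 2))).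
    by apply: ler_sum => k _; rewrite normcM amgm.
  rewrite big_split /= -!mulr_sumr lerD // ler_wpM2l ?invr_ge0 //; [exact: sum_le_fnorm|exact: hL].
pose F (x : fock R) : nat -> C^o := fun j => csum (fun k => x k * f j k).
have bF y N : \sum_(j < N) normc (F y j) ^+ 2 <= M * fnorm y ^+ 2.
  have c : \sum_(j < N) normc (\sum_(k < K) y k * f j k) ^+ 2 @[K --> \oo]
      --> \sum_(j < N) normc (F y j) ^+ 2.
    apply: cvg_bigsum => j; apply: cvgM; apply: cvgc_normc; exact: asum_cvg.
  by apply: (cvgr_to_le c); apply: nearW => K; exact: hM.
have sF (x : fock R) := square_summable_bounded (bF x).
pose G (x : fock R) := Fock (sF x).
have lG : G \in bounded_linear (R := R).
  rewrite inE; split=> [a x y|].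
    apply: val_inj; apply/funext => j /=; rewrite /F.
    rewrite -[RHS]/(a * csum (fun k => x k * f j k) + csum (fun k => y k * f j k)).
    rewrite -csumZ // -csumD //; last exact: asumZ.
    by congr csum; apply/funext => k; rewrite mulrDl mulrA.
  exists (Num.sqrt `|M|) => x.
  rewrite -(@ler_pXn2r _ 2) ?nnegrE ?mulr_ge0 ?fnorm_ge0 ?sqrtr_ge0 //.
  rewrite exprMn [Num.sqrt `|M| ^+ 2]sqr_sqrtr //.
  apply: le_trans (@fnorm_le _ (G x) _ (bF x)) _.
  by rewrite ler_wpM2r ?sqr_ge0 // ler_norm.
exists (Bop lG) => j k /=; rewrite /F.
rewrite (@csum_finite _ _ k.+1) => [|n kn]; last by rewrite basisE gtn_eqF ?mul0r.
under eq_bigr do rewrite basisE mulrC eq_sym.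
by rewrite (sum_delta _ (f j)) ltnSn.
Qed.

Lemma matrix_bop f M : square_bounded f M ->
  exists A : bop R, forall j k, A (basis k) j = f j k.
Proof.
move=> h; apply: (@bop_of_matrix f M M) => [j K|x N K]; first exact: square_bounded_row h.
apply: (@le_trans _ _ (\sum_(j < N) fnorm x ^+ 2 * \sum_(k < K) normc (f j k) ^+ 2)).
  apply: ler_sum => j _.
  apply: (@le_trans _ _ ((\sum_(k < K) normc (x k) * normc (f j k)) ^+ 2)).
    apply: lerXn2r; rewrite ?nnegrE ?normc_ge0 ?sumr_ge0 //.
      by move=> k _; rewrite mulr_ge0 ?normc_ge0.
    by apply: le_trans (normc_sum _ _ _) _; apply: ler_sum => k _; rewrite normcM.
  apply: le_trans (cauchy_schwarz_real (fun k => normc (x k)) (fun k => normc (f j k)) K) _.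
  rewrite ler_wpM2r ?sum_le_fnorm // sumr_ge0 // => k _; exact: sqr_ge0.
rewrite -mulr_sumr mulrC ler_wpM2r ?sqr_ge0 // exchange_big /=; exact: h.
Qed.

Definition ent X (j k : nat) : C := X (basis k) j.

Lemma entD X Y j k : ent (X + Y) j k = ent X j k + ent Y j k. Proof. by []. Qed.
Lemma entB X Y j k : ent (X - Y) j k = ent X j k - ent Y j k. Proof. by []. Qed.
Lemma entZ c X j k : ent (c *: X) j k = c * ent X j k. Proof. by []. Qed.
Lemma ent0 j k : ent 0 j k = 0. Proof. by []. Qed.

Lemma ent_sum (I : Type) (r : seq I) (P : pred I) (F : I -> hs R) j k :
  ent (\sum_(i <- r | P i) F i) j k = \sum_(i <- r | P i) ent (F i) j k.
Proof. exact: (big_morph (fun X => ent X j k) (fun X Y => entD X Y j k) (ent0 j k)). Qed.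

Lemma ent_ext X Y : (forall j k, ent X j k = ent Y j k) -> X = Y.
Proof. by move=> h; apply: val_inj; apply: bop_ext => k j; exact: h. Qed.

Lemma hs_sqnorm_le (A : bop R) M :
  square_bounded (fun j k => A (basis k) j) M -> (hs_sqnorm A <= M%:E)%E.
Proof.
move=> h; apply: lime_le.
  by apply: is_cvg_nneseries => n _ _; exact: sqnorm_ge0.
apply: nearW => K; rewrite big_mkord.
rewrite (_ : (\sum_(k < K) _)%E = (\sum_(k < K) fnorm (A (basis k)) ^+ 2)%:E); last first.
  by rewrite -sumEFin; apply: eq_bigr => k _; rewrite fnormE.
rewrite lee_fin.
have c : \sum_(k < K) \sum_(j < N) normc (A (basis k) j) ^+ 2 @[N --> \oo]
   --> \sum_(k < K) fnorm (A (basis k)) ^+ 2.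
  by apply: cvg_bigsum => k; exact: fnorm_cvg.
by apply: (cvgr_to_le c); apply: nearW => N; exact: h.
Qed.

Lemma hs_normE X : (hs_norm X ^+ 2)%:E = hs_sqnorm X.
Proof.
have /= := valP X; rewrite inE /hs_norm => Xoo.
have X0 : (0 <= hs_sqnorm X)%E by apply: nneseries_ge0 => n _ _; exact: sqnorm_ge0.
by rewrite sqr_sqrtr ?fine_ge0 // fineK // ge0_fin_numE.
Qed.

Lemma hs_norm_ge0 X : 0 <= hs_norm X. Proof. exact: sqrtr_ge0. Qed.

Lemma ent_square_bounded X : square_bounded (ent X) (hs_norm X ^+ 2).
Proof.
move=> N K; apply: (@le_trans _ _ (\sum_(k < K) fnorm (X (basis k)) ^+ 2)).
  by apply: ler_sum => k _; exact: sum_le_fnorm.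
rewrite -lee_fin hs_normE -sumEFin.
under eq_bigr do rewrite fnormE.
rewrite -(big_mkord xpredT (fun k => sqnorm (X (basis k)))).
by apply: nneseries_lim_ge => n _ _; exact: sqnorm_ge0.
Qed.

Lemma hs_norm_sqr_le X M : square_bounded (ent X) M -> hs_norm X ^+ 2 <= M.
Proof. by move=> h; rewrite -lee_fin hs_normE; exact: hs_sqnorm_le. Qed.

Lemma hs_of f M : square_bounded f M -> exists X, forall j k, ent X j k = f j k.
Proof.
move=> h; have [A hA] := matrix_bop h.
have AX : A \in hilbert_schmidt (R := R).
  rewrite inE; apply: le_lt_trans (hs_sqnorm_le (M := M) _) (ltry _) => N K.
  by under eq_bigr do under eq_bigr do rewrite hA; exact: h.
by exists (HS AX).
Qed.

Lemma ip_asum2 X Y : asum2 (fun j k => (ent X j k)^* * ent Y j k).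
Proof.
exists (2^-1 * hs_norm X ^+ 2 + 2^-1 * hs_norm Y ^+ 2) => N K.
apply: (@le_trans _ _ (\sum_(k < K) \sum_(j < N)
    (2^-1 * normc (ent X j k) ^+ 2 + 2^-1 * normc (ent Y j k) ^+ 2))).
  apply: ler_sum => k _; apply: ler_sum => j _.
  by rewrite normcM normc_conj amgm.
under eq_bigr do rewrite big_split /= -!mulr_sumr.
rewrite big_split /= -!mulr_sumr.
by rewrite lerD // ler_wpM2l ?invr_ge0 //; exact: ent_square_bounded.
Qed.

Lemma hs_innerE X Y : hs_inner X Y = csum2 (fun j k => (ent X j k)^* * ent Y j k).
Proof. by []. Qed.

Lemma hs_innerDr X Y W : hs_inner X (Y + W) = hs_inner X Y + hs_inner X W.
Proof.
rewrite !hs_innerE -csum2D; try exact: ip_asum2.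
by congr csum2; apply/funext => j; apply/funext => k; rewrite entD mulrDr.
Qed.

Lemma hs_innerZr X c Y : hs_inner X (c *: Y) = c * hs_inner X Y.
Proof.
rewrite !hs_innerE -csum2Z; last exact: ip_asum2.
by congr csum2; apply/funext => j; apply/funext => k; rewrite entZ mulrCA.
Qed.

Lemma hs_inner_conj X Y : (hs_inner X Y)^* = hs_inner Y X.
Proof.
rewrite !hs_innerE -csum2_conj; last exact: ip_asum2.
congr csum2; apply/funext => j; apply/funext => k.
by rewrite rmorphM /= conjCK mulrC.
Qed.

Lemma hs_inner0r X : hs_inner X 0 = 0.
Proof. by rewrite -(scale0r (0 : hs R)) hs_innerZr mul0r. Qed.

Lemma hs_innerDl X Y W : hs_inner (X + Y) W = hs_inner X W + hs_inner Y W.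
Proof. by rewrite -hs_inner_conj hs_innerDr rmorphD /= !hs_inner_conj. Qed.

Lemma hs_innerZl c X Y : hs_inner (c *: X) Y = c^* * hs_inner X Y.
Proof. by rewrite -hs_inner_conj hs_innerZr rmorphM /= hs_inner_conj. Qed.

Lemma hs_inner0l X : hs_inner 0 X = 0.
Proof. by rewrite -hs_inner_conj hs_inner0r rmorph0. Qed.

Lemma hs_innerBr X Y W : hs_inner X (Y - W) = hs_inner X Y - hs_inner X W.
Proof. by rewrite hs_innerDr -scaleN1r hs_innerZr mulN1r. Qed.

Lemma hs_inner_sumr X (I : Type) (r : seq I) (P : pred I) (F : I -> hs R) :
  hs_inner X (\sum_(i <- r | P i) F i) = \sum_(i <- r | P i) hs_inner X (F i).
Proof. exact: (big_morph _ (hs_innerDr X) (hs_inner0r X)). Qed.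

Lemma hs_inner_suml X (I : Type) (r : seq I) (P : pred I) (F : I -> hs R) :
  hs_inner (\sum_(i <- r | P i) F i) X = \sum_(i <- r | P i) hs_inner (F i) X.
Proof.
exact: (big_morph (fun Y => hs_inner Y X) (fun Y W => hs_innerDl Y W X) (hs_inner0l X)).
Qed.

(** The real part is squeezed through the sums over finite rectangles; the imaginary part vanishes
    by conjugate symmetry. *)
Lemma hs_inner_self X : hs_inner X X = (hs_norm X ^+ 2)%:C.
Proof.
have E (r : nat) s : Re (\sum_(k < s) \sum_(j < r) (ent X j k)^* * ent X j k) =
    \sum_(k < s) \sum_(j < r) normc (ent X j k) ^+ 2.
  by rewrite Re_sum; under eq_bigr do rewrite Re_sum; 
    under eq_bigr do under eq_bigr do rewrite conj_mulE.
apply: complex_ext.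
  rewrite [RHS]/=; apply/eqP; rewrite eq_le; apply/andP; split.
    apply: (csum2_cvg (ip_asum2 X X)) => N K; rewrite E; exact: ent_square_bounded.
  apply: hs_norm_sqr_le => N K; rewrite -E.
  apply: (csum2_ge (ip_asum2 X X)) => j k; rewrite conj_mulE /=; exact: sqr_ge0.
by have := congr1 Im (hs_inner_conj X X); rewrite Im_conjc [Im _%:C]/=; lra.
Qed.

Lemma hs_norm_sqrE X : hs_norm X ^+ 2 = Re (hs_inner X X).
Proof. by rewrite hs_inner_self. Qed.

Lemma hs_norm_eq0 X : hs_norm X = 0 -> X = 0.
Proof.
move=> h; apply: ent_ext => j k; rewrite ent0; apply: eq0_normc.
apply/eqP; rewrite eq_le normc_ge0 andbT -(@ler_pXn2r _ 2) ?nnegrE ?normc_ge0 //.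
rewrite expr0n /=; have := ent_square_bounded X j.+1 k.+1; rewrite h expr0n /=.
apply: le_trans; rewrite big_ord_recr /= [X in _ + X]big_ord_recr /= addrA lerDr.
by rewrite addr_ge0 // ?sumr_ge0 // => i _; rewrite ?sumr_ge0 ?sqr_ge0 // => ? _; exact: sqr_ge0.
Qed.

Lemma hs_norm0 : hs_norm (0 : hs R) = 0.
Proof.
apply/eqP; rewrite -(@eqrXn2 _ 2) ?hs_norm_ge0 //; apply/eqP.
have := hs_inner_self 0; rewrite hs_inner0r expr0n => /(congr1 Re) /=.
by move=> <-.
Qed.

Lemma hs_normZ c X : hs_norm (c *: X) = normc c * hs_norm X.
Proof.
apply/eqP; rewrite -(@eqrXn2 _ 2) ?hs_norm_ge0 ?mulr_ge0 ?normc_ge0 ?hs_norm_ge0 //.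
have := hs_inner_self (c *: X); rewrite hs_innerZr hs_innerZl mulrA [c * _]mulrC.
rewrite conj_mulE hs_inner_self -rmorphM => /(congr1 Re) /= <-.
by rewrite exprMn.
Qed.

Lemma hs_norm_opp X : hs_norm (- X) = hs_norm X.
Proof. by rewrite -scaleN1r hs_normZ normc_opp normc1 mul1r. Qed.

Lemma hs_normD_sqr X Y :
  hs_norm (X + Y) ^+ 2 = hs_norm X ^+ 2 + 2 * Re (hs_inner X Y) + hs_norm Y ^+ 2.
Proof.
have := hs_inner_self (X + Y); rewrite hs_innerDr !hs_innerDl !hs_inner_self.
rewrite -[hs_inner Y X]hs_inner_conj => /(congr1 Re).
by rewrite !ReD /= => <-; case: (hs_inner X Y) => a b /=; ring.
Qed.

Lemma hs_cauchy_schwarz X Y : normc (hs_inner X Y) <= hs_norm X * hs_norm Y.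
Proof.
have [X0|X0] := eqVneq (hs_norm X) 0.
  by rewrite (hs_norm_eq0 X0) hs_inner0l normc0 mulr_ge0 ?hs_norm_ge0.
have Xp : 0 < hs_norm X by rewrite lt_def X0 hs_norm_ge0.
(* [c *: X] is minus the orthogonal projection of [Y] on the line of [X], which makes [Y + c *: X]
   as short as possible. *)
pose c := - ((hs_norm X ^+ 2)^-1)%:C * hs_inner X Y.
have := sqr_ge0 (hs_norm (Y + c *: X)).
rewrite hs_normD_sqr hs_innerZr hs_normZ /c normcM normc_opp normcR.
rewrite ger0_norm ?invr_ge0 ?sqr_ge0 //.
have -> : Re (- ((hs_norm X ^+ 2)^-1)%:C * hs_inner X Y * hs_inner Y X) =
  - ((hs_norm X ^+ 2)^-1 * normc (hs_inner X Y) ^+ 2).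
  rewrite -mulrA -[hs_inner Y X]hs_inner_conj [_ * _^*]mulrC conj_mulE mulNr -rmorphM /=.
  by [].
set t := normc _; rewrite !exprMn => h.
rewrite -(@ler_pXn2r _ 2) ?nnegrE ?mulr_ge0 ?normc_ge0 ?hs_norm_ge0 //.
rewrite exprMn -subr_ge0.
have : 0 <= hs_norm X ^+ 2 * (hs_norm Y ^+ 2 + 2 * - ((hs_norm X ^+ 2)^-1 * t ^+ 2) +
     (hs_norm X ^+ 2)^-1 ^+ 2 * t ^+ 2 * hs_norm X ^+ 2).
  by rewrite mulr_ge0 ?sqr_ge0.
congr (_ <= _); field; exact: X0.
Qed.

Lemma hs_normD X Y : hs_norm (X + Y) <= hs_norm X + hs_norm Y.
Proof.
rewrite -(@ler_pXn2r _ 2) ?nnegrE ?addr_ge0 ?hs_norm_ge0 // hs_normD_sqr.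
have h := le_trans (le_trans (ler_norm _) (normc_Re _)) (hs_cauchy_schwarz X Y).
have -> : (hs_norm X + hs_norm Y) ^+ 2 =
  hs_norm X ^+ 2 + 2 * (hs_norm X * hs_norm Y) + hs_norm Y ^+ 2 by ring.
by rewrite lerD2r lerD2l ler_wpM2l.
Qed.

Lemma hs_norm_sum (I : Type) (r : seq I) (P : pred I) (F : I -> hs R) :
  hs_norm (\sum_(i <- r | P i) F i) <= \sum_(i <- r | P i) hs_norm (F i).
Proof.
elim/big_rec2: _ => [|i x y _ h]; first by rewrite hs_norm0.
by apply: le_trans (hs_normD _ _) _; rewrite lerD2l.
Qed.

Lemma hs_pythagoras (I : eqType) (e : I -> hs R) (c : I -> C) (r : seq I) :
  uniq r -> (forall i k, hs_inner (e i) (e k) = (i == k)%:R) ->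
  hs_norm (\sum_(i <- r) c i *: e i) ^+ 2 = \sum_(i <- r) normc (c i) ^+ 2.
Proof.
move=> ur he; have := hs_inner_self (\sum_(i <- r) c i *: e i).
rewrite hs_inner_suml => /(congr1 Re) /= <-; rewrite Re_sum.
apply: eq_big_seq => i ir; rewrite hs_innerZl hs_inner_sumr (bigD1_seq i) //= big1.
  by rewrite addr0 hs_innerZr he eqxx mulr1 conj_mulE.
by move=> k ki; rewrite hs_innerZr he eq_sym (negPf ki) mulr0.
Qed.

(** The bound holds on every finite rectangle and survives the limit there. This takes the place of
    completeness: limits are found entry by entry and recognized as Hilbert-Schmidt operators by the
    bound on the norms. *)
Lemma hs_fatou (F : nat -> hs R) (f : nat -> nat -> C) (M : R) :
  (forall n, hs_norm (F n) <= M) ->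
  (forall j k, cvgc \oo (fun n => ent (F n) j k) (f j k)) ->
  exists2 X, (forall j k, ent X j k = f j k) & hs_norm X <= M.
Proof.
move=> hM hf; have M0 : 0 <= M := le_trans (hs_norm_ge0 _) (hM 0%N).
have sb : square_bounded f (M ^+ 2).
  move=> N K.
  have c : \sum_(k < K) \sum_(j < N) normc (ent (F n) j k) ^+ 2 @[n --> \oo]
      --> \sum_(k < K) \sum_(j < N) normc (f j k) ^+ 2.
    apply: cvg_bigsum => k; apply: cvg_bigsum => j; apply: cvgM; exact: cvgc_normc.
  apply: (cvgr_to_le c); apply: nearW => n.
  apply: le_trans (ent_square_bounded _ _ _) _.
  by apply: lerXn2r; rewrite ?nnegrE ?hs_norm_ge0.
have [X hX] := hs_of sb; exists X => //.
rewrite -(@ler_pXn2r _ 2) ?nnegrE ?hs_norm_ge0 //; apply: hs_norm_sqr_le => N K.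
by under eq_bigr do under eq_bigr do rewrite hX; exact: sb.
Qed.

Lemma hs_inner_cvg (T : Type) (F : set_system T) {FF : Filter F} (f : T -> hs R) X Y :
  hs_norm (f t - X) @[t --> F] --> (0 : R) ->
  cvgc F (fun t => hs_inner Y (f t)) (hs_inner Y X).
Proof.
move=> h; apply/cvgcP; apply: cvg0_le (cvg0Z (hs_norm Y) h) => t.
by rewrite normc_ge0 andTb -hs_innerBr hs_cauchy_schwarz.
Qed.

End HilbertSchmidt.

(** * Square roots of integers and of factorials *)

Section SquareRoots.
Variable R : realType.

Definition sq (n : nat) : R := Num.sqrt n%:R.
Definition sf (n : nat) : R := Num.sqrt n`!%:R.

Lemma sq0 : sq 0 = 0. Proof. exact: sqrtr0. Qed.
Lemma sq_ge0 n : 0 <= sq n. Proof. exact: sqrtr_ge0. Qed.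
Lemma sqS_gt0 n : 0 < sq n.+1. Proof. by rewrite sqrtr_gt0 ltr0n. Qed.
Lemma sqS_neq0 n : sq n.+1 != 0. Proof. by rewrite gt_eqF ?sqS_gt0. Qed.
Lemma sq_sqr n : sq n * sq n = n%:R. Proof. by rewrite -expr2 sqr_sqrtr. Qed.
Lemma sf0 : sf 0 = 1. Proof. by rewrite /sf fact0 sqrtr1. Qed.
Lemma sfS n : sf n.+1 = sq n.+1 * sf n.
Proof. by rewrite /sf factS natrM sqrtrM. Qed.
Lemma sf_gt0 n : 0 < sf n. Proof. by rewrite sqrtr_gt0 ltr0n fact_gt0. Qed.
Lemma sf_neq0 n : sf n != 0. Proof. by rewrite gt_eqF ?sf_gt0. Qed.
Lemma sf_sqr n : sf n ^+ 2 = n`!%:R. Proof. exact: sqr_sqrtr. Qed.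

Lemma sq_le n : sq n <= n%:R.
Proof.
case: n => [|n]; first by rewrite sq0.
rewrite -(@ler_pXn2r _ 2) ?nnegrE ?sq_ge0 // expr2 sq_sqr expr2 ler_peMr //.
by rewrite ler1n.
Qed.

End SquareRoots.

Arguments sq {R}.
Arguments sf {R}.

(** * The two-mode squeezing matrix and its recurrences *)

Section BogoliubovMatrix.
Variables (R : realType) (r sg : R).

(* Matrix of the two-mode squeezing operator: [U m n j k] is the coefficient
   of [p^m q^n x^j y^k] in [sg * exp (r x y + sg x p + sg y q - r p q)],
   multiplied by [sqrt (m! n! j! k!)].  The four recurrences below express the
   four partial derivatives of the exponent. *)
Fixpoint squeeze_rec (k m n j : nat) : R :=
  if k is k'.+1 then
    (r * sq j * squeeze_rec k' m n j.-1 + sg * sq n * squeeze_rec k' m n.-1 j) / sq k'.+1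
  else if m == (j + n)%N then sg * sg ^+ j * (- r) ^+ n * (sf m / (sf j * sf n)) else 0.

Definition squeeze (m n j k : nat) : R := squeeze_rec k m n j.
Local Notation U := squeeze.

Lemma squeeze_base m n j : U m n j 0 =
  if m == (j + n)%N then sg * sg ^+ j * (- r) ^+ n * (sf m / (sf j * sf n)) else 0.
Proof. by []. Qed.

Lemma squeeze_y m n j k :
  sq k.+1 * U m n j k.+1 = r * sq j * U m n j.-1 k + sg * sq n * U m n.-1 j k.
Proof. by rewrite /squeeze /= mulrC divfK ?sqS_neq0. Qed.

Lemma mul_sqS_inj k (a b : R) : sq k.+1 * a = sq k.+1 * b -> a = b.
Proof. exact: (mulfI (sqS_neq0 R k)). Qed.

(** Induction on [k], the only direction in which [squeeze] is defined by recursion. The inductive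
    step multiplies by [sq k.+1] and expresses that the derivatives in p and in y commute. *)
Lemma squeeze_p m n j k :
  sq m.+1 * U m.+1 n j k = sg * sq j * U m n j.-1 k - r * sq n * U m n.-1 j k.
Proof.
elim: k m n j => [|k IH] m n j.
  rewrite !squeeze_base; case: j => [|j]; case: n => [|n] /=; rewrite ?sq0 ?mulr0 ?mul0r.
  - by rewrite subr0.
  - rewrite !add0n eqSS; case: eqP => [->|_]; last by rewrite !mulr0 subr0.
    by rewrite !sfS !sf0 exprS; field; rewrite !sqS_neq0 sf_neq0.
  - rewrite !addn0 eqSS; case: eqP => [->|_]; last by rewrite !mulr0 subr0.
    by rewrite !sfS !sf0 exprS; field; rewrite !sqS_neq0 sf_neq0.
  rewrite addSn addnS !eqSS !addSn; case: eqP => [->|_]; last by rewrite !mulr0 subr0.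
  apply: (@mulfI _ (sq j.+1 * sq n.+1 * sf j * sf n)).
    by rewrite !mulf_neq0 ?sqS_neq0 ?sf_neq0.
  rewrite !sfS !exprS.
  (* Once the common factors are removed, the claim is (j + 1) + (n + 1) = j + n + 2, each integer
     being the square of its [sq]. *)
  have E1 := sq_sqr R (j + n).+2; have E2 := sq_sqr R j.+1; have E3 := sq_sqr R n.+1.
  have N1 := sqS_neq0 R j; have N2 := sqS_neq0 R n.
  have N3 := sf_neq0 R j; have N4 := sf_neq0 R n.
  rewrite [LHS](_ : _ = (sq (j + n).+2 * sq (j + n).+2) *
    (sg * (sg * sg ^+ j) * (- r * (- r) ^+ n) * (sq (j + n).+1 * sf (j + n)))); last first.
    by field; rewrite N1 N2 N3 N4.
  rewrite [RHS](_ : _ = (sq j.+1 * sq j.+1 + sq n.+1 * sq n.+1) *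
    (sg * (sg * sg ^+ j) * (- r * (- r) ^+ n) * (sq (j + n).+1 * sf (j + n)))); last first.
    by field; rewrite N1 N2 N3 N4.
  by rewrite E1 E2 E3 -natrD addSn addnS.
apply: (@mul_sqS_inj k).
rewrite mulrCA squeeze_y mulrBr.
transitivity (r * sq j * (sq m.+1 * U m.+1 n j.-1 k) + sg * sq n * (sq m.+1 * U m.+1 n.-1 j k)).
  by ring.
rewrite !IH.
transitivity (sg * sq j * (sq k.+1 * U m n j.-1 k.+1) - r * sq n * (sq k.+1 * U m n.-1 j k.+1)).
  by rewrite !squeeze_y; ring.
by ring.
Qed.

Lemma squeeze_q m n j k :
  sq n.+1 * U m n.+1 j k = sg * sq k * U m n j k.-1 - r * sq m * U m.-1 n j k.
Proof.
elim: k m n j => [|k IH] m n j.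
  rewrite !squeeze_base sq0 mulr0 mul0r sub0r; case: m => [|m] /=.
    by rewrite addnS sq0 !mulr0 mul0r oppr0.
  rewrite addnS eqSS; case: eqP => [->|_]; last by rewrite !mulr0 oppr0.
  by rewrite !sfS exprS; field; rewrite sqS_neq0 !sf_neq0.
apply: (@mul_sqS_inj k); rewrite mulrCA squeeze_y mulrDr.
have -> : sq n.+1 * (r * sq j * U m n.+1 j.-1 k) = r * sq j * (sq n.+1 * U m n.+1 j.-1 k) by ring.
rewrite IH [RHS]mulrBr.
have -> : sq k.+1 * (r * sq m * U m.-1 n j k.+1) = r * sq m * (sq k.+1 * U m.-1 n j k.+1) by ring.
rewrite squeeze_y /=.
(* The operator y d/dy - q d/dq acts on the generating function as multiplication by r x y + r p q.
   Its coefficients give [h], which accounts for the difference between [n + 1] in [E1] and [k + 1]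
   in [E2]. *)
have h : sq k * (r * sq j * U m n j.-1 k.-1) + sq n * (r * sq m * U m.-1 n.-1 j k) =
   (sq k * sq k - sq n * sq n) * U m n j k.
  have hk : sq k * sq k * U m n j k =
      sq k * (r * sq j * U m n j.-1 k.-1 + sg * sq n * U m n.-1 j k.-1).
    by case: k {IH} => [|k]; rewrite ?sq0 ?mul0r // -mulrA squeeze_y.
  have hn : sq n * sq n * U m n j k =
      sq n * (sg * sq k * U m n.-1 j k.-1 - r * sq m * U m.-1 n.-1 j k).
    by case: n {hk} => [|n]; rewrite ?sq0 ?mul0r // -mulrA IH.
  by rewrite mulrBl hk hn; ring.
move: h; rewrite !sq_sqr => h.
have E1 : sq n.+1 * (sg * sq n.+1 * U m n j k) = sg * (n%:R + 1) * U m n j k.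
  by rewrite natr1 -sq_sqr; ring.
have E2 : sq k.+1 * (sg * sq k.+1 * U m n j k) = sg * (k%:R + 1) * U m n j k.
  by rewrite natr1 -sq_sqr; ring.
rewrite E1 E2; apply/eqP; rewrite -subr_eq0; apply/eqP.
transitivity (sg * (sq k * (r * sq j * U m n j.-1 k.-1) +
  sq n * (r * sq m * U m.-1 n.-1 j k) - (k%:R - n%:R) * U m n j k)); first by ring.
by rewrite h subrr mulr0.
Qed.

Lemma squeeze_x m n j k :
  sq j.+1 * U m n j.+1 k = r * sq k * U m n j k.-1 + sg * sq m * U m.-1 n j k.
Proof.
elim: k m n j => [|k IH] m n j.
  rewrite !squeeze_base sq0 mulr0 mul0r add0r; case: m => [|m] /=.
    by rewrite sq0 !mulr0 mul0r.
  rewrite addSn eqSS; case: eqP => [->|_]; last by rewrite !mulr0.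
  by rewrite !sfS exprS; field; rewrite sqS_neq0 !sf_neq0.
apply: (@mul_sqS_inj k); rewrite mulrCA squeeze_y mulrDr.
have -> : sq j.+1 * (sg * sq n * U m n.-1 j.+1 k) = sg * sq n * (sq j.+1 * U m n.-1 j.+1 k) by ring.
rewrite IH [RHS]mulrDr.
have -> : sq k.+1 * (sg * sq m * U m.-1 n j k.+1) = sg * sq m * (sq k.+1 * U m.-1 n j k.+1) by ring.
rewrite squeeze_y /=.
(* Here y d/dy - x d/dx acts as multiplication by sg y q - sg x p, and [h] accounts for the
   difference between [j + 1] and [k + 1]. *)
have h : sq k * (sg * sq n * U m n.-1 j k.-1) - sq j * (sg * sq m * U m.-1 n j.-1 k) =
   (sq k * sq k - sq j * sq j) * U m n j k.
  have hk : sq k * sq k * U m n j k =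
      sq k * (r * sq j * U m n j.-1 k.-1 + sg * sq n * U m n.-1 j k.-1).
    by case: k {IH} => [|k]; rewrite ?sq0 ?mul0r // -mulrA squeeze_y.
  have hn : sq j * sq j * U m n j k =
      sq j * (r * sq k * U m n j.-1 k.-1 + sg * sq m * U m.-1 n j.-1 k).
    by case: j {hk} => [|j]; rewrite ?sq0 ?mul0r // -mulrA IH.
  by rewrite mulrBl hk hn; ring.
move: h; rewrite !sq_sqr => h.
have E1 : sq j.+1 * (r * sq j.+1 * U m n j k) = r * (j%:R + 1) * U m n j k.
  by rewrite natr1 -sq_sqr; ring.
have E2 : sq k.+1 * (r * sq k.+1 * U m n j k) = r * (k%:R + 1) * U m n j k.
  by rewrite natr1 -sq_sqr; ring.
rewrite E1 E2; apply/eqP; rewrite -subr_eq0; apply/eqP.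
transitivity (r * (sq k * (sg * sq n * U m n.-1 j k.-1) -
  sq j * (sg * sq m * U m.-1 n j.-1 k) - (k%:R - j%:R) * U m n j k)); first by ring.
by rewrite h subrr mulr0.
Qed.

(** The counterpart of [squeeze_base] under the exchange of [squeeze_sym]; the induction there
    starts by comparing the two closed forms. *)
Lemma squeeze_col0 m n j : U j 0 m n =
  if m == (j + n)%N then sg * sg ^+ j * r ^+ n * (sf m / (sf j * sf n)) else 0.
Proof.
elim: n m => [|n IH] m.
  rewrite squeeze_base !addn0 eq_sym; case: eqP => [->|//].
  by rewrite !expr0.
apply: (@mul_sqS_inj n); rewrite squeeze_y sq0 mulr0 mul0r addr0 IH.
case: m => [|m]; first by rewrite addnS sq0 !mulr0 mul0r.
rewrite addnS eqSS /=; case: eqP => [->|_]; last by rewrite !mulr0.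
by rewrite !sfS exprS; field; rewrite sqS_neq0 !sf_neq0.
Qed.

(* Exchanging (p, q) with (x, y) amounts to changing the sign of y and q. *)
Lemma squeeze_sym m n j k : U m n j k = (-1) ^+ (n + k) * U j k m n.
Proof.
elim: k m n j => [|k IH] m n j.
  rewrite squeeze_col0 squeeze_base addn0; case: ifP => _; last by rewrite mulr0.
  by rewrite (exprNn r); move: ((-1) ^+ n) => e; ring.
apply: (@mul_sqS_inj k); rewrite squeeze_y mulrCA squeeze_q !IH addnS exprS.
case: n => [|n] /=; first by rewrite sq0; move: ((-1) ^+ _) => e; ring.
by rewrite addSn exprS; move: ((-1) ^+ _) => e; ring.
Qed.

End BogoliubovMatrix.

(** * Ladder operators on arrays and their adjunctions *)

Section LadderOperators.
Variable R : realType.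
Local Notation C := R[i].
Local Notation arr := (nat -> nat -> C).
Implicit Types f g h : arr.

Definition arr_inner f g : C := csum2 (fun j k => (f j k)^* * g j k).
Definition arr_lin (a : C) f (b : C) g : arr := fun j k => a * f j k + b * g j k.
(** Creation ([cr]) and annihilation ([an]) in the first and second index. In [cr1] and [cr2] the
    factor [sq 0 = 0] cancels the value that the truncated predecessor would supply at index 0. *)
Definition cr1 f : arr := fun j k => (sq j)%:C * f j.-1 k.
Definition an1 f : arr := fun j k => (sq j.+1)%:C * f j.+1 k.
Definition cr2 f : arr := fun j k => (sq k)%:C * f j k.-1.
Definition an2 f : arr := fun j k => (sq k.+1)%:C * f j k.+1.

Lemma rapid_lin a f b g : rapid f -> rapid g -> rapid (arr_lin a f b g).
Proof. by move=> hf hg; apply: rapidD; exact: rapidZ. Qed.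

Lemma rapid_cr1 f : rapid f -> rapid (cr1 f).
Proof.
move=> /rapid_unshiftl hf; apply: rapid_weight hf _ => -[|j] k.
  by rewrite /cr1 sq0 mul0r normc0 mulr_ge0 ?normc_ge0.
rewrite normcM normcR ger0_norm ?sq_ge0 // ler_wpM2r ?normc_ge0 //.
by apply: le_trans (sq_le _ _) _; rewrite ler_nat addSn ltnS -addnS leq_addr.
Qed.

Lemma rapid_cr2 f : rapid f -> rapid (cr2 f).
Proof.
move=> /rapid_unshiftr hf; apply: rapid_weight hf _ => j [|k].
  by rewrite /cr2 sq0 mul0r normc0 mulr_ge0 ?normc_ge0.
rewrite normcM normcR ger0_norm ?sq_ge0 // ler_wpM2r ?normc_ge0 //.
by apply: le_trans (sq_le _ _) _; rewrite ler_nat leqW // leq_addl.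
Qed.

Lemma rapid_an1 f : rapid f -> rapid (an1 f).
Proof.
move=> /rapid_shiftl hf; apply: rapid_weight hf _ => j k.
rewrite normcM normcR ger0_norm ?sq_ge0 // ler_wpM2r ?normc_ge0 //.
by apply: le_trans (sq_le _ _) _; rewrite ler_nat ltnS leq_addr.
Qed.

Lemma rapid_an2 f : rapid f -> rapid (an2 f).
Proof.
move=> /rapid_shiftr hf; apply: rapid_weight hf _ => j k.
rewrite normcM normcR ger0_norm ?sq_ge0 // ler_wpM2r ?normc_ge0 //.
by apply: le_trans (sq_le _ _) _; rewrite ler_nat ltnS leq_addl.
Qed.

Lemma arr_inner_asum2 f g : rapid f -> rapid g -> asum2 (fun j k => (f j k)^* * g j k).
Proof. by move=> hf hg; apply: rapid_asum2; apply: rapidM => //; exact: rapid_conj. Qed.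

Lemma arr_inner_linr a f b g h : rapid f -> rapid g -> rapid h ->
  arr_inner h (arr_lin a f b g) = a * arr_inner h f + b * arr_inner h g.
Proof.
move=> hf hg hh; rewrite -!csum2Z -?csum2D; try by apply: arr_inner_asum2.
- by congr csum2; apply/funext => j; apply/funext => k; rewrite mulrDr mulrCA [X in _ + X]mulrCA.
- by apply: asum2Z; exact: arr_inner_asum2.
- by apply: asum2Z; exact: arr_inner_asum2.
Qed.

Lemma arr_inner_conj f g : rapid f -> rapid g -> (arr_inner f g)^* = arr_inner g f.
Proof.
move=> hf hg; rewrite -csum2_conj; last exact: arr_inner_asum2.
congr csum2; apply/funext => j; apply/funext => k.
by rewrite rmorphM /= conjCK mulrC.
Qed.

Lemma arr_inner_linl a f b g h : rapid f -> rapid g -> rapid h ->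
  arr_inner (arr_lin a f b g) h = a^* * arr_inner f h + b^* * arr_inner g h.
Proof.
move=> hf hg hh; rewrite -arr_inner_conj //; last exact: rapid_lin.
by rewrite arr_inner_linr // rmorphD !rmorphM /= !arr_inner_conj.
Qed.

Lemma arr_inner_cr1 f g : rapid f -> rapid g -> arr_inner (cr1 f) g = arr_inner f (an1 g).
Proof.
move=> hf hg; rewrite /arr_inner csum2_shiftl.
- congr csum2; apply/funext => j; apply/funext => k.
  by rewrite /cr1 /an1 rmorphM /= conj_real mulrA [_ * (f _ _)^*]mulrC.
- by apply: arr_inner_asum2 => //; exact: rapid_cr1.
by move=> k; rewrite /cr1 sq0 mul0r rmorph0 mul0r.
Qed.

Lemma arr_inner_cr2 f g : rapid f -> rapid g -> arr_inner (cr2 f) g = arr_inner f (an2 g).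
Proof.
move=> hf hg; rewrite /arr_inner csum2_shiftr.
- congr csum2; apply/funext => j; apply/funext => k.
  by rewrite /cr2 /an2 rmorphM /= conj_real mulrA [_ * (f _ _)^*]mulrC.
- by apply: arr_inner_asum2 => //; exact: rapid_cr2.
by move=> k; rewrite /cr2 sq0 mul0r rmorph0 mul0r.
Qed.

Lemma arr_inner_an2 f g : rapid f -> rapid g -> arr_inner (an2 f) g = arr_inner f (cr2 g).
Proof.
move=> hf hg; rewrite -arr_inner_conj //; last exact: rapid_an2.
by rewrite -arr_inner_cr2 // arr_inner_conj //; exact: rapid_cr2.
Qed.

Lemma arr_inner_an1 f g : rapid f -> rapid g -> arr_inner (an1 f) g = arr_inner f (cr1 g).
Proof.
move=> hf hg; rewrite -arr_inner_conj //; last exact: rapid_an1.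
by rewrite -arr_inner_cr1 // arr_inner_conj //; exact: rapid_cr1.
Qed.

(** Each relation lowers both indices together. Off the diagonal one of them reaches 0 first and the
    factor [sq 0] kills the entry; on the diagonal the two factors cancel. *)
Lemma ladder_gram (G : nat -> nat -> C) :
  (forall m m', (sq m.+1)%:C * G m.+1 m' = (sq m')%:C * G m m'.-1) ->
  (forall m m', (sq m'.+1)%:C * G m m'.+1 = (sq m)%:C * G m.-1 m') ->
  forall m m', G m m' = (m == m')%:R * G 0%N 0%N.
Proof.
move=> h1 h2.
have inj m (a b : C) : (sq m.+1)%:C * a = (sq m.+1)%:C * b -> a = b.
  by apply: mulfI; rewrite fmorph_eq0 sqS_neq0.
elim=> [|m IH] [|m'].
- by rewrite mul1r.
- by apply: (@inj m'); rewrite h2 sq0 mul0r mulrA !mulr0 mul0r.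
- by apply: (@inj m); rewrite h1 sq0 mul0r mulrA !mulr0 mul0r.
rewrite eqSS; have [<-|ne] := eqVneq m m'.
  by apply: (@inj m); rewrite h1 /= IH eqxx.
by apply: (@inj m); rewrite h1 /= IH (negPf ne) !mul0r !mulr0.
Qed.

End LadderOperators.

(** * Orthonormality of the columns of the squeezing matrix *)

Section SqueezedBasis.
Variables (R : realType) (r sg : R).
Hypotheses (r0 : 0 < r) (r1 : r < 1) (sg0 : 0 < sg) (sgE : sg ^+ 2 = 1 - r ^+ 2).
Local Notation C := R[i].
Local Notation U := (squeeze r sg).

Definition squeeze_arr (m n j k : nat) : C := (U m n j k)%:C.
Local Notation u := squeeze_arr.

Lemma squeeze_ground j k : U 0 0 j k = if j == k then sg * r ^+ k else 0.
Proof.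
elim: k j => [|k IH] j.
  rewrite squeeze_base addn0 eq_sym; case: eqP => [->|//].
  by rewrite !expr0 sf0; field.
apply: (@mul_sqS_inj R k); rewrite squeeze_y sq0 mulr0 mul0r addr0 IH.
case: j => [|j] /=; first by rewrite sq0 !mulr0 mul0r.
rewrite eqSS; case: eqP => [->|_]; last by rewrite !mulr0.
by rewrite exprS; ring.
Qed.

(** Here and in the next three lemmas, Bogoliubov combinations (a ladder operator in one index minus
    [r] times the opposite one in the other index) act on the columns as ladder operators in [m] or
    [n]. The relation [sgE] between [r] and [sg] is what makes the two creation identities close. *)
Lemma u_creation1 m n :
  arr_lin 1 (cr1 (u m n)) (- r%:C) (an2 (u m n)) =
  arr_lin (sg * sq m.+1)%:C (u m.+1 n) 0 (u m n).
Proof.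
apply/funext => j; apply/funext => k; rewrite /arr_lin /cr1 /an2 /u mul0r addr0 mul1r.
rewrite -!rmorphM mulNr -!rmorphM -rmorphB; congr (_%:C).
rewrite -[RHS]mulrA squeeze_p squeeze_y.
transitivity ((1 - r ^+ 2) * (sq j * U m n j.-1 k) - r * sg * sq n * U m n.-1 j k); first by ring.
by rewrite -sgE; ring.
Qed.

Lemma u_creation2 m n :
  arr_lin 1 (cr2 (u m n)) (- r%:C) (an1 (u m n)) =
  arr_lin (sg * sq n.+1)%:C (u m n.+1) 0 (u m n).
Proof.
apply/funext => j; apply/funext => k; rewrite /arr_lin /cr2 /an1 /u mul0r addr0 mul1r.
rewrite -!rmorphM mulNr -!rmorphM -rmorphB; congr (_%:C).
rewrite -[RHS]mulrA squeeze_q squeeze_x.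
transitivity ((1 - r ^+ 2) * (sq k * U m n j k.-1) - r * sg * sq m * U m.-1 n j k); first by ring.
by rewrite -sgE; ring.
Qed.

Lemma u_annihilation1 m n :
  arr_lin 1 (an1 (u m n)) (- r%:C) (cr2 (u m n)) =
  arr_lin (sg * sq m)%:C (u m.-1 n) 0 (u m n).
Proof.
apply/funext => j; apply/funext => k; rewrite /arr_lin /cr2 /an1 /u mul0r addr0 mul1r.
rewrite -!rmorphM mulNr -!rmorphM -rmorphB; congr (_%:C).
by rewrite squeeze_x; ring.
Qed.

Lemma u_annihilation2 m n :
  arr_lin 1 (an2 (u m n)) (- r%:C) (cr1 (u m n)) =
  arr_lin (sg * sq n)%:C (u m n.-1) 0 (u m n).
Proof.
apply/funext => j; apply/funext => k; rewrite /arr_lin /cr1 /an2 /u mul0r addr0 mul1r.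
rewrite -!rmorphM mulNr -!rmorphM -rmorphB; congr (_%:C).
by rewrite squeeze_y; ring.
Qed.

(** The array is diagonal with entries [sg * r ^+ k]; since j + k = 2k there, its rate in j + k is
    the square root of [r]. *)
Lemma rapid_ground : rapid (u 0 0).
Proof.
exists sg, (Num.sqrt r); split; first exact: sqrtr_ge0.
  by rewrite -(sqrtr1 R) ltr_sqrt.
move=> j k; rewrite /u squeeze_ground normcR; case: eqP => [->|_]; last first.
  by rewrite normr0 mulr_ge0 ?exprn_ge0 ?sqrtr_ge0 // ltW.
rewrite addnn -mul2n exprM sqr_sqrtr; last exact: ltW.
by rewrite ger0_norm // mulr_ge0 ?exprn_ge0 // ltW.
Qed.

Lemma rapid_of_scaled (f g : nat -> nat -> C) c :
  c != 0 -> rapid (arr_lin c f 0 g) -> rapid f.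
Proof.
move=> c0 /(rapidZ c^-1); apply: rapid_le => j k.
by rewrite /arr_lin mul0r addr0 mulKf.
Qed.

Lemma scale_neq0 n : (sg * sq n.+1)%:C != 0 :> C.
Proof. by rewrite fmorph_eq0 mulf_neq0 ?sqS_neq0 // gt_eqF. Qed.

(** Decay spreads from the ground array through the transformed creation operators, without any
    estimate of the entries. *)
Lemma rapid_u m n : rapid (u m n).
Proof.
elim: n m => [|n IH] m.
  elim: m => [|m IH]; first exact: rapid_ground.
  apply: (rapid_of_scaled (scale_neq0 m) (g := u m 0)).
  by rewrite -u_creation1; apply: rapid_lin; [exact: rapid_cr1|exact: rapid_an2].
apply: (rapid_of_scaled (scale_neq0 n) (g := u m n)).
by rewrite -u_creation2; apply: rapid_lin; [exact: rapid_cr2|exact: rapid_an1].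
Qed.

Lemma arr_inner_scalel (c : R) f f' g : rapid f -> rapid f' -> rapid g ->
  arr_inner (arr_lin c%:C f 0 f') g = c%:C * arr_inner f g.
Proof.
move=> hf hf' hg; rewrite arr_inner_linl // conj_real.
by rewrite conj0 mul0r addr0.
Qed.

Lemma arr_inner_scaler (c : R) f g g' : rapid f -> rapid g -> rapid g' ->
  arr_inner f (arr_lin c%:C g 0 g') = c%:C * arr_inner f g.
Proof. by move=> hf hg hg'; rewrite arr_inner_linr // mul0r addr0. Qed.

Let conjr : (- r%:C : C)^* = - r%:C. Proof. by rewrite conjN conj_real. Qed.

Lemma arr_inner_bogoliubov1 f g : rapid f -> rapid g ->
  arr_inner (arr_lin 1 (cr1 f) (- r%:C) (an2 f)) g =
  arr_inner f (arr_lin 1 (an1 g) (- r%:C) (cr2 g)).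
Proof.
move=> hf hg.
have h1 := rapid_cr1 hf; have h2 := rapid_an2 hf.
have h3 := rapid_an1 hg; have h4 := rapid_cr2 hg.
rewrite (arr_inner_linl _ _ h1 h2 hg) (arr_inner_linr _ _ h3 h4 hf).
by rewrite (arr_inner_cr1 hf hg) (arr_inner_an2 hf hg) conj1 conjr.
Qed.

Lemma arr_inner_bogoliubov2 f g : rapid f -> rapid g ->
  arr_inner (arr_lin 1 (cr2 f) (- r%:C) (an1 f)) g =
  arr_inner f (arr_lin 1 (an2 g) (- r%:C) (cr1 g)).
Proof.
move=> hf hg.
have h1 := rapid_cr2 hf; have h2 := rapid_an1 hf.
have h3 := rapid_an2 hg; have h4 := rapid_cr1 hg.
rewrite (arr_inner_linl _ _ h1 h2 hg) (arr_inner_linr _ _ h3 h4 hf).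
by rewrite (arr_inner_cr2 hf hg) (arr_inner_an1 hf hg) conj1 conjr.
Qed.

Lemma scaled_mulI (a b : R) (x y : C) : (sg * a)%:C * x = (sg * b)%:C * y ->
  a%:C * x = b%:C * y.
Proof.
have s0 : sg%:C != 0 :> C by rewrite fmorph_eq0 gt_eqF.
by rewrite !rmorphM -!mulrA => /(mulfI s0).
Qed.

(** The transformed creation operator, moved to the other argument, becomes the transformed
    annihilation operator. *)
Lemma u_gram1 n n' m m' :
  (sq m.+1)%:C * arr_inner (u m.+1 n) (u m' n') = (sq m')%:C * arr_inner (u m n) (u m'.-1 n').
Proof.
have := arr_inner_bogoliubov1 (rapid_u m n) (rapid_u m' n').
rewrite u_creation1 u_annihilation1 arr_inner_scalel; try exact: rapid_u.
by rewrite arr_inner_scaler; try exact: rapid_u; exact: scaled_mulI.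
Qed.

Lemma u_gram2 m m' n n' :
  (sq n.+1)%:C * arr_inner (u m n.+1) (u m' n') = (sq n')%:C * arr_inner (u m n) (u m' n'.-1).
Proof.
have := arr_inner_bogoliubov2 (rapid_u m n) (rapid_u m' n').
rewrite u_creation2 u_annihilation2 arr_inner_scalel; try exact: rapid_u.
by rewrite arr_inner_scaler; try exact: rapid_u; exact: scaled_mulI.
Qed.

Lemma arr_inner_u_conj m n m' n' :
  (arr_inner (u m n) (u m' n'))^* = arr_inner (u m' n') (u m n).
Proof. by apply: arr_inner_conj; exact: rapid_u. Qed.

Lemma conj_scaled (a b : R) (x y : C) : a%:C * x = b%:C * y -> a%:C * x^* = b%:C * y^*.
Proof.
by move=> /(congr1 (fun z : C => z^*)); rewrite !conjM !conj_real.
Qed.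

Lemma u_gram1_sym n n' m m' :
  (sq m'.+1)%:C * arr_inner (u m n) (u m'.+1 n') = (sq m)%:C * arr_inner (u m.-1 n) (u m' n').
Proof. by have := conj_scaled (u_gram1 n' n m' m); rewrite !arr_inner_u_conj. Qed.

Lemma u_gram2_sym m m' n n' :
  (sq n'.+1)%:C * arr_inner (u m n) (u m' n'.+1) = (sq n)%:C * arr_inner (u m n.-1) (u m' n').
Proof. by have := conj_scaled (u_gram2 m' m n' n); rewrite !arr_inner_u_conj. Qed.

Lemma u_ground_norm : arr_inner (u 0 0) (u 0 0) = 1.
Proof.
have rE : 1 - r ^+ 2 != 0 by rewrite -sgE expf_neq0 // gt_eqF.
rewrite /arr_inner /csum2.
have col k : csum (fun j => (u 0 0 j k)^* * u 0 0 j k) = ((sg * r ^+ k) ^+ 2)%:C.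
  rewrite (@csum_finite _ _ k.+1) => [|j kj]; last first.
    by rewrite /u squeeze_ground gtn_eqF // mulr0.
  rewrite big_ord_recr /= big1 ?add0r => [|i _]; last first.
    by rewrite /u squeeze_ground ltn_eqF // mulr0.
  by rewrite /u squeeze_ground eqxx conj_real -rmorphM expr2.
under eq_fun do rewrite col.
have geo N : \sum_(n < N) (sg * r ^+ n) ^+ 2 = 1 - (r ^+ 2) ^+ N.
  rewrite -[RHS]opprB subrX1 -mulNr opprB -sgE mulr_sumr; apply: eq_bigr => i _.
  by rewrite exprMn -!exprM mulnC.
have r21 : r ^+ 2 < 1 by rewrite expr_lt1 // ltW.
apply: csum_unique.
  exists 1 => N; under eq_bigr do rewrite normcR ger0_norm ?sqr_ge0 //.
  by rewrite geo gerBl exprn_ge0 // sqr_ge0.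
apply: cvgc_ext (_ : cvgc _ (fun N => (1 - (r ^+ 2) ^+ N)%:C) _) => [N|].
  by rewrite -geo rmorph_sum.
rewrite -[1 in X in cvgc _ _ X](rmorph1 (real_complex R)); apply: cvgc_real.
suff : 1 - (r ^+ 2) ^+ N @[N --> \oo] --> 1 - (0 : R) by rewrite subr0.
apply: cvgB; first exact: cvg_cst.
by apply: cvg_expr; rewrite ger0_norm ?sqr_ge0.
Qed.

Lemma u_orthonormal m n m' n' :
  arr_inner (u m n) (u m' n') = ((m, n) == (m', n'))%:R.
Proof.
rewrite (@ladder_gram R (fun m m' => arr_inner (u m n) (u m' n'))); last first.
- by move=> a b; exact: u_gram1_sym.
- by move=> a b; exact: u_gram1.
rewrite (@ladder_gram R (fun n n' => arr_inner (u 0 n) (u 0 n'))); last first.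
- by move=> a b; exact: u_gram2_sym.
- by move=> a b; exact: u_gram2.
by rewrite u_ground_norm mulr1 -natrM mulnb.
Qed.

End SqueezedBasis.

(** * Bounded functionals, Bessel's identity and matrix units *)

Section BoundedFunctionals.
Variable R : realType.
Local Notation C := R[i].
Implicit Types X Y : hs R.

Definition hs_of_arr (f : nat -> nat -> C) : hs R :=
  xget 0 [set X : hs R | forall j k, ent X j k = f j k].

Lemma hs_of_arrE f M : square_bounded f M -> forall j k, ent (hs_of_arr f) j k = f j k.
Proof.
by move=> /hs_of hX; apply: (@xgetPex _ 0 [set X : hs R | forall j k, ent X j k = f j k]).
Qed.

Lemma rapid_square_bounded (f : nat -> nat -> C) : rapid f -> exists M, square_bounded f M.
Proof.
move=> hf; have [M hM] := arr_inner_asum2 hf hf; exists M => N K.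
apply: le_trans (hM N K); apply: ler_sum => k _; apply: ler_sum => j _.
by rewrite normcM normc_conj expr2.
Qed.

Lemma ent_rapid (f : nat -> nat -> C) : rapid f -> forall j k, ent (hs_of_arr f) j k = f j k.
Proof. by move=> /rapid_square_bounded [M]; exact: hs_of_arrE. Qed.

Lemma hs_inner_rapid (f g : nat -> nat -> C) : rapid f -> rapid g ->
  hs_inner (hs_of_arr f) (hs_of_arr g) = arr_inner f g.
Proof.
move=> hf hg; rewrite hs_innerE; congr csum2; apply/funext => j; apply/funext => k.
by rewrite !ent_rapid.
Qed.

Definition hs_orthonormal (I : eqType) (e : I -> hs R) : Prop :=
  forall i k, hs_inner (e i) (e k) = (i == k)%:R.

Lemma bessel_identity (I : eqType) (e : I -> hs R) (r : seq I) X :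
  hs_orthonormal e -> uniq r ->
  hs_norm (X - \sum_(i <- r) hs_inner (e i) X *: e i) ^+ 2 =
  hs_norm X ^+ 2 - \sum_(i <- r) normc (hs_inner (e i) X) ^+ 2.
Proof.
move=> oe ur; rewrite hs_normD_sqr hs_norm_opp (hs_pythagoras _ ur oe).
rewrite -scaleN1r hs_innerZr hs_inner_sumr mulN1r.
have -> : \sum_(i <- r) hs_inner X (hs_inner (e i) X *: e i) =
    (\sum_(i <- r) normc (hs_inner (e i) X) ^+ 2)%:C.
  rewrite rmorph_sum; apply: eq_bigr => i _.
  by rewrite hs_innerZr -(hs_inner_conj (e i) X) mulrC conj_mulE.
by rewrite -rmorphN [Re _]/=; ring.
Qed.

Definition bounded_functional (phi : hs R -> C) : Prop :=
  (forall c X Y, phi (c *: X + Y) = c * phi X + phi Y) /\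
  exists M, forall X, normc (phi X) <= M * hs_norm X.

Lemma functional0 phi : bounded_functional phi -> phi 0 = 0.
Proof.
move=> [l _]; have := l (-1) 0 0.
by rewrite scaler0 addr0 mulN1r addNr.
Qed.

Lemma functionalD phi X Y : bounded_functional phi -> phi (X + Y) = phi X + phi Y.
Proof. by move=> [l _]; rewrite -{1}[X]scale1r l mul1r. Qed.

Lemma functionalZ phi c X : bounded_functional phi -> phi (c *: X) = c * phi X.
Proof. by move=> hp; rewrite -[c *: X]addr0 hp.1 functional0 // addr0. Qed.

Lemma functionalB phi X Y : bounded_functional phi -> phi (X - Y) = phi X - phi Y.
Proof. by move=> hp; rewrite functionalD // -scaleN1r functionalZ // mulN1r. Qed.

Lemma functional_sum phi (I : Type) (r : seq I) (P : pred I) (F : I -> hs R) :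
  bounded_functional phi ->
  phi (\sum_(i <- r | P i) F i) = \sum_(i <- r | P i) phi (F i).
Proof.
move=> hp; exact: (big_morph phi (fun X Y => functionalD X Y hp) (functional0 hp)).
Qed.

Lemma inner_functional X : bounded_functional (hs_inner X).
Proof.
split=> [c Y W|]; first by rewrite hs_innerDr hs_innerZr.
by exists (hs_norm X) => Y; exact: hs_cauchy_schwarz.
Qed.

(** Subtracting a finite projection does not change [phi X], so by Bessel's identity every finite
    sum of squared coefficients falls short of the squared norm by at least (|phi X| / M)^2. The
    last hypothesis is Parseval's identity for [X], phrased through upper bounds of finite sums, and
    it forces this gap to be 0. *)
Lemma functional_eq0_parseval (I : eqType) (e : I -> hs R) phi X :
  bounded_functional phi -> hs_orthonormal e -> (forall i, phi (e i) = 0) ->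
  (forall M : R, (forall r : seq I, uniq r ->
      \sum_(i <- r) normc (hs_inner (e i) X) ^+ 2 <= M) -> hs_norm X ^+ 2 <= M) ->
  phi X = 0.
Proof.
move=> hp oe pe hX; apply: eq0_normc; apply/eqP; rewrite eq_le normc_ge0 andbT.
have [_ [M0 hM0]] := hp; pose M := `|M0| + 1.
have Mp : 0 < M by rewrite ltr_wpDl.
have hM Y : normc (phi Y) <= M * hs_norm Y.
  apply: le_trans (hM0 Y) _; rewrite ler_wpM2r ?hs_norm_ge0 //.
  by apply: le_trans (ler_norm _) _; rewrite lerDl.
have key (r : seq I) : uniq r -> \sum_(i <- r) normc (hs_inner (e i) X) ^+ 2 <=
    hs_norm X ^+ 2 - (normc (phi X) / M) ^+ 2.
  move=> ur; rewrite lerBrDr -lerBrDl -(bessel_identity X oe ur).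
  apply: lerXn2r; rewrite ?nnegrE ?hs_norm_ge0 ?divr_ge0 ?normc_ge0 ?(ltW Mp) //.
  rewrite ler_pdivrMr // mulrC.
  have <- : phi (X - \sum_(i <- r) hs_inner (e i) X *: e i) = phi X.
    rewrite functionalB // functional_sum // big1 ?subr0 // => i _.
    by rewrite functionalZ // pe mulr0.
  exact: hM.
have := hX _ key; rewrite lerDl oppr_ge0 => h.
have h0 : (normc (phi X) / M) ^+ 2 = 0 by apply/eqP; rewrite eq_le h sqr_ge0.
move/eqP: h0; rewrite expf_eq0 /= mulf_eq0 invr_eq0 (gt_eqF Mp) orbF => /eqP ->.
exact: lexx.
Qed.

Lemma csum2_single (f : nat -> nat -> C) j0 k0 :
  (forall j k, (j, k) != (j0, k0) -> f j k = 0) -> csum2 f = f j0 k0.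
Proof.
move=> h; rewrite /csum2.
have col k : csum (fun j => f j k) = if k == k0 then f j0 k0 else 0.
  case: eqP => [->|/eqP ne]; last first.
    by rewrite csum0 // => j; rewrite h // xpair_eqE (negPf ne) andbF.
  rewrite (@csum_finite _ _ j0.+1) => [|j jj]; last first.
    by rewrite h // xpair_eqE gtn_eqF.
  rewrite big_ord_recr /= big1 ?add0r // => i _.
  by rewrite h // xpair_eqE ltn_eqF.
rewrite (@csum_finite _ _ k0.+1) => [|k kk]; last by rewrite col gtn_eqF.
rewrite big_ord_recr /= big1 ?add0r => [|i _]; first by rewrite col eqxx.
by rewrite col ltn_eqF.
Qed.

Definition unit_arr (p : nat * nat) (j k : nat) : C := ((j, k) == p)%:R.
Definition unit_hs p : hs R := hs_of_arr (unit_arr p).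

Lemma ent_unit p j k : ent (unit_hs p) j k = ((j, k) == p)%:R.
Proof.
case: p => j0 k0.
suff sb : square_bounded (unit_arr (j0, k0)) 1 by rewrite (hs_of_arrE sb).
move=> N K.
have bound n (c : nat) : \sum_(i < n) ((i == c :> nat)%:R : R) <= 1.
  elim: n => [|n IH]; first by rewrite big_ord0.
  rewrite big_ord_recr /=; have [->|_] := eqVneq n c; last by rewrite addr0.
  by rewrite big1 ?add0r // => i _; rewrite ltn_eqF.
apply: (@le_trans _ _ (\sum_(k < K) (k == k0 :> nat)%:R)); last exact: bound.
apply: ler_sum => k1 _.
have -> : \sum_(j1 < N) normc (unit_arr (j0, k0) j1 k1) ^+ 2 =
    (\sum_(j1 < N) (j1 == j0 :> nat)%:R) * (k1 == k0 :> nat)%:R.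
  rewrite mulr_suml; apply: eq_bigr => j1 _; rewrite /unit_arr xpair_eqE.
  by case: (_ == _); case: (_ == _); rewrite ?normc1 ?normc0 ?expr1n ?expr0n ?mulr0 ?mulr1.
by rewrite ler_piMl ?bound.
Qed.

Lemma hs_inner_unit p X : hs_inner (unit_hs p) X = ent X p.1 p.2.
Proof.
case: p => j0 k0; rewrite hs_innerE (@csum2_single _ j0 k0) => [|j k /negPf ne].
  by rewrite ent_unit eqxx conj1 mul1r.
by rewrite ent_unit ne conj0 mul0r.
Qed.

Lemma unit_orthonormal : hs_orthonormal unit_hs.
Proof. by move=> i k; rewrite hs_inner_unit ent_unit -surjective_pairing. Qed.

Definition grid N K : seq (nat * nat) := [seq (j, k) | j <- iota 0 N, k <- iota 0 K].

Lemma grid_uniq N K : uniq (grid N K).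
Proof. by apply: allpairs_uniq; rewrite ?iota_uniq // => -[? ?] [? ?]. Qed.

Lemma sum_grid N K (F : nat * nat -> R) :
  \sum_(p <- grid N K) F p = \sum_(k < K) \sum_(j < N) F (nat_of_ord j, nat_of_ord k).
Proof.
have E n : iota 0 n = index_iota 0 n by rewrite /index_iota subn0.
rewrite big_allpairs exchange_big !E big_mkord.
by apply: eq_bigr => k _; rewrite big_mkord.
Qed.

Lemma functional_eq0_unit phi : bounded_functional phi ->
  (forall p, phi (unit_hs p) = 0) -> forall X, phi X = 0.
Proof.
move=> hp pe X; apply: (functional_eq0_parseval hp unit_orthonormal pe) => M hM.
apply: hs_norm_sqr_le => N K; have := hM _ (grid_uniq N K).
by rewrite sum_grid; under eq_bigr do under eq_bigr do rewrite hs_inner_unit.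
Qed.

End BoundedFunctionals.

(** * Completeness of the squeezed basis *)

Section SqueezedBasisComplete.
Variables (R : realType) (r sg : R).
Hypotheses (r0 : 0 < r) (r1 : r < 1) (sg0 : 0 < sg) (sgE : sg ^+ 2 = 1 - r ^+ 2).
Local Notation C := R[i].
Local Notation U := (squeeze r sg).

Definition sqb (p : nat * nat) : hs R := hs_of_arr (squeeze_arr r sg p.1 p.2).

Lemma ent_sqb m n j k : ent (sqb (m, n)) j k = (U m n j k)%:C.
Proof. by rewrite ent_rapid //; exact: rapid_u. Qed.

Lemma sqb_orthonormal : hs_orthonormal sqb.
Proof.
by move=> [m n] [m' n']; rewrite hs_inner_rapid ?u_orthonormal //; exact: rapid_u.
Qed.

Lemma sqb_norm p : hs_norm (sqb p) ^+ 2 = 1.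
Proof. by rewrite hs_norm_sqrE sqb_orthonormal eqxx. Qed.

(** By [squeeze_sym], the coefficients of the matrix unit at [(j, k)] have the same moduli as the
    entries of [sqb (j, k)], whose squares sum to 1; hence the matrix units satisfy the Parseval
    hypothesis. *)
Lemma functional_eq0 phi : bounded_functional phi ->
  (forall p, phi (sqb p) = 0) -> forall X, phi X = 0.
Proof.
move=> hp pe; apply: functional_eq0_unit => // -[j k].
apply: (functional_eq0_parseval hp sqb_orthonormal pe) => M hM.
have -> : hs_norm (unit_hs R (j, k)) ^+ 2 = hs_norm (sqb (j, k)) ^+ 2.
  by rewrite sqb_norm hs_norm_sqrE unit_orthonormal eqxx.
apply: hs_norm_sqr_le => N K; have := hM _ (grid_uniq N K); rewrite sum_grid.
congr (_ <= _); apply: eq_bigr => n _; apply: eq_bigr => m _.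
rewrite -hs_inner_conj normc_conj hs_inner_unit !ent_sqb squeeze_sym.
by rewrite !normcR normrM normrX normrN1 expr1n mul1r.
Qed.

Lemma hs_eq0 X : (forall p, hs_inner (sqb p) X = 0) -> X = 0.
Proof.
move=> h; apply: hs_norm_eq0; apply/eqP; rewrite -sqrf_eq0.
rewrite hs_norm_sqrE (functional_eq0 (inner_functional X)) // => p.
by rewrite -hs_inner_conj h conj0.
Qed.

End SqueezedBasisComplete.

(** * Geometric bounds from a ratio test *)

Section GeometricBounds.
Variable R : realType.
Local Notation C := R[i].

(** The rate [4^-1] is chosen to split as [2^-1 * 2^-1]: Weyl vectors share it between two indices,
    and homogeneous parts are bounded through their squared norms. [K] dominates the finitely many
    terms to which the ratio test does not yet apply. *)
Lemma eventually_geometric (a rho : nat -> R) (N : nat) :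
  (forall n, 0 <= a n) -> (forall n, a n.+1 <= rho n * a n) ->
  (forall n, (N <= n)%N -> rho n <= 4^-1) ->
  exists2 K, 0 <= K & forall n, a n <= K * 4^-1 ^+ n.
Proof.
move=> a0 ha hr; pose K := \sum_(i < N.+1) a i * 4 ^+ i.
have t0 i : 0 <= a i * 4 ^+ i by rewrite mulr_ge0 // exprn_ge0.
have K0 : 0 <= K by apply: sumr_ge0.
have small n : (n <= N)%N -> a n <= K * 4^-1 ^+ n.
  move=> nN; rewrite exprVn ler_pdivlMr ?exprn_gt0 //.
  by rewrite /K (bigD1 (Ordinal (nN : (n < N.+1)%N))) //= lerDl sumr_ge0.
exists K => //; elim=> [|n IH]; first exact: small.
have [nN|Nn] := ltnP n N; first exact: small.
apply: le_trans (ha n) _; rewrite exprS mulrCA.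
apply: le_trans (_ : 4^-1 * a n <= _); first by rewrite ler_wpM2r ?hr.
by rewrite ler_wpM2l ?invr_ge0.
Qed.

Lemma exp_coeff_geometric (s : R) : 0 <= s ->
  exists2 Q, 0 <= Q & forall K, s ^+ K / K`!%:R <= Q * 4^-1 ^+ K.
Proof.
move=> s0; pose N := Num.Def.archi_bound (4 * s).
apply: (@eventually_geometric (fun K => s ^+ K / K`!%:R) (fun n => s / n.+1%:R) N) => n.
- by rewrite mulr_ge0 ?exprn_ge0 ?invr_ge0.
- by rewrite factS natrM invfM exprS mulrACA.
move=> Nn; rewrite ler_pdivrMr ?ltr0n // mulrC ler_pdivlMr // mulrC.
apply: ltW; apply: lt_le_trans (archi_boundP _) _; first by rewrite mulr_ge0.
by rewrite ler_nat leqW.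
Qed.

Lemma csum_geometric (f : nat -> C) (c : R) :
  (forall n, normc (f n) <= c * 2^-1 ^+ n) ->
  asum f /\ forall m, normc (csum f - \sum_(n < m) f n) <= 2 * c * 2^-1 ^+ m.
Proof.
move=> hf; have c0 : 0 <= c.
  by have := hf 0%N; rewrite expr0 mulr1; apply: le_trans (normc_ge0 _).
have geo m N : \sum_(n < N) (2^-1 : R) ^+ (m + n) <= 2 * 2^-1 ^+ m.
  have -> : \sum_(n < N) (2^-1 : R) ^+ (m + n) = 2 * 2^-1 ^+ m - 2 * 2^-1 ^+ (m + N).
    elim: N => [|N IH]; first by rewrite big_ord0 addn0 subrr.
    by rewrite big_ord_recr /= IH addnS exprS; field.
  by rewrite gerBl mulr_ge0 ?exprn_ge0 ?invr_ge0.
have af : asum f.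
  exists (2 * c) => N; apply: (@le_trans _ _ (\sum_(n < N) c * 2^-1 ^+ (0 + n))).
    by apply: ler_sum => n _; exact: hf.
  by rewrite -mulr_sumr mulrC ler_wpM2r // (le_trans (geo _ _)) // expr0 mulr1.
split=> // m.
have c1 : cvgc \oo (fun N => \sum_(n < N) f n - \sum_(n < m) f n)
    (csum f - \sum_(n < m) f n).
  by apply: cvgcB; [exact: asum_cvg|exact: cvgc_cst].
apply: (cvgc_normc_le c1); exists m => // N /= mN.
have {mN} [d ->] : exists d, N = (m + d)%N by exists (N - m)%N; rewrite subnKC.
rewrite big_split_ord /= addrAC subrr add0r.
apply: le_trans (normc_sum _ _ _) _.
apply: (@le_trans _ _ (\sum_(n < d) c * 2^-1 ^+ (m + n))).
  by apply: ler_sum => n _; exact: hf.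
by rewrite -mulr_sumr -mulrA mulrCA ler_wpM2l.
Qed.

End GeometricBounds.

(** * Series defined by a two-step recurrence *)

Section GaussSeries.
Variable R : realType.
Local Notation C := R[i].

(* The even terms are those of the exponential series and the odd ones vanish. *)
Lemma csum_gauss (h : nat -> C) (c : C) (a : R) : asum h ->
  h 0%N = c -> h 1%N = 0 -> (forall n, n.+2%:R * h n.+2 = a%:C * h n) ->
  csum h = c * (expR (a / 2))%:C.
Proof.
move=> ah h0 h1 hS.
have ev n : h n.*2 = c * (exp_coeff (a / 2) n)%:C.
  elim: n => [|n IH]; first by rewrite h0 /exp_coeff /= expr0 fact0 divr1 mulr1.
  have nz : (n.+1.*2)%:R != 0 :> C by rewrite pnatr_eq0 double_eq0.
  apply: (mulfI nz); rewrite doubleS hS IH /exp_coeff /= -doubleS factS exprS.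
  rewrite mulrCA [RHS]mulrCA; congr (_ * _).
  rewrite -(rmorph_nat (real_complex R)) -!rmorphM; congr (_%:C).
  rewrite -muln2 !natrM; field.
  by rewrite nat1r !pnatr_eq0 -lt0n fact_gt0.
have od n : h n.*2.+1 = 0.
  elim: n => [|n IH] //; have nz : (n.+1.*2.+1)%:R != 0 :> C by rewrite pnatr_eq0.
  by apply: (mulfI nz); rewrite doubleS hS IH !mulr0.
have ps N : \sum_(n < N.*2) h n = c * (series (exp_coeff (a / 2)) N)%:C.
  elim: N => [|N IH]; first by rewrite /series /= big_geq // big_ord0 mulr0.
  rewrite doubleS !big_ord_recr /= IH ev od addr0 -mulrDr -rmorphD.
  by rewrite /series /= big_nat_recr.
have c1 : cvgc \oo (fun N => \sum_(n < N.*2) h n) (csum h).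
  have /cvgcP hc := asum_cvg ah; apply/cvgcP.
  apply: (cvg_comp (fun N => N.*2) (fun N => normc (\sum_(n < N) h n - csum h))) hc.
  move=> A [N _ hN]; exists N => // n /= Nn; apply: hN => /=.
  by rewrite (leq_trans Nn) // -addnn leq_addr.
apply: (cvgc_unique c1).
apply: cvgc_ext (_ : cvgc _ (fun N => c * (series (exp_coeff (a / 2)) N)%:C) _) => [N|].
  by rewrite ps.
by apply: cvgcZ; apply: cvgc_real; exact: is_cvg_series_exp_coeff.
Qed.

End GaussSeries.

(** * Images of the basis vectors under the exponential series of the Weyl generator *)

Section WeylVectors.
Variables (R : realType) (z : R[i]).
Local Notation C := R[i].
Local Notation cseq := (nat -> C^o).
Local Notation basis := (@Defs.basis R).
Local Notation A := (weyl_generator z).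
Implicit Types x y : cseq.

Lemma creationE x j : creation x j = (sq j)%:C * x j.-1. Proof. by []. Qed.
Lemma annihilationE x j : annihilation x j = (sq j.+1)%:C * x j.+1. Proof. by []. Qed.

Lemma weyl_generatorE x j :
  A x j = z * ((sq j)%:C * x j.-1) - z^* * ((sq j.+1)%:C * x j.+1).
Proof. by []. Qed.

Lemma weyl_generator_lin c x y : A (x + c *: y) = A x + c *: A y.
Proof.
apply/funext => j; rewrite weyl_generatorE.
rewrite -[RHS]/(A x j + c * A y j) !weyl_generatorE.
rewrite -![(x + c *: y) _]/(x _ + c * y _).
by ring.
Qed.

Lemma sqC_sqr n : (sq n : R)%:C * (sq n)%:C = n%:R :> C.
Proof. by rewrite -rmorphM sq_sqr rmorph_nat. Qed.

Lemma sqC_mulA n (a : C) : (sq n)%:C * ((sq n)%:C * a) = n%:R * a.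
Proof. by rewrite mulrA sqC_sqr. Qed.

Lemma sqC0 : (sq 0 : R)%:C = 0 :> C. Proof. by rewrite sq0. Qed.

Lemma weyl_generator_creation x : A (creation x) = creation (A x) - z^* *: x.
Proof.
apply/funext => j; rewrite weyl_generatorE.
rewrite -[RHS]/(creation (A x) j - z^* * x j) !creationE weyl_generatorE /=.
case: j => [|j]; first by rewrite sqC0 !mul0r sqC_mulA; ring.
rewrite sqC_mulA /=.
have -> : (sq j.+1)%:C * (z * ((sq j)%:C * x j.-1) - z^* * ((sq j.+1)%:C * x j.+1)) =
  z * (sq j.+1)%:C * ((sq j)%:C * x j.-1) - z^* * (((sq j.+1)%:C * (sq j.+1)%:C) * x j.+1) by ring.
by rewrite sqC_sqr -[j.+2%:R]natr1; ring.
Qed.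

Lemma weyl_generator_annihilation x : A (annihilation x) = annihilation (A x) - z *: x.
Proof.
apply/funext => j; rewrite weyl_generatorE.
rewrite -[RHS]/(annihilation (A x) j - z * x j) !annihilationE weyl_generatorE /=.
have -> : (sq j.+1)%:C * (z * ((sq j.+1)%:C * x j) - z^* * ((sq j.+2)%:C * x j.+2)) =
  z * ((sq j.+1)%:C * (sq j.+1)%:C * x j) - z^* * ((sq j.+1)%:C * ((sq j.+2)%:C * x j.+2)) by ring.
rewrite sqC_sqr -[j.+1%:R]natr1; case: j => [|j]; first by rewrite sqC0; ring.
by rewrite sqC_mulA; ring.
Qed.

(** The commutator of [A] with the creation operator is a scalar, so moving that operator past [n]
    factors [A] yields [n] equal corrections. *)
Lemma iter_creation n x :
  iter n A (creation x) = creation (iter n A x) + (- (n%:R * z^*)) *: iter n.-1 A x.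
Proof.
elim: n => [|n IH]; first by rewrite mul0r oppr0 scale0r addr0.
rewrite iterS IH weyl_generator_lin weyl_generator_creation -addrA; congr (_ + _).
rewrite -scaleNr; case: n {IH} => [|n]; first by rewrite mul0r oppr0 scale0r addr0 mul1r.
rewrite -iterS -scalerDl; congr (_ *: _).
by rewrite -[n.+2%:R]natr1; ring.
Qed.

Lemma iter_annihilation n x :
  iter n A (annihilation x) = annihilation (iter n A x) + (- (n%:R * z)) *: iter n.-1 A x.
Proof.
elim: n => [|n IH]; first by rewrite mul0r oppr0 scale0r addr0.
rewrite iterS IH weyl_generator_lin weyl_generator_annihilation -addrA; congr (_ + _).
rewrite -scaleNr; case: n {IH} => [|n]; first by rewrite mul0r oppr0 scale0r addr0 mul1r.
rewrite -iterS -scalerDl; congr (_ *: _).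
by rewrite -[n.+2%:R]natr1; ring.
Qed.

Lemma iter_scale n c x : iter n A (c *: x) = c *: iter n A x.
Proof.
have A0 : A 0 = 0.
  by apply/funext => j; rewrite weyl_generatorE -[(0 : cseq) _]/(0 : C) !mulr0 subr0.
elim: n => [|n IH] //; rewrite !iterS IH -[c *: _]add0r weyl_generator_lin A0 add0r.
by [].
Qed.

Lemma creation_basis k : creation (basis k) = (sq k.+1)%:C *: (basis k.+1 : cseq).
Proof.
apply/funext => j; rewrite creationE -[RHS]/((sq k.+1)%:C * basis k.+1 j) !basisE.
case: j => [|j]; first by rewrite sq0 mul0r mulr0.
by rewrite eqSS /=; case: eqP => [->//|_]; rewrite !mulr0.
Qed.

Lemma annihilation_basis k : annihilation (basis k) = (sq k)%:C *: (basis k.-1 : cseq).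
Proof.
apply/funext => j; rewrite annihilationE -[RHS]/((sq k)%:C * basis k.-1 j) !basisE.
case: k => [|k]; first by rewrite sq0 mul0r mulr0.
by rewrite eqSS /=; case: eqP => [->//|_]; rewrite !mulr0.
Qed.

Definition weyl_iter k n j : C := iter n A (basis k) j.
Local Notation al := weyl_iter.

Lemma weyl_iter_up k n j : (sq k.+1)%:C * al k.+1 n j =
  (sq j)%:C * al k n j.-1 - n%:R * z^* * al k n.-1 j.
Proof.
have := congr1 (fun x : cseq => x j) (iter_creation n (basis k)).
by rewrite creation_basis iter_scale => h; rewrite -mulNr; exact: h.
Qed.

Lemma weyl_iter_down k n j : (sq k)%:C * al k.-1 n j =
  (sq j.+1)%:C * al k n j.+1 - n%:R * z * al k n.-1 j.
Proof.
have := congr1 (fun x : cseq => x j) (iter_annihilation n (basis k)).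
by rewrite annihilation_basis iter_scale => h; rewrite -mulNr; exact: h.
Qed.

Lemma weyl_iterS k n j : al k n.+1 j =
  z * ((sq j)%:C * al k n j.-1) - z^* * ((sq j.+1)%:C * al k n j.+1).
Proof. by []. Qed.

Lemma weyl_iter_support k n j : (k + n < j)%N -> al k n j = 0.
Proof.
elim: n j => [|n IH] j lt; first by rewrite addn0 in lt; rewrite /al /= gtn_eqF.
by rewrite weyl_iterS !IH ?mulr0 ?subr0 //; lia.
Qed.

(** The iterate of order n is supported on indices up to k + n, so each of the two ladder terms of
    the next application multiplies the largest entry by at most |z| times the square root of k + n
    + 1. *)
Fixpoint weyl_bound k n : R :=
  if n is n'.+1 then 2 * normc z * sq (k + n'.+1) * weyl_bound k n' else 1.

Lemma weyl_bound_ge0 k n : 0 <= weyl_bound k n.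
Proof. by elim: n => [|n IH] //=; rewrite !mulr_ge0 ?normc_ge0 ?sq_ge0. Qed.

Lemma sq_mono m n : (m <= n)%N -> sq m <= sq n :> R.
Proof. by move=> mn; rewrite /sq ler_wsqrtr // ler_nat. Qed.

Lemma weyl_iter_le k n j : normc (al k n j) <= weyl_bound k n.
Proof.
elim: n j => [|n IH] j.
  by rewrite -[al k 0 j]/(basis k j) basisE; case: eqP => _; rewrite ?normc1 ?normc0.
have h (i l : nat) : (l <= i.+1)%N -> normc ((sq l)%:C * al k n i) <= sq (k + n.+1) * weyl_bound k n.
  move=> li; have [lt|ge] := ltnP (k + n) i.
    by rewrite weyl_iter_support // mulr0 normc0 mulr_ge0 ?sq_ge0 ?weyl_bound_ge0.
  rewrite normcM normcR ger0_norm ?sq_ge0 // ler_pM ?sq_ge0 ?normc_ge0 //.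
  by apply: sq_mono; lia.
rewrite weyl_iterS /=; apply: le_trans (normcD _ _) _.
rewrite normc_opp normcM [normc (z^* * _)]normcM normc_conj -mulrDr -!mulrA [2 * _]mulrCA.
rewrite ler_wpM2l ?normc_ge0 // mulr_natl mulr2n lerD ?h //; lia.
Qed.

Lemma weyl_bound_geometric k : exists2 K, 0 <= K &
  forall n, weyl_bound k n / n`!%:R <= K * 4^-1 ^+ n.
Proof.
pose a n := weyl_bound k n / n`!%:R.
pose rho (n : nat) : R := 2 * normc z * sq (k + n.+1) / n.+1%:R.
(* The ratio is at most 1/4 when 64 |z|^2 (k + n + 1) <= (n + 1)^2. Since k + n + 1 <= (k + 1)(n +
   1), it suffices that n + 1 exceeds 64 |z|^2 (k + 1). *)
pose N := Num.Def.archi_bound (64 * normc z ^+ 2 * k.+1%:R).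
have zk0 : 0 <= 64 * normc z ^+ 2 * k.+1%:R by rewrite !mulr_ge0 ?normc_ge0 ?sqr_ge0 ?ler0n.
apply: (@eventually_geometric _ a rho N) => n.
- by rewrite divr_ge0 // weyl_bound_ge0.
- rewrite /a /rho /= factS natrM invfM !mulrA le_eqVlt; apply/orP; left; apply/eqP.
  by ring.
move=> Nn; rewrite /rho ler_pdivrMr ?ltr0n // [4^-1 * _]mulrC ler_pdivlMr //.
rewrite -(@ler_pXn2r _ 2) ?nnegrE ?mulr_ge0 ?sq_ge0 ?normc_ge0 //.
have -> : (2 * normc z * sq (k + n.+1) * 4) ^+ 2 =
    64 * normc z ^+ 2 * (sq (k + n.+1) * sq (k + n.+1)) :> R by ring.
rewrite sq_sqr.
have h1 : 64 * normc z ^+ 2 * k.+1%:R <= n.+1%:R :> R.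
  apply: ltW; apply: lt_le_trans (archi_boundP zk0) _.
  by rewrite ler_nat leqW.
apply: (@le_trans _ _ (64 * normc z ^+ 2 * (k.+1%:R * n.+1%:R))).
  apply: ler_wpM2l; first by rewrite mulr_ge0 ?sqr_ge0.
  by rewrite -natrM ler_nat; lia.
by rewrite mulrA expr2 ler_wpM2r.
Qed.

Definition weyl_coef k n j : C := (n`!%:R)^-1 * al k n j.

(** The coefficient vanishes for j > k + n, so one of the two factors 2^(-n) of 4^(-n) can be traded
    for 2^k 2^(-j). The decay in [j] makes the remainders small in norm and not merely entrywise. *)
Lemma weyl_coef_le k : exists2 K, 0 <= K &
  forall n j, normc (weyl_coef k n j) <= K * 2^-1 ^+ j * 2^-1 ^+ n.
Proof.
have [K K0 hK] := weyl_bound_geometric k.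
exists (K * 2 ^+ k) => [|n j]; first by rewrite mulr_ge0 ?exprn_ge0.
have [lt|ge] := ltnP (k + n) j.
  rewrite /weyl_coef weyl_iter_support // mulr0 normc0.
  by rewrite !mulr_ge0 ?exprn_ge0 ?invr_ge0.
rewrite /weyl_coef normcM normcV -(rmorph_nat (real_complex R)) normcR normr_nat.
apply: (@le_trans _ _ (K * 4^-1 ^+ n)).
  by apply: le_trans (hK n); rewrite mulrC ler_wpM2r ?invr_ge0 ?weyl_iter_le.
have -> : 4^-1 = 2^-1 * 2^-1 :> R by field.
rewrite exprMn -!mulrA ler_wpM2l // mulrA ler_wpM2r ?exprn_ge0 ?invr_ge0 //.
rewrite !exprVn -[X in X <= _]mul1r ler_pdivlMr ?exprn_gt0 //.
rewrite mul1r mulrC ler_pdivrMr ?exprn_gt0 // -exprD ler_weXn2l //.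
by rewrite ler1n.
Qed.

Definition weyl_vec k j : C := csum (fun n => weyl_coef k n j).
Local Notation psi := weyl_vec.

Lemma weyl_coef_asum k j : asum (fun n => weyl_coef k n j).
Proof. by have [K _ hK] := weyl_coef_le k; have [] := csum_geometric (fun n => hK n j). Qed.

Lemma weyl_vec_tail k : exists2 K, 0 <= K & forall j m,
  normc (psi k j - \sum_(n < m) weyl_coef k n j) <= K * 2^-1 ^+ j * 2^-1 ^+ m.
Proof.
have [K K0 hK] := weyl_coef_le k; exists (2 * K) => [|j m]; first by rewrite mulr_ge0.
by have [_] := csum_geometric (fun n => hK n j); rewrite !mulrA; apply.
Qed.

Lemma coef_shift (f : nat -> C) (c : C) : asum (fun n => (n`!%:R)^-1 * f n) ->
  asum (fun n => (n`!%:R)^-1 * (n%:R * c * f n.-1)) /\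
  csum (fun n => (n`!%:R)^-1 * (n%:R * c * f n.-1)) = c * csum (fun n => (n`!%:R)^-1 * f n).
Proof.
move=> af.
have E n : (n.+1`!%:R)^-1 * (n.+1%:R * c * f n) = c * ((n`!%:R)^-1 * f n) :> C.
  rewrite factS natrM invfM; field.
  by rewrite nat1r !pnatr_eq0 -lt0n fact_gt0.
have a1 : asum (fun n => (n`!%:R)^-1 * (n%:R * c * f n.-1)).
  by apply/asumS; under eq_fun do rewrite E; exact: asumZ.
split=> //; rewrite csumS // !mul0r mulr0 add0r -csumZ //.
by congr csum; apply/funext => n; rewrite E.
Qed.

(** Entrywise form of the displacement relation e^A a^dagger = (a^dagger - conj z) e^A; the
    correction in [weyl_iter_up] is the same exponential series shifted by one. *)
Lemma weyl_vec_up k j :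
  (sq k.+1)%:C * psi k.+1 j = (sq j)%:C * psi k j.-1 - z^* * psi k j.
Proof.
have [a1 e1] := coef_shift (z^*) (weyl_coef_asum k j).
have a2 := weyl_coef_asum k j.-1.
transitivity (csum (fun n => (sq k.+1)%:C * weyl_coef k.+1 n j)).
  by rewrite csumZ //; exact: weyl_coef_asum.
transitivity (csum (fun n => (sq j)%:C * weyl_coef k n j.-1 +
    (-1) * ((n`!%:R)^-1 * (n%:R * z^* * al k n.-1 j)))).
  congr csum; apply/funext => n; rewrite /weyl_coef mulrCA weyl_iter_up.
  by move: (n`!%:R^-1) => c; ring.
rewrite csumD; [|exact: asumZ|exact: asumZ].
by rewrite csumZ // csumZ // e1 mulN1r.
Qed.

Lemma weyl_vec_down k j :
  (sq k)%:C * psi k.-1 j = (sq j.+1)%:C * psi k j.+1 - z * psi k j.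
Proof.
have [a1 e1] := coef_shift (z) (weyl_coef_asum k j).
have a2 := weyl_coef_asum k j.+1.
transitivity (csum (fun n => (sq k)%:C * weyl_coef k.-1 n j)).
  by rewrite csumZ //; exact: weyl_coef_asum.
transitivity (csum (fun n => (sq j.+1)%:C * weyl_coef k n j.+1 +
    (-1) * ((n`!%:R)^-1 * (n%:R * z * al k n.-1 j)))).
  congr csum; apply/funext => n; rewrite /weyl_coef mulrCA weyl_iter_down.
  by move: (n`!%:R^-1) => c; ring.
rewrite csumD; [|exact: asumZ|exact: asumZ].
by rewrite csumZ // csumZ // e1 mulN1r.
Qed.

(** The two-step recurrence combines [weyl_iterS] at [j = 0] with [weyl_iter_down] at [k = 0], whose
    left side vanishes because the vacuum is annihilated. *)
Lemma weyl_vec00 : psi 0 0 = (expR (- normc z ^+ 2 / 2))%:C.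
Proof.
rewrite -[RHS]mul1r; apply: csum_gauss; first exact: weyl_coef_asum.
- by rewrite /weyl_coef /al fact0 /= invr1 mul1r.
- rewrite /weyl_coef weyl_iterS sq0 mul0r mulr0 sub0r /al /=.
  by rewrite !mulr0 oppr0 mulr0.
move=> n; rewrite /weyl_coef weyl_iterS sq0 mul0r mulr0 sub0r.
have := weyl_iter_down 0 n.+1 0; rewrite sq0 mul0r => /esym/eqP; rewrite subr_eq0 => /eqP ->.
have -> : (- normc z ^+ 2)%:C = - (z^* * z) :> C by rewrite conj_mulE; exact: rmorphN.
rewrite !factS !natrM /=; field.
by rewrite nat1r -natrD !pnatr_eq0 -lt0n fact_gt0.
Qed.

End WeylVectors.

(** * The Weyl operator as an isometry with explicit matrix *)

Section WeylOperator.
Variables (R : realType) (z : R[i]).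
Local Notation C := R[i].
Local Notation basis := (@Defs.basis R).
Local Notation psi := (weyl_vec z).

(** A Fock vector is stored as column 0 of an array, so that the inner product of arrays, its
    adjunctions and Bessel's identity apply to it unchanged. *)
Definition weyl_arr (k j l : nat) : C := psi k j * (l == 0%N)%:R.
Local Notation Psi := weyl_arr.

Lemma rapid_weyl k : rapid (Psi k).
Proof.
have [K K0 hK] := weyl_vec_tail z k; exists K, 2^-1; split => //; first lra.
move=> j [|l]; last by rewrite /Psi mulr0 normc0 mulr_ge0 ?exprn_ge0.
by have := hK j 0%N; rewrite big_ord0 subr0 expr0 mulr1 /Psi mulr1 addn0.
Qed.

Lemma weyl_arr_up k :
  arr_lin 1 (cr1 (Psi k)) (- z^*) (Psi k) = arr_lin (sq k.+1)%:C (Psi k.+1) 0 (Psi k).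
Proof.
apply/funext => j; apply/funext => l; rewrite /arr_lin /cr1 /Psi mul0r addr0 mul1r.
by rewrite mulrA [RHS]mulrA weyl_vec_up; ring.
Qed.

Lemma weyl_arr_down k :
  arr_lin 1 (an1 (Psi k)) (- z) (Psi k) = arr_lin (sq k)%:C (Psi k.-1) 0 (Psi k).
Proof.
apply/funext => j; apply/funext => l; rewrite /arr_lin /an1 /Psi mul0r addr0 mul1r.
by rewrite mulrA [RHS]mulrA weyl_vec_down; ring.
Qed.

Lemma weyl_gram k k' :
  (sq k.+1)%:C * arr_inner (Psi k.+1) (Psi k') = (sq k')%:C * arr_inner (Psi k) (Psi k'.-1).
Proof.
have rw := rapid_weyl; have h1 := rapid_cr1 (rw k); have h2 := rapid_an1 (rw k').
rewrite -(arr_inner_scalel _ (rw k.+1) (rw k) (rw k')) -weyl_arr_up.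
rewrite -(arr_inner_scaler _ (rw k) (rw k'.-1) (rw k')) -weyl_arr_down.
rewrite (arr_inner_linl _ _ h1 (rw k) (rw k')) (arr_inner_linr _ _ h2 (rw k') (rw k)).
by rewrite (arr_inner_cr1 (rw k) (rw k')) conj1 conjN conjCK.
Qed.

Lemma weyl_gram_sym k k' :
  (sq k'.+1)%:C * arr_inner (Psi k) (Psi k'.+1) = (sq k)%:C * arr_inner (Psi k.-1) (Psi k').
Proof.
have e1 := arr_inner_conj (rapid_weyl k'.+1) (rapid_weyl k).
have e2 := arr_inner_conj (rapid_weyl k') (rapid_weyl k.-1).
by rewrite -e1 -e2; exact: conj_scaled (weyl_gram k' k).
Qed.

Lemma weyl_ground j : psi 0 j = z ^+ j / (sf j)%:C * (expR (- normc z ^+ 2 / 2))%:C.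
Proof.
elim: j => [|j IH]; first by rewrite weyl_vec00 expr0 sf0 divr1 mul1r.
have := weyl_vec_down z 0 j; rewrite sq0 mul0r => /esym/eqP; rewrite subr_eq0 => /eqP h.
have nz : (sq j.+1)%:C != 0 :> C by rewrite fmorph_eq0 sqS_neq0.
have nf : (sf j)%:C != 0 :> C by rewrite fmorph_eq0 sf_neq0.
apply: (mulfI nz); rewrite h IH sfS rCM [z ^+ j.+1]exprS; move: (expR _)%:C => e; field.
by rewrite nz nf.
Qed.

Lemma weyl_ground_norm : arr_inner (Psi 0) (Psi 0) = 1.
Proof.
have a2 := arr_inner_asum2 (rapid_weyl 0) (rapid_weyl 0).
rewrite /arr_inner /csum2 (@csum_finite _ _ 1) => [|k k1]; last first.
  by apply: csum0 => j; rewrite /Psi gtn_eqF // !mulr0.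
rewrite big_ord_recl big_ord0 addr0 /=.
pose e := expR (- normc z ^+ 2).
have E j : (Psi 0 j 0)^* * Psi 0 j 0 = (e * exp_coeff (normc z ^+ 2) j)%:C.
  rewrite /Psi mulr1 conj_mulE weyl_ground !normcM normcV !normcR normcX.
  rewrite (ger0_norm (ltW (sf_gt0 _ _))) (ger0_norm (expR_ge0 _)); congr (_%:C).
  rewrite !exprMn exprVn sf_sqr -expRM_natl /exp_coeff /= /e -!exprM [(j * 2)%N]mulnC.
  by rewrite mulrC; congr (expR _ * _); field.
under eq_fun do rewrite E.
apply: csum_unique; first by under eq_fun do rewrite -E; exact: asum2_col a2.
apply: cvgc_ext (_ : cvgc _ (fun N => (e * series (exp_coeff (normc z ^+ 2)) N)%:C) _) => [N|].
  by rewrite /series /= mulr_sumr rmorph_sum big_mkord.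
have -> : (1 : C) = (e * expR (normc z ^+ 2))%:C by rewrite /e -expRD addNr expR0.
apply: cvgc_real; apply: cvgM; first exact: cvg_cst.
exact: is_cvg_series_exp_coeff.
Qed.

Lemma weyl_orthonormal k k' : arr_inner (Psi k) (Psi k') = (k == k')%:R.
Proof.
rewrite (@ladder_gram R (fun a b => arr_inner (Psi a) (Psi b))); first by rewrite weyl_ground_norm mulr1.
  exact: weyl_gram.
exact: weyl_gram_sym.
Qed.

Definition weyl_hs k : hs R := hs_of_arr (Psi k).

Lemma ent_weyl_hs k j : ent (weyl_hs k) j 0 = psi k j.
Proof. by rewrite ent_rapid; [rewrite /weyl_arr mulr1|exact: rapid_weyl]. Qed.

Lemma weyl_hs_orthonormal : hs_orthonormal weyl_hs.
Proof. by move=> k k'; rewrite hs_inner_rapid ?weyl_orthonormal //; exact: rapid_weyl. Qed.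

(** Orthonormality of the columns supplies both bounds with constant 1: Bessel's inequality for the
    rows, Pythagoras for the truncations. *)
Lemma weyl_bop_exists : exists W : bop R, forall j k, W (basis k) j = psi k j.
Proof.
have iE K (F : nat -> R) : \sum_(k <- iota 0 K) F k = \sum_(k < K) F k.
  by rewrite -(big_mkord xpredT F) /index_iota subn0.
have iEh K (F : nat -> hs R) : \sum_(k <- iota 0 K) F k = \sum_(k < K) F k.
  by rewrite -(big_mkord xpredT F) /index_iota subn0.
apply: (@bop_of_matrix _ (fun j k => psi k j) 1 1) => [j K|x N K].
  have := bessel_identity (unit_hs R (j, 0%N)) weyl_hs_orthonormal (iota_uniq 0 K).
  rewrite [hs_norm (unit_hs _ _) ^+ 2]hs_norm_sqrE unit_orthonormal eqxx iE => h.
  have := sqr_ge0 (hs_norm (unit_hs R (j, 0%N) -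
    \sum_(i <- iota 0 K) hs_inner (weyl_hs i) (unit_hs R (j, 0%N)) *: weyl_hs i)).
  rewrite h subr_ge0; apply: le_trans; rewrite le_eqVlt; apply/orP; left; apply/eqP.
  by apply: eq_bigr => k _; rewrite -hs_inner_conj normc_conj hs_inner_unit ent_weyl_hs.
have := hs_pythagoras (fun k => x k : C) (iota_uniq 0 K) weyl_hs_orthonormal.
rewrite iE iEh mul1r => h.
apply: le_trans (sum_le_fnorm x K); rewrite -h.
apply: le_trans (ent_square_bounded _ N 1); rewrite big_ord1 le_eqVlt; apply/orP; left.
apply/eqP; apply: eq_bigr => j _; rewrite ent_sum; congr (normc _ ^+ 2).
by apply: eq_bigr => k _; rewrite entZ ent_weyl_hs.
Qed.

Definition weyl_remainder (W : bop R) k m : nat -> C^o :=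
  (W (basis k) : nat -> C^o) - \sum_(n < m) (n`!%:R : C)^-1 *:
    iter n (weyl_generator z) (basis k).

Lemma weyl_remainderE W k m j :
  weyl_remainder W k m j = W (basis k) j - \sum_(n < m) weyl_coef z k n j.
Proof.
have sumE (F : 'I_m -> nat -> C^o) : (\sum_(i < m) F i) j = \sum_(i < m) F i j.
  by elim/big_rec2: _ => [|i y x _ <-].
exact: (congr1 (fun t => W (basis k) j - t) (sumE (fun n =>
  (n`!%:R : C)^-1 *: iter n (weyl_generator z) (basis k)))).
Qed.

Lemma weyl_remainder_cvg (W : bop R) k : (forall j, W (basis k) j = psi k j) ->
  sqnorm (weyl_remainder W k m) @[m --> \oo] --> 0%E.
Proof.
move=> hW; have [K K0 hK] := weyl_vec_tail z k.
have le m : (sqnorm (weyl_remainder W k m) <= (2 * K ^+ 2 * 4^-1 ^+ m)%:E)%E.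
  apply: sqnorm_le => N.
  apply: (@le_trans _ _ (\sum_(j < N) 4^-1 ^+ j * (K ^+ 2 * 4^-1 ^+ m))).
    apply: ler_sum => j _; rewrite weyl_remainderE hW.
    have E : 4^-1 = 2^-1 ^+ 2 :> R by field.
    have -> : 4^-1 ^+ j * (K ^+ 2 * 4^-1 ^+ m) = (K * 2^-1 ^+ j * 2^-1 ^+ m) ^+ 2 :> R.
      by rewrite E -!exprM ![(2 * _)%N]mulnC !exprMn -!exprM; ring.
    by apply: lerXn2r; rewrite ?nnegrE ?normc_ge0 ?mulr_ge0 ?exprn_ge0 ?invr_ge0.
  rewrite -mulr_suml -mulrA ler_wpM2r ?mulr_ge0 ?exprn_ge0 ?invr_ge0 //.
  apply: le_trans (sum_geom_le _ _ _) _; try lra.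
  have -> : 1 - 4^-1 = (4 / 3)^-1 :> R by field.
  by rewrite invrK; lra.
have lim0 : (2 * K ^+ 2 * 4^-1 ^+ m)%:E @[m --> \oo] --> (0 : \bar R).
  apply: cvg_EFin; first exact: nearW.
  by apply: cvg0Z; apply: cvg_expr; rewrite ger0_norm; lra.
apply: squeeze_cvge (cvg_cst 0%E) lim0.
by apply: nearW => m; rewrite sqnorm_ge0 le.
Qed.

(** [weyl z] is a choice among the operators with a prescribed norm limit. The operator just built
    shows that one exists, and the limit fixes the entries of any of them. *)
Lemma weylE k j : weyl z (basis k) j = psi k j.
Proof.
have [W hW] := weyl_bop_exists.
have h : sqnorm (weyl_remainder (weyl z) k m) @[m --> \oo] --> 0%E.
  apply: (@xgetPex _ 0 [set W : bop R | forall k,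
    sqnorm (weyl_remainder W k m) @[m --> \oo] --> 0%E] _ k).
  by exists W => l; apply: weyl_remainder_cvg.
have c : cvgc \oo (fun m => \sum_(n < m) weyl_coef z k n j) (weyl z (basis k) j).
  apply/cvgcP.
  have h2 : Num.sqrt (fine (sqnorm (weyl_remainder (weyl z) k m))) @[m --> \oo] --> (0 : R).
    suff : Num.sqrt (fine (sqnorm (weyl_remainder (weyl z) k m))) @[m --> \oo]
      --> Num.sqrt (0 : R) by rewrite sqrtr0.
    by apply: continuous_cvg; [exact: sqrt_continuous|exact: fine_cvg h].
  (* [fine] sends an infinite value to 0, so the bound on the entry is available only from the rank
     [N] on, where the squared norm is finite. *)
  have [_ /fine_cvgP [[N _ hN] _]] := (I, h).
  apply: squeeze_cvgr (cvg_cst 0) h2; exists N => // m /= Nm.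
  rewrite normc_ge0 /= -normc_opp opprB -weyl_remainderE.
  rewrite -(@ler_pXn2r _ 2) ?nnegrE ?normc_ge0 ?sqrtr_ge0 //.
  rewrite sqr_sqrtr ?fine_ge0 ?sqnorm_ge0 // -lee_fin fineK; last exact: hN.
  have := @nneseries_lim_ge R (fun n => (normc (weyl_remainder (weyl z) k m n) ^+ 2)%:E)
    xpredT 0 j.+1 (fun n _ _ => _).
  rewrite big_nat_recr //= => le; apply: le_trans (le _) => [|n]; last by rewrite lee_fin sqr_ge0.
  by rewrite leeDr // sume_ge0 // => n _; rewrite lee_fin sqr_ge0.
exact: (cvgc_unique c (asum_cvg (weyl_coef_asum z k j))).
Qed.

End WeylOperator.

(** * Sums over antidiagonals *)

Section Antidiagonal.
Variable V : zmodType.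

Definition antidiag (K : nat) (F : nat -> nat -> V) : V := \sum_(i < K.+1) F i (K - i)%N.

Lemma antidiag_shiftr K (F G : nat -> nat -> V) :
  (forall m, F m 0%N = 0) -> (forall m n, F m n.+1 = G m n) ->
  antidiag K.+1 F = antidiag K G.
Proof.
move=> F0 FS; rewrite /antidiag big_ord_recr /= subnn F0 addr0.
by apply: eq_bigr => i _; rewrite subSn ?FS // -ltnS.
Qed.

Lemma antidiag_shiftl K (F G : nat -> nat -> V) :
  (forall n, F 0%N n = 0) -> (forall m n, F m.+1 n = G m n) ->
  antidiag K.+1 F = antidiag K G.
Proof.
move=> F0 FS; rewrite /antidiag big_ord_recl /= F0 add0r.
by apply: eq_bigr => i _; rewrite /= subSS FS.
Qed.

Lemma antidiag0 (F : nat -> nat -> V) : antidiag 0 F = F 0%N 0%N.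
Proof. by rewrite /antidiag big_ord1. Qed.

Lemma eq_antidiag K (F G : nat -> nat -> V) :
  (forall m n, (m + n)%N = K -> F m n = G m n) -> antidiag K F = antidiag K G.
Proof. by move=> h; apply: eq_bigr => i _; apply: h; rewrite subnKC // -ltnS. Qed.

Lemma antidiagD K (F G : nat -> nat -> V) :
  antidiag K (fun m n => F m n + G m n) = antidiag K F + antidiag K G.
Proof. exact: big_split. Qed.

End Antidiagonal.

(** * Coherent vectors, their homogeneous parts and their matrix entries *)

Section CoherentVectors.
Variables (R : realType) (r sg w : R).
Hypotheses (r0 : 0 < r) (r1 : r < 1) (sg0 : 0 < sg) (sgE : sg ^+ 2 = 1 - r ^+ 2).
Hypothesis w0 : 0 < w.
Local Notation C := R[i].
Local Notation U := (squeeze r sg).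

(** These come from substituting p = (w / sg) z and q = - (r / (sg w)) conj z in the generating
    function of [squeeze]. The exponent becomes r x y + w z x - (r / w) (conj z) y plus a term in
    |z|^2, which is that of W(z) with x and y rescaled by the two powers of the Gibbs weight. *)
Definition coh_coef (m n : nat) : R :=
  (w / sg) ^+ m * (- (r / (sg * w))) ^+ n / (sf m * sf n).

Definition homv (m n : nat) : hs R := (coh_coef m n)%:C *: sqb r sg (m, n).

(* The component of degree [K] of the expansion of [rho^(s/2) W(z) rho^((1-s)/2)]
   in powers of [z] and its conjugate, up to normalization. *)
Definition hom_part (K : nat) (z : C) : hs R :=
  antidiag K (fun m n => (z ^+ m * z^* ^+ n) *: homv m n).

Lemma squeezeC_y m n j k : (sq k.+1)%:C * (U m n j k.+1)%:C =
  r%:C * (sq j)%:C * (U m n j.-1 k)%:C + sg%:C * (sq n)%:C * (U m n.-1 j k)%:C :> C.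
Proof. by rewrite -rCM squeeze_y rCD !rCM. Qed.

Lemma squeezeC_x m n j k : (sq j.+1)%:C * (U m n j.+1 k)%:C =
  r%:C * (sq k)%:C * (U m n j k.-1)%:C + sg%:C * (sq m)%:C * (U m.-1 n j k)%:C :> C.
Proof. by rewrite -rCM squeeze_x rCD !rCM. Qed.

Lemma squeezeC_p m n : (sq m.+1)%:C * (U m.+1 n 0 0)%:C =
  - (r%:C * (sq n)%:C * (U m n.-1 0 0)%:C) :> C.
Proof. by rewrite -rCM squeeze_p sq0 mulr0 mul0r sub0r rCN !rCM. Qed.

Lemma squeezeC_q m n : (sq n.+1)%:C * (U m n.+1 0 0)%:C =
  - (r%:C * (sq m)%:C * (U m.-1 n 0 0)%:C) :> C.
Proof. by rewrite -rCM squeeze_q sq0 mulr0 mul0r sub0r rCN !rCM. Qed.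

Section FixedPoint.
Variable z : C.
Let cp : C := (w / sg)%:C * z.
Let cq : C := (- (r / (sg * w)))%:C * z^*.
Let c m n : C := cp ^+ m * cq ^+ n / ((sf m)%:C * (sf n)%:C).
Let pe K j k : C := ent (hom_part K z) j k.

Let cE m n : z ^+ m * z^* ^+ n * (coh_coef m n)%:C = c m n.
Proof.
have -> : (coh_coef m n)%:C = (w / sg)%:C ^+ m * (- (r / (sg * w)))%:C ^+ n /
    ((sf m)%:C * (sf n)%:C) by rewrite /coh_coef !(rCM, rCX, rCV).
by rewrite /c /cp /cq !exprMn; ring.
Qed.

Let c_up m n : c m.+1 n * (sq m.+1)%:C = cp * c m n.
Proof.
rewrite /c sfS rCM exprS; field.
by rewrite !fmorph_eq0 sqS_neq0 !sf_neq0.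
Qed.

Let c_right m n : c m n.+1 * (sq n.+1)%:C = cq * c m n.
Proof.
rewrite /c sfS rCM [cq ^+ n.+1]exprS; field.
by rewrite !fmorph_eq0 sqS_neq0 !sf_neq0.
Qed.

Lemma pe_antidiag K j k : pe K j k = antidiag K (fun m n => c m n * (U m n j k)%:C).
Proof.
rewrite /pe /hom_part /antidiag ent_sum; apply: eq_bigr => i _.
by rewrite /homv scalerA entZ cE ent_sqb.
Qed.

Lemma antidiagZ a K (F : nat -> nat -> C) :
  a * antidiag K F = antidiag K (fun m n => a * F m n).
Proof. exact: mulr_sumr. Qed.

(** The derivative in y brings down r x + sg q, and q has degree 1 in z; hence the drop from [K.+1]
    to [K] in the last term. *)
Lemma pe_y K j k : (sq k.+1)%:C * pe K.+1 j k.+1 =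
  r%:C * (sq j)%:C * pe K.+1 j.-1 k + sg%:C * cq * pe K j k.
Proof.
rewrite !pe_antidiag !antidiagZ.
rewrite -(@antidiag_shiftr _ K (fun m n => sg%:C * (sq n)%:C * c m n * (U m n.-1 j k)%:C)).
- rewrite -antidiagD; apply: eq_antidiag => m n _.
  by rewrite mulrCA squeezeC_y; ring.
- by move=> m; rewrite sqC0 mulr0 !mul0r.
by move=> m n /=; rewrite -(mulrA _ (sq _)%:C) [_%:C * c _ _]mulrC c_right; ring.
Qed.

Lemma pe_y0 j k : (sq k.+1)%:C * pe 0 j k.+1 = r%:C * (sq j)%:C * pe 0 j.-1 k.
Proof.
rewrite !pe_antidiag !antidiag0 mulrCA squeezeC_y sqC0 mulr0 mul0r addr0.
by ring.
Qed.

Lemma pe_x K j : (sq j.+1)%:C * pe K.+1 j.+1 0 = sg%:C * cp * pe K j 0.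
Proof.
rewrite !pe_antidiag !antidiagZ; apply: antidiag_shiftl => [n|m n].
  by rewrite mulrCA squeezeC_x !sqC0; ring.
rewrite mulrCA squeezeC_x sqC0 /=.
transitivity (sg%:C * (c m.+1 n * (sq m.+1)%:C) * (U m n j 0)%:C); first by ring.
by rewrite c_up; ring.
Qed.

Lemma pe_x0 j : (sq j.+1)%:C * pe 0 j.+1 0 = 0.
Proof.
by rewrite !pe_antidiag !antidiag0 mulrCA squeezeC_x !sqC0; ring.
Qed.

(** Euler's identity for exp (- r p q): the factor m + n = K + 2 is p d/dp + q d/dq, and each of the
    two derivatives brings down - r p q, of degree 2 in z. *)
Lemma pe_00 K : K.+2%:R * pe K.+2 0 0 = (2 * (r ^+ 2 / sg ^+ 2 * normc z ^+ 2))%:C * pe K 0 0.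
Proof.
have E m n : (m + n)%N = K.+2 -> K.+2%:R * (c m n * (U m n 0 0)%:C) =
    c m n * (sq m)%:C * ((sq m)%:C * (U m n 0 0)%:C) +
    c m n * (sq n)%:C * ((sq n)%:C * (U m n 0 0)%:C).
  move=> <-; rewrite natrD -!sqC_sqr; ring.
rewrite !pe_antidiag antidiagZ (eq_antidiag E) antidiagD.
rewrite (@antidiag_shiftl _ K.+1 _ (fun m n => - r%:C * cp * ((sq n)%:C * c m n) * (U m n.-1 0 0)%:C));
  first last.
- by move=> m n; rewrite squeezeC_p c_up; ring.
- by move=> n; rewrite sqC0; ring.
rewrite (@antidiag_shiftr _ K _ (fun m n => - r%:C * cp * cq * (c m n * (U m n 0 0)%:C)));
  first last.
- by move=> m n /=; rewrite [_%:C * c _ _]mulrC c_right; ring.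
- by move=> m; rewrite sqC0; ring.
rewrite (@antidiag_shiftr _ K.+1 _ (fun m n => - r%:C * cq * ((sq m)%:C * c m n) * (U m.-1 n 0 0)%:C));
  first last.
- by move=> m n; rewrite squeezeC_q c_right; ring.
- by move=> n; rewrite sqC0; ring.
rewrite (@antidiag_shiftl _ K _ (fun m n => - r%:C * cp * cq * (c m n * (U m n 0 0)%:C)));
  first last.
- by move=> m n /=; rewrite [_%:C * c _ _]mulrC c_up; ring.
- by move=> m; rewrite sqC0; ring.
rewrite -antidiagZ -mulrDl; congr (_ * _).
have E2 : cp * cq = (- (r / sg ^+ 2 * normc z ^+ 2))%:C.
  rewrite /cp /cq.
  have -> : (w / sg)%:C * z * ((- (r / (sg * w)))%:C * z^*) =
     (w / sg)%:C * (- (r / (sg * w)))%:C * (z^* * z) by ring.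
  rewrite conj_mulE -!rCM; congr (_%:C).
  by field; rewrite !gt_eqF.
rewrite -[- r%:C * cp * cq]mulrA E2 -!rCN -!rCM -rCD; congr (_%:C).
by field; rewrite gt_eqF.
Qed.

Lemma normc_sqr_coef (a b : C) m n :
  normc (a ^+ m * b ^+ n / ((sf m)%:C * (sf n)%:C)) ^+ 2 =
  (normc a ^+ 2) ^+ m * (normc b ^+ 2) ^+ n / (m`!%:R * n`!%:R).
Proof.
rewrite !(normcM, normcV, normcX, normcR) !(ger0_norm (ltW (sf_gt0 _ _))).
have e (x : R) k : (x ^+ 2) ^+ k = (x ^+ k) ^+ 2 by rewrite -!exprM mulnC.
rewrite !e -!sf_sqr; move: (normc a ^+ m) (normc b ^+ n) => x y.
by field; rewrite !sf_neq0.
Qed.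

(** Orthonormality turns the squared norm into the sum of a^i b^(K-i) / (i! (K-i)!), a binomial
    expansion. *)
Lemma hom_part_sqnorm K : hs_norm (hom_part K z) ^+ 2 =
  (normc cp ^+ 2 + normc cq ^+ 2) ^+ K / K`!%:R.
Proof.
have oe : hs_orthonormal (fun i => sqb r sg (i, (K - i)%N)).
  move=> i i'; rewrite sqb_orthonormal // xpair_eqE; congr (nat_of_bool _)%:R.
  by case: eqP => [->|//]; rewrite eqxx.
have -> : hom_part K z = \sum_(i <- iota 0 K.+1) c i (K - i) *: sqb r sg (i, (K - i)%N).
  have -> : iota 0 K.+1 = index_iota 0 K.+1 by rewrite /index_iota subn0.
  rewrite big_mkord; apply: eq_bigr => i _.
  by rewrite /homv scalerA cE.
rewrite (hs_pythagoras _ (iota_uniq _ _) oe).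
have -> : iota 0 K.+1 = index_iota 0 K.+1 by rewrite /index_iota subn0.
rewrite big_mkord addrC exprDn mulr_suml; apply: eq_bigr => i _.
have iK : (i <= K)%N by rewrite -ltnS.
rewrite normc_sqr_coef -mulr_natr -(bin_fact iK) !natrM.
have f1 : i`!%:R != 0 :> R by rewrite pnatr_eq0 -lt0n fact_gt0.
have f2 : (K - i)`!%:R != 0 :> R by rewrite pnatr_eq0 -lt0n fact_gt0.
have f3 : 'C(K, i)%:R != 0 :> R by rewrite pnatr_eq0 -lt0n bin_gt0.
by move: (normc cp ^+ 2) (normc cq ^+ 2) => a b; field; rewrite f1 f2 f3.
Qed.

Lemma hom_part_geometric : exists2 Q, 0 <= Q &
  forall K, hs_norm (hom_part K z) <= Q * 2^-1 ^+ K.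
Proof.
set s := normc cp ^+ 2 + normc cq ^+ 2.
have s0 : 0 <= s by rewrite addr_ge0 ?sqr_ge0.
have [Q Q0 hQ] := exp_coeff_geometric s0.
exists (Num.sqrt Q); first exact: sqrtr_ge0.
move=> K; have h0 : 0 <= Num.sqrt Q * 2^-1 ^+ K.
  by rewrite mulr_ge0 ?sqrtr_ge0 ?exprn_ge0 ?invr_ge0.
rewrite -(@ler_pXn2r _ 2) ?nnegrE ?hs_norm_ge0 //.
rewrite hom_part_sqnorm exprMn sqr_sqrtr // -exprM mulnC exprM.
by have -> : 2^-1 ^+ 2 = 4^-1 :> R by field.
Qed.

Definition coh_arr (j k : nat) : C := csum (fun K => pe K j k).
Definition coh : hs R := hs_of_arr coh_arr.

Lemma normc_ent_le (X : hs R) j k : normc (ent X j k) <= hs_norm X.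
Proof.
rewrite -(@ler_pXn2r _ 2) ?nnegrE ?normc_ge0 ?hs_norm_ge0 //.
apply: le_trans (ent_square_bounded X j.+1 k.+1).
rewrite big_ord_recr /= [X in _ + X]big_ord_recr /= addrA lerDr.
by rewrite addr_ge0 // ?sumr_ge0 // => i _; rewrite ?sumr_ge0 ?sqr_ge0 // => ? _; exact: sqr_ge0.
Qed.

Lemma pe_asum j k : asum (fun K => pe K j k).
Proof.
have [Q Q0 hQ] := hom_part_geometric.
by have [] := csum_geometric (fun K => le_trans (normc_ent_le (hom_part K z) j k) (hQ K)).
Qed.

Lemma sum_half_le n d : \sum_(i < d) (2^-1 : R) ^+ (n + i) <= 2 * 2^-1 ^+ n.
Proof.
under eq_bigr do rewrite exprD.
rewrite -mulr_sumr mulrC ler_wpM2r ?exprn_ge0 ?invr_ge0 //.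
apply: le_trans (sum_geom_le _ _ _) _; try lra.
have -> : 1 - 2^-1 = 2^-1 :> R by field.
by rewrite invrK.
Qed.

(** The finite tail sums have geometrically small norms, and [hs_fatou] turns their entrywise limit
    into an operator. At [n = 0] this is the coherent vector itself. *)
Lemma coh_tail : exists2 Q, 0 <= Q & forall n,
  exists2 X : hs R, (forall j k, ent X j k = coh_arr j k - \sum_(K < n) pe K j k) &
  hs_norm X <= Q * 2^-1 ^+ n.
Proof.
have [Q Q0 hQ] := hom_part_geometric; exists (Q * 2) => [|n]; first by rewrite mulr_ge0.
apply: (@hs_fatou _ (fun d => \sum_(i < d) hom_part (n + i) z)) => [d|j k].
  apply: le_trans (hs_norm_sum _ _ _) _.
  apply: (@le_trans _ _ (\sum_(i < d) Q * 2^-1 ^+ (n + i))).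
    by apply: ler_sum => i _; exact: hQ.
  by rewrite -mulr_sumr -mulrA ler_wpM2l // sum_half_le.
apply: cvgc_ext (_ : cvgc _ (fun d => \sum_(K < n + d) pe K j k - \sum_(K < n) pe K j k) _).
  by move=> d; rewrite big_split_ord /= addrAC subrr add0r ent_sum.
apply: cvgcB; last exact: cvgc_cst.
have /cvgcP h := asum_cvg (pe_asum j k); apply/cvgcP.
apply: (cvg_comp (fun d => n + d)%N (fun N => normc (\sum_(K < N) pe K j k - coh_arr j k))) h.
by move=> A [N _ hN]; exists N => // d /= Nd; apply: hN => /=; rewrite (leq_trans Nd) // leq_addl.
Qed.

Lemma ent_coh j k : ent coh j k = coh_arr j k.
Proof.
have [Q _ h] := coh_tail; have [X hX _] := h 0%N.
apply: (@hs_of_arrE _ _ (hs_norm X ^+ 2)) => N K.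
by have := ent_square_bounded X N K;
  under eq_bigr do under eq_bigr do rewrite hX big_ord0 subr0.
Qed.

Lemma coh_remainder : exists2 Q, 0 <= Q & forall n,
  hs_norm (coh - \sum_(K < n) hom_part K z) <= Q * 2^-1 ^+ n.
Proof.
have [Q Q0 h] := coh_tail; exists Q => // n; have [X hX] := h n.
suff -> : X = coh - \sum_(K < n) hom_part K z by [].
by apply: ent_ext => j k; rewrite hX entB ent_coh ent_sum.
Qed.

Lemma coh_functional phi : bounded_functional phi ->
  asum (fun K => phi (hom_part K z)) /\ phi coh = csum (fun K => phi (hom_part K z)).
Proof.
move=> hp; have [_ [M hM]] := hp.
have [Q Q0 hQ] := hom_part_geometric; have [L L0 hL] := coh_remainder.
have hM' X : normc (phi X) <= `|M| * hs_norm X.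
  by apply: le_trans (hM X) _; rewrite ler_wpM2r ?hs_norm_ge0 // ler_norm.
have [a _] : asum (fun K => phi (hom_part K z)) /\ forall m,
   normc (csum (fun K => phi (hom_part K z)) - \sum_(n < m) phi (hom_part n z)) <=
   2 * (`|M| * Q) * 2^-1 ^+ m.
  apply: csum_geometric => n; apply: le_trans (hM' _) _.
  by rewrite -mulrA ler_wpM2l.
split=> //; apply/esym; apply: csum_unique => //; apply/cvgcP.
have h0 : `|M| * (L * 2^-1 ^+ n) @[n --> \oo] --> (0 : R).
  apply: cvg0Z; apply: cvg0Z; apply: cvg_expr; rewrite ger0_norm; lra.
apply: cvg0_le h0 => n; rewrite normc_ge0 andTb.
rewrite -functional_sum // -functionalB // -normc_opp -(mulN1r (phi _)) -functionalZ //.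
rewrite scaleN1r opprB; apply: le_trans (hM' _) _.
by rewrite ler_wpM2l.
Qed.

Lemma coh_arr_y j k : (sq k.+1)%:C * coh_arr j k.+1 =
  r%:C * (sq j)%:C * coh_arr j.-1 k + sg%:C * cq * coh_arr j k.
Proof.
have a := pe_asum.
have aS j' k' := (asumS (fun K => pe K j' k')).2 (a j' k').
rewrite /coh_arr (csumS (a j k.+1)) (csumS (a j.-1 k)) mulrDr pe_y0 [in RHS]mulrDr -addrA.
congr (_ + _); rewrite -csumZ // -[X in _ = X + _]csumZ // -[X in _ = _ + X]csumZ //.
rewrite -csumD; [|exact: asumZ|exact: asumZ].
by congr csum; apply/funext => K; rewrite pe_y.
Qed.

Lemma coh_arr_x j : (sq j.+1)%:C * coh_arr j.+1 0 = sg%:C * cp * coh_arr j 0.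
Proof.
have a := pe_asum.
have aS j' k' := (asumS (fun K => pe K j' k')).2 (a j' k').
rewrite /coh_arr (csumS (a j.+1 0%N)) mulrDr pe_x0 add0r -csumZ // -csumZ //.
by congr csum; apply/funext => K; rewrite pe_x.
Qed.

Lemma coh_arr00 : coh_arr 0 0 = (sg * expR (r ^+ 2 / sg ^+ 2 * normc z ^+ 2))%:C.
Proof.
rewrite /coh_arr rCM.
have -> : r ^+ 2 / sg ^+ 2 * normc z ^+ 2 = 2 * (r ^+ 2 / sg ^+ 2 * normc z ^+ 2) / 2 by field; rewrite gt_eqF.
apply: csum_gauss; first exact: pe_asum.
- by rewrite pe_antidiag antidiag0 squeeze_ground /= expr0 mulr1 /c !expr0 sf0 mulr1 divr1 mul1r.
- by rewrite pe_antidiag /antidiag big_ord_recl big_ord1 /= /squeeze /= !mulr0 addr0.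
by move=> n; rewrite pe_00.
Qed.

(** Both sides obey the same first-order recurrences, down column 0 and then from column to column.
    The constant in the exponential is forced at (0, 0), where (1 + r^2) / (2 sg^2) - 1/2 = r^2 /
    sg^2. *)
Lemma coh_arrE j k : coh_arr j k =
  (expR ((1 + r ^+ 2) / sg ^+ 2 / 2 * normc z ^+ 2))%:C *
  (sg * r ^+ k * (w ^+ j / w ^+ k))%:C * weyl_vec z k j.
Proof.
have w_neq0 : w != 0 by rewrite gt_eqF.
have sg_neq0 : sg != 0 by rewrite gt_eqF.
have nz n : (sq n.+1)%:C != 0 :> C by rewrite fmorph_eq0 sqS_neq0.
have ww : w%:C != 0 :> C by rewrite fmorph_eq0.
have ss : sg%:C != 0 :> C by rewrite fmorph_eq0.
have wn n : (w ^+ n)%:C != 0 :> C by rewrite fmorph_eq0 expf_neq0.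
set kap := expR _.
elim: k j => [|k IH] j.
  elim: j => [|j IH].
    rewrite coh_arr00 weyl_vec00 !expr0 !mulr1 divr1 mulr1 -!rCM; congr (_%:C).
    rewrite /kap [RHS]mulrAC -expRD [RHS]mulrC; congr (_ * expR _).
    have -> : r ^+ 2 = 1 - sg ^+ 2 by rewrite sgE opprB addrC subrK.
    by field.
  apply: (mulfI (nz j)); rewrite coh_arr_x IH.
  have := weyl_vec_down z 0 j; rewrite sqC0 mul0r => /esym/eqP; rewrite subr_eq0 => /eqP h.
  rewrite [RHS]mulrCA h /cp [w ^+ j.+1]exprS !(rCM, rCV); field.
  by rewrite ?ww ?ss ?wn.
apply: (mulfI (nz k)); rewrite coh_arr_y !IH [RHS]mulrCA weyl_vec_up.
rewrite /cq ![_ ^+ k.+1]exprS !(rCM, rCV, rCN).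
case: j => [|j]; rewrite ?sqC0 /=.
  rewrite !expr0; field; by rewrite ?ww ?ss ?wn.
rewrite exprS !(rCM); field; by rewrite ?ww ?ss ?wn.
Qed.

End FixedPoint.
End CoherentVectors.

(** * The flow of a real-linear map of the plane *)

Section RealLinearFlow.
Variable R : realType.
Local Notation C := R[i].
Variables (A B : C).

Let Z (z : C) : C := A * z + B * z^*.
Let e (t : R) (z : C) : C := rexp Z t z.

Let ZR (a : R) x : Z (a%:C * x) = a%:C * Z x.
Proof. by rewrite /Z conjM conj_real; ring. Qed.

Let iterZR n (a : R) x : iter n Z (a%:C * x) = a%:C * iter n Z x.
Proof. by elim: n => [|n IH] //; rewrite !iterS IH ZR. Qed.

Let iterZ_le n x : normc (iter n Z x) <= (normc A + normc B) ^+ n * normc x.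
Proof.
elim: n => [|n IH]; first by rewrite expr0 mul1r.
rewrite iterS exprS -mulrA; apply: (@le_trans _ _ ((normc A + normc B) * normc (iter n Z x))).
  by apply: le_trans (normcD _ _) _; rewrite !normcM normc_conj mulrDl.
by rewrite ler_wpM2l ?addr_ge0 ?normc_ge0.
Qed.

Let term (t : R) z n : C := (t ^+ n / n`!%:R)%:C * iter n Z z.

Lemma rexp_geometric t z : exists2 Q, 0 <= Q & forall n, normc (term t z n) <= Q * 2^-1 ^+ n.
Proof.
have s0 : 0 <= `|t| * (normc A + normc B) by rewrite mulr_ge0 ?addr_ge0 ?normc_ge0.
have [Q Q0 hQ] := exp_coeff_geometric s0.
exists (Q * normc z) => [|n]; first by rewrite mulr_ge0 ?normc_ge0.
rewrite normcM normcR normrM normrX normfV normr_nat.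
apply: (@le_trans _ _ ((`|t| * (normc A + normc B)) ^+ n / n`!%:R * normc z)).
  rewrite exprMn -!mulrA ler_wpM2l ?exprn_ge0 //.
  by rewrite mulrCA ler_wpM2l ?invr_ge0.
rewrite [X in _ <= X]mulrAC ler_wpM2r ?normc_ge0 //; apply: le_trans (hQ n) _.
rewrite ler_wpM2l //; apply: lerXn2r; rewrite ?nnegrE ?invr_ge0 //.
by rewrite lef_pV2 ?posrE // ler_nat.
Qed.

Lemma rexp_asum t z : asum (term t z).
Proof. by have [Q _ hQ] := rexp_geometric t z; have [] := csum_geometric hQ. Qed.

Lemma rexp0 z : e 0 z = z.
Proof.
rewrite /e /rexp (@csum_finite _ _ 1) => [|[|n] _] //.
  by rewrite big_ord1 expr0 fact0 divr1 mul1r.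
by rewrite exprS !mul0r.
Qed.

Lemma rexp_real t (a : R) z : e t (a%:C * z) = a%:C * e t z.
Proof.
rewrite -csumZ; last exact: rexp_asum.
by congr csum; apply/funext => n; rewrite iterZR mulrCA.
Qed.

Lemma rexp_commute t z : Z (e t z) = e t (Z z).
Proof.
have a := rexp_asum t z.
have ac : asum (fun n => (term t z n)^*).
  by case: a => M hM; exists M => N; under eq_bigr do rewrite normc_conj.
rewrite /Z -csumZ // -csum_conj // -csumZ // -csumD; [|exact: asumZ|exact: asumZ].
congr csum; apply/funext => n; rewrite -[LHS]/(Z (term t z n)) ZR.
by rewrite -iterS iterSr.
Qed.

Lemma cvgn_scaled_series (c : nat -> R) (z : C) (x : R) :
  (forall n, `|c n| <= normc (iter n Z z) / n`!%:R) -> cvgn (pseries c x).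
Proof.
move=> hc; have [M hM] := rexp_asum x z.
apply: (@bounded_series_cvg _ _ M) => N; apply: le_trans (hM N); apply: ler_sum => n _.
rewrite normrM normcM normcR !normrM normfV normr_nat normrX mulrC -mulrA ler_wpM2l ?exprn_ge0 //.
by rewrite mulrC.
Qed.

Section Component.
Variable p : C -> R.
Hypothesis pR : forall (a : R) z, p (a%:C * z) = a * p z.
Hypothesis p_le : forall z, `|p z| <= normc z.
Hypothesis pcsum : forall f, p (csum f) = limn (series (fun n => p (f n))).

Let coeff z n : R := p (iter n Z z) / n`!%:R.

Let coeff_le z n : `|coeff z n| <= normc (iter n Z z) / n`!%:R.
Proof. by rewrite normrM normfV normr_nat ler_wpM2r ?invr_ge0. Qed.

Let coeff_diffs z : pseries_diffs (coeff z) = coeff (Z z).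
Proof.
apply/funext => n; rewrite /pseries_diffs /coeff -iterSr factS natrM invfM.
by rewrite mulrCA mulVKf ?pnatr_eq0.
Qed.

Let component_pseries z : (fun t => p (e t z)) = fun t => limn (pseries (coeff z) t).
Proof.
apply/funext => t; rewrite pcsum; congr (limn (series _)); apply/funext => n.
rewrite pR; transitivity (coeff z n * t ^+ n) => //.
by rewrite /coeff; move: (n`!%:R^-1) => c; ring.
Qed.

(** Here [p] stands for the real or the imaginary part. Each component of the flow is a real power
    series in time, and its formal derivative is the series started at [Z z]. *)
Lemma component_derive z (t : R) : is_derive t (1 : R) (fun t => p (e t z)) (p (e t (Z z))).
Proof.
have cv z' K : cvgn (pseries (coeff z') K) by apply: (@cvgn_scaled_series _ z'); exact: coeff_le.
rewrite component_pseries.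
have -> : p (e t (Z z)) = limn (pseries (coeff (Z z)) t).
  exact: (congr1 (fun f => f t) (component_pseries (Z z))).
rewrite -coeff_diffs; apply: (@pseries_snd_diffs _ _ (`|t| + 1)); rewrite ?coeff_diffs //.
by rewrite [X in _ < X]ger0_norm ?addr_ge0 // ltrDl.
Qed.

End Component.

Lemma Re_rexp_derive z t :
  is_derive t (1 : R) (fun t => Re (e t z)) (Re (e t (Z z))).
Proof.
apply: (@component_derive (fun z => Re z)) => //; first exact: ReM_real.
exact: normc_Re.
Qed.

Lemma Im_rexp_derive z t :
  is_derive t (1 : R) (fun t => Im (e t z)) (Im (e t (Z z))).
Proof.
apply: (@component_derive (fun z => Im z)) => //; first exact: ImM_real.
exact: normc_Im.
Qed.

Lemma rexp_right_derivative z :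
  cvgc (0 : R)^'+ (fun t => (t^-1)%:C * (e t z - z)) (Z z).
Proof.
have dq (f : R -> R) (d : R) : is_derive (0 : R) (1 : R) f d ->
    t^-1 * (f t - f 0) @[t --> (0 : R)^'+] --> d.
  move=> [df fd]; apply: cvg_dnbhs_at_right; rewrite -fd; apply: cvg_trans df.
  apply: near_eq_cvg; apply: nearW => h /=.
  by rewrite addr0 /GRing.scale /= mulr1.
have h0 : forall t : R, rexp Z t z - z = rexp Z t z - rexp Z 0 z.
  by move=> t; have := rexp0 z; rewrite /e => ->.
have ez : e 0 (Z z) = Z z := rexp0 (Z z).
apply: cvgc_ReIm.
  have := dq _ _ (Re_rexp_derive z 0); rewrite ez; apply: cvg_trans.
  apply: near_eq_cvg; apply: nearW => t; rewrite ReM_real ReB rexp0.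
  by [].
have := dq _ _ (Im_rexp_derive z 0); rewrite ez; apply: cvg_trans.
apply: near_eq_cvg; apply: nearW => t; rewrite ImM_real ImB rexp0.
by [].
Qed.

Lemma sqr_rexp_derive z t :
  is_derive t (1 : R) (fun t => normc (e t z) ^+ 2) (2 * Re ((e t z)^* * Z (e t z))).
Proof.
have h1 := Re_rexp_derive z t; have h2 := Im_rexp_derive z t.
rewrite rexp_commute.
have -> : (fun t => normc (e t z) ^+ 2) =
    (fun t => Re (e t z)) * (fun t => Re (e t z)) + (fun t => Im (e t z)) * (fun t => Im (e t z)).
  by apply/funext => s; rewrite sqr_normcE !expr2.
apply: is_derive_eq.
case: (e t z) => a b; case: (e t (Z z)) => c d; rewrite /= /GRing.scale /=.
by ring.
Qed.

End RealLinearFlow.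

(** * The Gaussian factor along the flow *)

Section WeylFactor.
Variable R : realType.
Local Notation C := R[i].

Lemma Rintegral_FTC2 (f F : R -> R) (t : R) : 0 <= t ->
  (forall x : R, is_derive x (1 : R) F (f x)) -> (forall x : R, derivable f x 1) ->
  \int[lebesgue_measure]_(x in `[0, t]) f x = F t - F 0.
Proof.
move=> t0 dF df.
have cF : continuous F.
  by move=> x; apply: differentiable_continuous; apply/derivable1_diffP; case: (dF x).
move: t0; rewrite le_eqVlt => /predU1P[<-|t0]; first by rewrite set_itv1 Rintegral_set1 subrr.
rewrite /Rintegral (@continuous_FTC2 _ f F 0 t) //.
- by apply: derivable_within_continuous => x _; exact: df.
- split; first by move=> x _; case: (dF x).
    by apply: cvg_at_right_filter; exact: cF.
  by apply: cvg_at_left_filter; exact: cF.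
by move=> x _; rewrite derive1E; exact: derive_val.
Qed.

Variables (Omega : R) (kappa : C) (u v : 'I_2 -> C) (cfac : R).
Local Notation Z := (drift_map Omega kappa u v).
Hypothesis noiseE : forall y : C,
  Re (y^* * noise_map u v y) = - cfac * (2 * Re (y^* * Z y)).

(** By [noiseE] the integrand is [- cfac] times the derivative of the squared modulus along the
    flow, so the integral is explicit. *)
Lemma weyl_factorE (t : R) z : 0 <= t -> weyl_factor Omega kappa 0 u v t z =
  (expR (cfac / 2 * (normc (rexp Z t z) ^+ 2 - normc z ^+ 2)))%:C.
Proof.
move=> t0; rewrite /weyl_factor.
set A : C := - gamma u v +i* Omega; set B : C := (0 +i* 1) * kappa.
have rc s z' : Z (rexp Z s z') = rexp Z s (Z z') := @rexp_commute R A B s z'.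
have r00 : rexp Z 0 z = z := @rexp0 R A B z.
have dR z' s := @Re_rexp_derive _ A B z' s.
have dI z' s := @Im_rexp_derive _ A B z' s.
have I1 : \int[lebesgue_measure]_(r in `[0, t])
      Re ((rexp Z r z)^* * noise_map u v (rexp Z r z)) =
    - cfac * normc (rexp Z t z) ^+ 2 - - cfac * normc z ^+ 2.
  have dF (x : R) : is_derive x (1 : R) (fun r => - cfac * normc (rexp Z r z) ^+ 2)
      (- cfac * (2 * Re ((rexp Z x z)^* * Z (rexp Z x z)))).
    have d := @sqr_rexp_derive _ A B z x.
    exact: (is_deriveZ (- cfac) d).
  have df (x : R) :
      derivable (fun r => - cfac * (2 * Re ((rexp Z r z)^* * Z (rexp Z r z)))) x 1.
    have -> : (fun r => - cfac * (2 * Re ((rexp Z r z)^* * Z (rexp Z r z)))) =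
        (- cfac * 2) *: ((fun r => Re (rexp Z r z)) * (fun r => Re (rexp Z r (Z z))) +
          (fun r => Im (rexp Z r z)) * (fun r => Im (rexp Z r (Z z)))).
      apply/funext => r; rewrite rc.
      rewrite -[RHS]/(- cfac * 2 * (Re (rexp Z r z) * Re (rexp Z r (Z z)) +
          Im (rexp Z r z) * Im (rexp Z r (Z z)))).
      by case: (rexp Z r z) => a b; case: (rexp Z r (Z z)) => c d /=; ring.
    apply: derivableZ; apply: derivableD; apply: derivableM.
    - by case: (dR z x).
    - by case: (dR (Z z) x).
    - by case: (dI z x).
    by case: (dI (Z z) x).
  have -> : (fun r => Re ((rexp Z r z)^* * noise_map u v (rexp Z r z))) =
      (fun r => - cfac * (2 * Re ((rexp Z r z)^* * Z (rexp Z r z)))).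
    by apply/funext => r; rewrite noiseE.
  by rewrite (Rintegral_FTC2 t0 dF df) r00.
have I2 : \int[lebesgue_measure]_(r in `[0, t]) Re ((0 : C)^* * rexp Z r z) = 0.
  have -> : (fun r => Re ((0 : C)^* * rexp Z r z)) = (fun=> 0).
    by apply/funext => r; rewrite conj0 mul0r.
  have d0 (x : R) : is_derive x (1 : R) (fun=> 0 : R) 0 by exact: is_derive_cst.
  have d1 (x : R) : derivable (fun=> 0 : R) x 1 by exact: derivable_cst.
  by rewrite (Rintegral_FTC2 t0 d0 d1) subrr.
rewrite I1 I2 /cexp /= cos0 sin0.
have -> : (1 +i* 0 : C) = 1 by [].
rewrite mulr1; congr ((expR _)%:C); by field.
Qed.

End WeylFactor.

(** * Eigenvalues of the symmetric powers of a two-by-two matrix *)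

Section SymmetricPowerSpectrum.
Variables (F : fieldType) (A A' B B' lam mu : F) (K : nat).
Hypothesis sum_lm : lam + mu = A + A'.
Hypothesis prod_lm : lam * mu = A * A' - B * B'.
Hypothesis B0 : B' = 0 -> B = 0.

(* Matrix of the derivation x -> A x + B y, y -> B' x + A' y on the forms of
   degree [K], in the basis x^i y^(K-i). *)
Definition sym_entry (i j : nat) : F :=
  (i == j)%:R * (i%:R * A + (K - i)%:R * A') + (j == i.+1)%:R * (i.+1%:R * B) +
  (i == j.+1)%:R * ((K - j)%:R * B').

Definition sym_mx : 'M[F]_K.+1 := \matrix_(i, j) sym_entry i j.

(* The derivation on dehomogenized forms f(x) = F(x, 1), by Euler's identity. *)
Definition sym_op (f : {poly F}) : {poly F} :=
  (B%:P + (A - A')%:P * 'X - B'%:P * 'X^2) * f^`() + K%:R * ((B'%:P * 'X + A'%:P) * f).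

Lemma sum_pick (n i : nat) (h : nat -> F) :
  \sum_(j < n) (i == j :> nat)%:R * h j = if (i < n)%N then h i else 0.
Proof.
elim: n => [|n IH]; first by rewrite big_ord0.
rewrite big_ord_recr /= IH ltnS; have [->|ne] := eqVneq i n.
  by rewrite ltnn leqnn mul1r add0r.
by rewrite mul0r addr0 [in RHS]leq_eqVlt (negPf ne).
Qed.

Lemma coef_sym_op (f : {poly F}) i : (sym_op f)`_i =
  i.+1%:R * B * f`_i.+1 + (i%:R * (A - A') + K%:R * A') * f`_i +
  (if i is i'.+1 then (K%:R - i'%:R) * B' * f`_i' else 0).
Proof.
have E : sym_op f = B *: f^`() + ((A - A') *: ('X * f^`()) - B' *: ('X * ('X * f^`()))) +
    K%:R *: (B' *: ('X * f) + A' *: f).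
  by rewrite /sym_op -!mul_polyC; rewrite -polyC_natr; ring.
have cd n : f^`()`_n = n.+1%:R * f`_n.+1 by rewrite coef_deriv mulr_natl.
rewrite E !(coefD, coefN, coefZ, coefXM) !cd.
by case: i => [|[|i]] /=; rewrite ?cd; ring.
Qed.

(** The right-hand side is that of [coef_sym_op]; the condition at [K.+1] removes the term that
    would leave the matrix at [i = K]. *)
Lemma sum_sym_entry (c : nat -> F) (i : nat) : (i <= K)%N -> c K.+1 = 0 ->
  \sum_(j < K.+1) sym_entry i j * c j =
  i.+1%:R * B * c i.+1 + (i%:R * (A - A') + K%:R * A') * c i +
  (if i is i'.+1 then (K%:R - i'%:R) * B' * c i' else 0).
Proof.
move=> iK cK.
transitivity (\sum_(j < K.+1) (i == j :> nat)%:R * ((i%:R * A + (K - i)%:R * A') * c j) +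
   \sum_(j < K.+1) (i.+1 == j :> nat)%:R * (i.+1%:R * B * c j) +
   \sum_(j < K.+1) (i == j.+1 :> nat)%:R * ((K - j)%:R * B' * c j)).
  rewrite -!big_split; apply: eq_bigr => j _ /=.
  by rewrite /sym_entry [(j == i.+1 :> nat)]eq_sym; ring.
rewrite (sum_pick _ i (fun j => (i%:R * A + (K - i)%:R * A') * c j)).
rewrite (sum_pick _ i.+1 (fun j => i.+1%:R * B * c j)) !ltnS iK.
rewrite natrB //.
have -> : (if (i < K)%N then i.+1%:R * B * c i.+1 else 0) = i.+1%:R * B * c i.+1.
  case: ltnP => // Ki; have -> : i = K by lia.
  by rewrite cK mulr0.
case: i iK => [|i] iK.
  by rewrite [X in _ + X]big1 => [|j _]; [ring|rewrite mul0r].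
rewrite [X in _ + X](eq_bigr (fun j : 'I_K.+1 => (i == j :> nat)%:R * ((K - j)%:R * B' * c j))).
  rewrite (sum_pick _ i (fun j => (K - j)%:R * B' * c j)) ltnS ltnW //.
  by rewrite natrB ?(ltnW iK) //; ring.
by move=> j _; rewrite eqSS.
Qed.

Lemma sym_mx_poly (c : 'cV[F]_K.+1) (a : F) :
  let f := \poly_(i < K.+1) c (inord i) 0 in
  (sym_mx *m c = a *: c) <-> (sym_op f = a *: f).
Proof.
move=> f.
have fE i : f`_i = if (i < K.+1)%N then c (inord i) 0 else 0 by rewrite coef_poly.
have fO (i : 'I_K.+1) : f`_i = c i 0 by rewrite fE ltn_ord inord_val.
have f0 i : (K < i)%N -> f`_i = 0 by move=> h; rewrite fE ltnS leqNgt h.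
have mE (i : 'I_K.+1) : (sym_mx *m c) i 0 = (sym_op f)`_i.
  rewrite mxE coef_sym_op -(sum_sym_entry (c := fun j => f`_j)) ?f0 //; last by rewrite -ltnS.
  by apply: eq_bigr => j _; rewrite mxE fO.
split=> h.
  apply/polyP => i; rewrite coefZ; have [iK|Ki] := ltnP i K.+1.
    by have := congr1 (fun m : 'cV_K.+1 => m (Ordinal iK) 0) h; rewrite mE mxE -fO.
  rewrite coef_sym_op !f0 ?mulr0 ?add0r //; last by lia.
  case: i Ki => [|i] Ki //; case: (ltnP K i) => [Ki'|iK]; first by rewrite f0 ?mulr0.
  (* At [i = K] the factor [K%:R - i%:R] vanishes, so no term of degree K + 1 is created. *)
  have -> : i = K by apply/eqP; rewrite eqn_leq iK -ltnS.
  by rewrite subrr !mul0r.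
apply/colP => i; rewrite mE h mxE coefZ fO.
by [].
Qed.

(** The roots are the fixed points of the induced vector field on the projective line, that is, the
    eigendirections of the two-by-two matrix. *)
Lemma quadratic_factor : B' != 0 ->
  B%:P + (A - A')%:P * 'X - B'%:P * 'X^2 =
  - B'%:P * ('X - ((mu - A') / B')%:P) * ('X - ((lam - A') / B')%:P) :> {poly F}.
Proof.
move=> nB.
have e1 : (mu - A') / B' + (lam - A') / B' = (A - A') / B'.
  rewrite -mulrDl; congr (_ / _).
  by rewrite addrACA [mu + lam]addrC sum_lm; ring.
have e2 : B' * ((mu - A') / B' * ((lam - A') / B')) = - B.
  have -> : B' * ((mu - A') / B' * ((lam - A') / B')) =
    (lam * mu - (lam + mu) * A' + A' ^+ 2) / B' by field.
  by rewrite sum_lm prod_lm; field.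
have E (x y : F) : - B'%:P * ('X - x%:P) * ('X - y%:P) =
    (- (B' * (x * y)))%:P + (B' * (x + y))%:P * 'X - B'%:P * 'X^2 :> {poly F}.
  by rewrite !(polyCM, polyCD, polyCN); ring.
have e3 : B' * ((A - A') / B') = A - A' by field.
by rewrite E e1 e2 opprK e3.
Qed.

Lemma deriv_XsubC_exp (x : F) n :
  ('X - x%:P) * (('X - x%:P) ^+ n)^`() = n%:R * ('X - x%:P) ^+ n :> {poly F}.
Proof.
rewrite deriv_exp derivXsubC mul1r mulr_natl; case: n => [|n].
  by rewrite !mulr0n mulr0.
by rewrite mulrnAr -exprS.
Qed.

(** For nonzero [B'], [d] is the order of vanishing of [f] at [x0]: after division by (X - x0)^d,
    evaluation at [x0] leaves a = d (lam - mu) + K mu. Nothing requires [x0] and [x1] to differ,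
    which covers the defective case. For [B' = 0] the operator is diagonal on monomials and the
    leading coefficient decides. *)
Lemma sym_op_eigen_forward (f : {poly F}) a : f != 0 -> (size f <= K.+1)%N ->
  sym_op f = a *: f -> exists2 d, (d <= K)%N & a = d%:R * lam + (K - d)%:R * mu.
Proof.
move=> nf sf ef; have [B'0|nB] := eqVneq B' 0.
  have BB := B0 B'0; pose n := (size f).-1.
  have sn : size f = n.+1 by rewrite /n prednK // size_poly_gt0.
  have nK : (n <= K)%N by rewrite -ltnS -sn.
  have lc : f`_n != 0 by rewrite -[f`_n]/(lead_coef f) lead_coef_eq0.
  have aE : a = n%:R * A + (K - n)%:R * A'.
    have := congr1 (fun p : {poly F} => p`_n) ef.
    rewrite coef_sym_op coefZ BB B'0 !mulr0 !mul0r.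
    have -> : (if n is i'.+1 then (K%:R - i'%:R) * 0 * f`_i' else 0) = 0.
      by case: (n) => // m; rewrite mulr0 mul0r.
    rewrite add0r addr0 => /(mulIf lc) <-; rewrite natrB //; ring.
  have : (lam - A) * (lam - A') = 0.
    have muE : mu = A + A' - lam by rewrite -sum_lm; ring.
    have := prod_lm; rewrite muE BB mul0r subr0 => h.
    transitivity (A * A' - lam * (A + A' - lam)); first by ring.
    by rewrite h subrr.
  move/eqP; rewrite mulf_eq0 !subr_eq0 => /orP[/eqP lA|/eqP lA].
    exists n => //; have -> : mu = A' by apply: (@addrI _ lam); rewrite sum_lm lA.
    by rewrite lA.
  exists (K - n)%N; first exact: leq_subr.
  have -> : mu = A by apply: (@addrI _ lam); rewrite sum_lm lA addrC.
  by rewrite lA aE subKn // addrC.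
pose x0 := (mu - A') / B'; pose x1 := (lam - A') / B'.
have [d [g ng fE]] := multiplicity_XsubC f x0.
have gx : g.[x0] != 0 by move: ng; rewrite nf.
have ng0 : g != 0 by apply: contraNneq gx => ->; rewrite horner0.
have nX : ('X - x0%:P) ^+ d != 0 :> {poly F} by rewrite expf_neq0 // polyXsubC_eq0.
have dK : (d <= K)%N.
  have : (size f <= K.+1)%N by [].
  rewrite fE size_mul // size_exp_XsubC addnS /= => h.
  have : (0 < size g)%N by rewrite size_poly_gt0.
  by move=> s0; rewrite -ltnS (leq_trans _ h) // -add1n leq_add2r.
exists d => //.
have key : - B'%:P * ('X - x1%:P) * (('X - x0%:P) * g^`() + d%:R * g) +
    K%:R * ((B'%:P * 'X + A'%:P) * g) = a *: g.
  apply: (mulIf nX); rewrite -scalerAl -fE -ef /sym_op quadratic_factor //.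
  rewrite fE derivM.
  have -> : - B'%:P * ('X - x0%:P) * ('X - x1%:P) *
      (g^`() * ('X - x0%:P) ^+ d + g * (('X - x0%:P) ^+ d)^`()) =
      - B'%:P * ('X - x1%:P) * (('X - x0%:P) * g^`() * ('X - x0%:P) ^+ d +
        g * (('X - x0%:P) * (('X - x0%:P) ^+ d)^`())) by ring.
  by rewrite deriv_XsubC_exp; ring.
have := congr1 (fun p : {poly F} => p.[x0]) key.
rewrite -[d%:R]polyC_natr -[K%:R]polyC_natr.
rewrite !(hornerM, hornerD, hornerN, hornerXsubC, hornerX, hornerC, hornerZ) subrr mul0r add0r => h.
apply: (mulIf gx); rewrite -h natrB //.
by rewrite /x0 /x1; field.
Qed.

(** The eigenforms are products of powers of the two linear eigenforms. *)
Lemma sym_op_eigen_backward d : (d <= K)%N ->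
  exists f : {poly F}, [/\ f != 0, (size f <= K.+1)%N &
    sym_op f = (d%:R * lam + (K - d)%:R * mu) *: f].
Proof.
move=> dK; have [B'0|nB] := eqVneq B' 0.
  have BB := B0 B'0.
  have mono n : (n <= K)%N -> sym_op 'X^n = (n%:R * A + (K - n)%:R * A') *: 'X^n.
    move=> nK; rewrite /sym_op BB B'0 -mul_polyC derivXn natrB //.
    rewrite !polyC0.
    case: n nK => [|n] _ /=.
      by rewrite mulr0n mulr0 !expr0 !(polyCM, polyCD, polyCN, polyC_natr); ring.
    have -> : 'X^n *+ n.+1 = n.+1%:R * 'X^n :> {poly F} by rewrite mulr_natl.
    by rewrite ['X^(n.+1)]exprS !(polyCM, polyCD, polyCN, polyC_natr); ring.
  have : (lam - A) * (lam - A') = 0.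
    have muE : mu = A + A' - lam by rewrite -sum_lm; ring.
    have := prod_lm; rewrite muE BB mul0r subr0 => h.
    transitivity (A * A' - lam * (A + A' - lam)); first by ring.
    by rewrite h subrr.
  move/eqP; rewrite mulf_eq0 !subr_eq0 => /orP[/eqP lA|/eqP lA].
    exists 'X^d; rewrite -size_poly_eq0 size_polyXn ltnS; split=> //.
    have -> : mu = A' by apply: (@addrI _ lam); rewrite sum_lm lA.
    by rewrite lA mono.
  exists 'X^(K - d); rewrite -size_poly_eq0 size_polyXn ltnS leq_subr; split=> //.
  have -> : mu = A by apply: (@addrI _ lam); rewrite sum_lm lA addrC.
  by rewrite lA mono ?leq_subr // subKn // addrC.
pose x0 := (mu - A') / B'; pose x1 := (lam - A') / B'.
exists (('X - x0%:P) ^+ d * ('X - x1%:P) ^+ (K - d)); split.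
- by rewrite mulf_neq0 // expf_neq0 // polyXsubC_eq0.
- by rewrite size_mul ?expf_neq0 ?polyXsubC_eq0 // !size_exp_XsubC; lia.
rewrite /sym_op quadratic_factor // derivM -mul_polyC.
set f0 := ('X - x0%:P) ^+ d; set f1 := ('X - x1%:P) ^+ (K - d).
transitivity (- B'%:P * (('X - x1%:P) * (('X - x0%:P) * f0^`()) * f1 +
   ('X - x0%:P) * f0 * (('X - x1%:P) * f1^`())) + K%:R * ((B'%:P * 'X + A'%:P) * (f0 * f1))).
  by rewrite -/x0 -/x1; ring.
rewrite !deriv_XsubC_exp -/f0 -/f1 !natrB //.
have h0 : B'%:P * x0%:P = (mu - A')%:P :> {poly F} by rewrite -polyCM /x0 mulrCA divff // mulr1.
have h1 : B'%:P * x1%:P = (lam - A')%:P :> {poly F} by rewrite -polyCM /x1 mulrCA divff // mulr1.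
transitivity ((d%:R * (B'%:P * x1%:P) + (K%:R - d%:R) * (B'%:P * x0%:P) + K%:R * A'%:P) * (f0 * f1)).
  by ring.
by rewrite h0 h1 !(polyCM, polyCD, polyCN, polyC_natr); ring.
Qed.

Lemma sym_mx_eigen_col a :
  (exists2 c : 'cV[F]_K.+1, c != 0 & sym_mx *m c = a *: c) <->
  (exists2 d, (d <= K)%N & a = d%:R * lam + (K - d)%:R * mu).
Proof.
split=> [[c nc ec]|[d dK ->]].
  apply: (@sym_op_eigen_forward (\poly_(i < K.+1) c (inord i) 0)).
  - apply: contraNneq nc => f0; apply/eqP/colP => i; rewrite mxE.
    have := congr1 (fun p : {poly F} => p`_i) f0.
    by rewrite coef_poly ltn_ord inord_val coef0.
  - exact: size_poly.
  by apply/sym_mx_poly.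
have [f [nf sf ef]] := sym_op_eigen_backward dK.
pose c : 'cV[F]_K.+1 := \col_i f`_i.
have fE : \poly_(i < K.+1) c (inord i) 0 = f.
  apply/polyP => i; rewrite coef_poly; case: ltnP => h; first by rewrite mxE inordK.
  by rewrite nth_default // (leq_trans sf).
exists c; last by apply/sym_mx_poly; rewrite fE.
apply: contraNneq nf => c0; rewrite -fE; apply/eqP/polyP => i.
by rewrite coef_poly coef0 c0 mxE; case: ifP.
Qed.

(** Rows serve the generator and columns its adjoint; the two cases are exchanged by transposition,
    which preserves the characteristic polynomial. *)
Lemma sym_mx_eigen_row a :
  (exists2 x : 'rV[F]_K.+1, x != 0 & x *m sym_mx = a *: x) <->
  (exists2 d, (d <= K)%N & a = d%:R * lam + (K - d)%:R * mu).
Proof.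
have T : eigenvalue sym_mx a = eigenvalue sym_mx^T a.
  rewrite !eigenvalue_root_char /char_poly -[in RHS]det_tr; congr (root (\det _) _).
  by apply/matrixP => i j; rewrite !mxE eq_sym.
rewrite -sym_mx_eigen_col; split=> [[x nx ex]|[c nc ec]].
  have /eigenvalueP [v ev nv] : eigenvalue sym_mx^T a by rewrite -T; apply/eigenvalueP; exists x.
  exists v^T; first by rewrite trmx_eq0.
  by rewrite -[sym_mx]trmxK -trmx_mul ev linearZ.
have /eigenvalueP [v ev nv] : eigenvalue sym_mx a.
  rewrite T; apply/eigenvalueP; exists c^T; last by rewrite trmx_eq0.
  by rewrite -trmx_mul ec linearZ.
by exists v.
Qed.

End SymmetricPowerSpectrum.

Lemma ReM_nat (R : realType) n (z : R[i]) : Re (n%:R * z) = n%:R * Re z.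
Proof. by rewrite -ReM_real rmorph_nat. Qed.

(** * Interpolation of forms in z and its conjugate *)

Section HomogeneousInterpolation.
Variable R : realType.
Local Notation C := R[i].

Definition node (y : nat) : C := 1 +i* y%:R.

Lemma node_neq0 y : node y != 0.
Proof. by apply/eqP => -[] /eqP; rewrite oner_eq0. Qed.

Definition node_mx K : 'M[C]_K.+1 :=
  \matrix_(y, i) (node y ^+ i * (node y)^* ^+ (K - i)).

Lemma node_ratio_inj : injective (fun y => node y / (node y)^*).
Proof.
move=> y y' h; have nz x : (node x)^* != 0 by rewrite conjC_eq0 node_neq0.
have {h} : node y * (node y')^* = node y' * (node y)^*.
  by apply/eqP; rewrite -eqr_div ?nz //; apply/eqP.
move=> /(congr1 Im) /=; rewrite !mul1r !mulr1 => h.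
have /eqP : y%:R = y'%:R :> R by lra.
by rewrite eqr_nat => /eqP.
Qed.

(* The ratios [node y / (node y)^*] are distinct, so evaluating the forms of
   degree [K] at the nodes is a Vandermonde system. *)
Lemma node_mx_unit K : node_mx K \in unitmx.
Proof.
rewrite -unitmx_tr -row_free_unit -kermx_eq0; apply/rowV0P => v /sub_kermxP vM.
pose q := \poly_(i < K.+1) v 0 (inord i).
have qE : q = 0.
  apply: (@roots_geq_poly_eq0 _ q [seq node y / (node y)^* | y <- iota 0 K.+1]).
  - apply/allP => _ /mapP[y + ->]; rewrite mem_iota add0n => /andP[_ yK].
    have nz : (node y)^* != 0 by rewrite conjC_eq0 node_neq0.
    have := congr1 (fun m : 'rV[C]_K.+1 => m 0 (Ordinal yK)) vM; rewrite !mxE => h.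
    apply/rootP; apply: (mulfI (expf_neq0 K nz)); rewrite mulr0 -[RHS]h horner_poly mulr_sumr.
    apply: eq_bigr => i _; rewrite !mxE inord_val /= expr_div_n.
    have iK : (i <= K)%N by rewrite -ltnS.
    have -> : (node y)^* ^+ K = (node y)^* ^+ (K - i) * (node y)^* ^+ i by rewrite -exprD subnK.
    by field; rewrite expf_neq0.
  - by rewrite map_inj_uniq ?iota_uniq //; exact: node_ratio_inj.
  by rewrite size_map size_iota; exact: size_poly.
apply/rowP => i; have := congr1 (fun p : {poly C} => p`_i) qE.
by rewrite coef_poly ltn_ord inord_val coef0 mxE.
Qed.

End HomogeneousInterpolation.

(** * Uniqueness of power series on a real interval *)

Section PowerSeries.
Variable R : realType.
Local Notation C := R[i].
Implicit Types a b d : nat -> C.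

Lemma asum_damped d (t : R) : 0 < t -> t <= 1 -> asum d -> asum (fun K => (t ^+ K)%:C * d K).
Proof.
move=> t0 t1 [M hM]; exists M => N; apply: le_trans (hM N); apply: ler_sum => n _.
rewrite normcM normcR ger0_norm ?exprn_ge0 ?(ltW t0) //.
by rewrite ler_piMl ?normc_ge0 // exprn_ile1 // ltW.
Qed.

Lemma power_series_eq0_head d : asum d ->
(forall t : R, 0 < t -> t <= 1 -> csum (fun K => (t ^+ K)%:C * d K) = 0) -> d 0%N = 0.
Proof.
move=> ad h.
apply: eq0_normc; apply/eqP; rewrite eq_le normc_ge0 andbT leNgt; apply/negP => d0.
have adS := (asumS d).2 ad; have [M hM] := adS.
have M0 : 0 <= M by have := hM 0%N; rewrite big_ord0.
(* With this [t] the terms of positive degree sum to at most t M, which is below half the modulus of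
   [d 0], and so they cannot cancel it. The [+ 1] avoids a division by 0. *)
pose t := Num.min 1 (normc (d 0%N) / (2 * (M + 1))).
have q0 : 0 < normc (d 0%N) / (2 * (M + 1)).
  by rewrite divr_gt0 // mulr_gt0 // ltr_wpDl.
have t0 : 0 < t by rewrite lt_min ltr01.
have t1 : t <= 1 by rewrite ge_min lexx.
have tq : t <= normc (d 0%N) / (2 * (M + 1)) by rewrite ge_min lexx orbT.
have := h t t0 t1; rewrite csumS; last exact: asum_damped.
rewrite expr0 mul1r => /eqP; rewrite addr_eq0 => /eqP E.
have : normc (d 0%N) <= t * M.
  rewrite E normc_opp; apply: normc_csum_le => N.
  apply: le_trans (ler_wpM2l (ltW t0) (hM N)); rewrite mulr_sumr; apply: ler_sum => k _.
  rewrite normcM normcR ger0_norm ?exprn_ge0 ?(ltW t0) // exprS ler_wpM2r ?normc_ge0 //.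
  by rewrite ler_piMr ?(ltW t0) // exprn_ile1 // ltW.
apply/negP; rewrite -ltNge; apply: le_lt_trans (ler_wpM2r M0 tq) _.
rewrite mulrAC ltr_pdivrMr ?mulr_gt0 ?ltr_wpDl // ltr_pM2l //; lra.
Qed.

Lemma power_series_eq0 n d : asum d ->
  (forall t : R, 0 < t -> t <= 1 -> csum (fun K => (t ^+ K)%:C * d K) = 0) -> d n = 0.
Proof.
elim: n d => [|n IH] d ad h; first exact: power_series_eq0_head.
have d0 := power_series_eq0_head ad h.
apply: (IH (fun K => d K.+1)); first exact: (asumS d).2.
move=> t t0 t1; have := h t t0 t1; rewrite csumS; last exact: asum_damped.
rewrite d0 mulr0 add0r.
have -> : (fun K => (t ^+ K.+1)%:C * d K.+1) = (fun K => t%:C * ((t ^+ K)%:C * d K.+1)).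
  by apply/funext => K; rewrite exprS rCM mulrA.
rewrite csumZ; last by apply: asum_damped => //; exact: (asumS d).2.
move/eqP; rewrite mulf_eq0 fmorph_eq0 gt_eqF //= => /eqP.
exact.
Qed.

Lemma power_series_unique n (d1 d2 : nat -> C) : asum d1 -> asum d2 ->
  (forall t : R, 0 < t -> t <= 1 ->
    csum (fun K => (t ^+ K)%:C * d1 K) = csum (fun K => (t ^+ K)%:C * d2 K)) -> d1 n = d2 n.
Proof.
move=> a1 a2 h; apply/eqP; rewrite -subr_eq0; apply/eqP.
have a2' := asumZ (-1) a2.
have -> : d1 n - d2 n = d1 n + -1 * d2 n by rewrite mulN1r.
apply: (@power_series_eq0 n (fun K => d1 K + -1 * d2 K)); first exact: asumD.
move=> t t0 t1.
have b1 := asum_damped t0 t1 a1; have b2 := asum_damped t0 t1 a2.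
have c2 := csumZ (-1) b2; have b2' := asumZ (-1) b2.
have E := csumD b1 b2'; rewrite c2 h // mulN1r subrr in E; rewrite -{}E.
by congr csum; apply/funext => K; ring.
Qed.

End PowerSeries.

(** * Block structure of a semigroup that moves coherent vectors along a flow *)

Section HomogeneousSemigroup.
Variables (R : realType) (r sg w : R).
Hypotheses (r0 : 0 < r) (r1 : r < 1) (sg0 : 0 < sg) (sgE : sg ^+ 2 = 1 - r ^+ 2).
Hypothesis w0 : 0 < w.
Local Notation C := R[i].
Variables (A B : C) (e : R -> C -> C) (T : R -> hs R -> hs R).
Local Notation Z := (fun z : C => A * z + B * z^*).
Hypothesis cT : contraction_semigroup T.
Hypothesis T_coh : forall t z, 0 <= t -> T t (coh r sg w z) = coh r sg w (e t z).
Hypothesis e_real : forall t (a : R) z, e t (a%:C * z) = a%:C * e t z.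
Hypothesis e_deriv : forall z, cvgc (0 : R)^'+ (fun t => (t^-1)%:C * (e t z - z)) (Z z).
Local Notation P := (hom_part r sg w).
Local Notation g := (homv r sg w).
Local Notation E := (sqb r sg).
Local Notation gc := (coh_coef r sg w).
Local Notation M K i j := (sym_entry A A^* B B^* K i j).

Lemma coh_coef_neq0 m n : (gc m n)%:C != 0 :> C.
Proof.
rewrite fmorph_eq0 /coh_coef !mulf_neq0 ?invr_neq0 ?mulf_neq0 ?sf_neq0 //.
  by rewrite expf_neq0 // mulf_neq0 ?invr_neq0 // gt_eqF.
by rewrite expf_neq0 // oppr_eq0 mulf_neq0 ?invr_neq0 ?mulf_neq0 // gt_eqF.
Qed.

Lemma functional_comp t phi : 0 <= t ->
  bounded_functional phi -> bounded_functional (fun X => phi (T t X)).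
Proof.
move=> t0 [l [M hM]]; split=> [c X Y|]; first by rewrite (csg_linear cT t0) l.
exists `|M| => X; apply: le_trans (hM _) _.
apply: (@le_trans _ _ (`|M| * hs_norm (T t X))).
  by rewrite ler_wpM2r ?hs_norm_ge0 // ler_norm.
by rewrite ler_wpM2l // (csg_contraction cT).
Qed.

Lemma T_sum t (I : Type) (s : seq I) (Q : pred I) (F : I -> hs R) : 0 <= t ->
  T t (\sum_(i <- s | Q i) F i) = \sum_(i <- s | Q i) T t (F i).
Proof.
move=> t0; have l := csg_linear cT t0.
have l0 : T t 0 = 0 by have := l (-1) 0 0; rewrite scaler0 addr0 scaleN1r addNr.
have lD X Y : T t (X + Y) = T t X + T t Y by have := l 1 X Y; rewrite !scale1r.
exact: (big_morph _ lD l0).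
Qed.

Lemma T_scale t c X : 0 <= t -> T t (c *: X) = c *: T t X.
Proof.
move=> t0; have l := csg_linear cT t0.
have l0 : T t 0 = 0 by have := l (-1) 0 0; rewrite scaler0 addr0 scaleN1r addNr.
by have := l c X 0; rewrite l0 !addr0.
Qed.

Lemma hom_part_real K (a : R) z : P K (a%:C * z) = (a ^+ K)%:C *: P K z.
Proof.
rewrite /hom_part /antidiag scaler_sumr; apply: eq_bigr => i _; rewrite scalerA.
have iK : (i <= K)%N by rewrite -ltnS.
have -> : a ^+ K = a ^+ i * a ^+ (K - i) by rewrite -exprD subnKC.
congr (_ *: _); rewrite conjM conj_real !exprMn rCM !rCX.
by ring.
Qed.

(** Tested against a basis vector and evaluated at a real multiple s z, the coherent identity is an
    equality of power series in s, because [e t] commutes with real dilations. The coefficient of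
    s^K is the claim. *)
Lemma T_hom_part t K z : 0 <= t -> T t (P K z) = P K (e t z).
Proof.
move=> t0; apply/eqP; rewrite -subr_eq0; apply/eqP.
apply: (hs_eq0 r0 r1 sg0 sgE) => p; rewrite hs_innerBr; apply/eqP; rewrite subr_eq0; apply/eqP.
have hp : bounded_functional (hs_inner (E p)) := inner_functional _.
have hpT := functional_comp t0 hp.
have [a1 _] := @coh_functional R r sg w r0 r1 sg0 sgE z _ hpT.
have [a2 _] := @coh_functional R r sg w r0 r1 sg0 sgE (e t z) _ hp.
apply: (power_series_unique K a1 a2) => s _ _.
have [_ e1] := @coh_functional R r sg w r0 r1 sg0 sgE (s%:C * z) _ hpT.
have [_ e2] := @coh_functional R r sg w r0 r1 sg0 sgE (e t (s%:C * z)) _ hp.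
have h := congr1 (hs_inner (E p)) (T_coh (s%:C * z) t0).
rewrite e1 e2 in h; transitivity (csum (fun K => hs_inner (E p) (T t (P K (s%:C * z))))).
  by congr csum; apply/funext => n; rewrite hom_part_real (T_scale _ _ t0) hs_innerZr.
rewrite h; congr csum; apply/funext => n.
by rewrite e_real hom_part_real hs_innerZr.
Qed.

(** The matrix of T_t on the block of degree K, read off by interpolation from the values of the
    flow at the nodes. *)
Definition flow_coef K t (i j : nat) : C :=
  \sum_(y < K.+1) invmx (node_mx R K) (inord i) y *
    (e t (node R y) ^+ j * (e t (node R y))^* ^+ (K - j)).

Lemma homv_node K i : (i <= K)%N ->
  g i (K - i) = \sum_(y < K.+1) invmx (node_mx R K) (inord i) y *: P K (node R y).
Proof.
move=> iK.
transitivity (\sum_(j < K.+1) ((1%:M : 'M[C]_K.+1) (inord i) j) *: g j (K - j)).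
  rewrite (bigD1 (inord i)) //= mxE eqxx scale1r inordK ?ltnS // big1 ?addr0 // => j ji.
  by rewrite mxE eq_sym (negPf ji) scale0r.
rewrite -(mulVmx (node_mx_unit R K)); under eq_bigr do rewrite mxE scaler_suml.
rewrite exchange_big; apply: eq_bigr => y _; rewrite /hom_part /antidiag scaler_sumr.
by apply: eq_bigr => j _; rewrite [node_mx R K y j]mxE [RHS]scalerA.
Qed.

Lemma T_homv K t i : 0 <= t -> (i <= K)%N ->
  T t (g i (K - i)) = \sum_(j < K.+1) flow_coef K t i j *: g j (K - j).
Proof.
move=> t0 iK; rewrite (homv_node iK) (T_sum _ _ _ t0).
transitivity (\sum_(y < K.+1) \sum_(j < K.+1) (invmx (node_mx R K) (inord i) y *
    (e t (node R y) ^+ j * (e t (node R y))^* ^+ (K - j))) *: g j (K - j)).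
  apply: eq_bigr => y _; rewrite (T_scale _ _ t0) (T_hom_part _ _ t0) /hom_part /antidiag.
  by rewrite scaler_sumr; apply: eq_bigr => j _; rewrite [LHS]scalerA.
by rewrite exchange_big; apply: eq_bigr => j _; rewrite scaler_suml.
Qed.

Lemma e_cvg z : cvgc (0 : R)^'+ (e^~ z) z.
Proof.
have h1 : cvgc (0 : R)^'+ (fun t : R => t%:C : C) 0.
  by apply: (@cvgc_real _ _ _ _ id 0); apply: cvg_at_right_filter; exact: cvg_id.
have h2 : cvgc (0 : R)^'+ (fun t => t%:C * ((t^-1)%:C * (e t z - z)) + z) z.
  rewrite -[X in cvgc _ _ X]add0r; apply: cvgcD (cvgc_cst z).
  by rewrite -[X in cvgc _ _ X](mul0r (Z z)); exact: cvgcM h1 (e_deriv z).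
have h3 : normc (t%:C * ((t^-1)%:C * (e t z - z)) + z - z) @[t --> (0 : R)^'+] --> (0 : R).
  by move/cvgcP: h2; exact.
apply/cvgcP; apply: cvg_trans h3.
apply: near_eq_cvg; near=> t.
have t0 : 0 < t by near: t; exact: nbhs_right_gt.
congr (normc (_ - _)); rewrite mulrA -rCM divff ?gt_eqF // mul1r.
by rewrite subrK.
Unshelve. all: by end_near. Qed.

Lemma cvgc_diffX (f : R -> C) (a d : C) n : cvgc (0 : R)^'+ f a ->
  cvgc (0 : R)^'+ (fun t => (t^-1)%:C * (f t - a)) d ->
  cvgc (0 : R)^'+ (fun t => (t^-1)%:C * (f t ^+ n - a ^+ n)) (n%:R * a ^+ n.-1 * d).
Proof.
move=> cf cd; elim: n => [|n IH].
  rewrite mul0r mul0r; apply: cvgc_ext (cvgc_cst _) => t.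
  by rewrite !expr0 subrr mulr0.
have h : cvgc (0 : R)^'+ (fun t => f t ^+ n * ((t^-1)%:C * (f t - a)) +
    a * ((t^-1)%:C * (f t ^+ n - a ^+ n))) (a ^+ n * d + a * (n%:R * a ^+ n.-1 * d)).
  by apply: cvgcD; apply: cvgcM => //; [exact: cvgcX | exact: cvgc_cst].
have -> : n.+1%:R * a ^+ n.+1.-1 * d = a ^+ n * d + a * (n%:R * a ^+ n.-1 * d).
  case: n {IH h} => [|n] /=; first by rewrite !expr0; ring.
  by rewrite exprS -[n.+2%:R]natr1; ring.
by apply: cvgc_ext h => t; rewrite !exprS; ring.
Qed.

Lemma monomial_deriv z j k :
  cvgc (0 : R)^'+ (fun t => (t^-1)%:C * (e t z ^+ j * (e t z)^* ^+ k - z ^+ j * z^* ^+ k))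
    (j%:R * z ^+ j.-1 * Z z * z^* ^+ k + z ^+ j * (k%:R * z^* ^+ k.-1 * (Z z)^*)).
Proof.
have cc : cvgc (0 : R)^'+ (fun t => (e t z)^*) z^* by exact: cvgc_conj (e_cvg z).
have cdc : cvgc (0 : R)^'+ (fun t => (t^-1)%:C * ((e t z)^* - z^*)) (Z z)^*.
  by apply: cvgc_ext (cvgc_conj (e_deriv z)) => t; rewrite conjM conjB conj_real.
apply: (@cvgc_ext _ _ _ (fun t =>
  ((t^-1)%:C * (e t z ^+ j - z ^+ j)) * (e t z)^* ^+ k +
  z ^+ j * ((t^-1)%:C * ((e t z)^* ^+ k - z^* ^+ k)))) => [t|]; first by ring.
apply: cvgcD.
  apply: cvgcM; last exact: (cvgcX k cc).
  exact: (cvgc_diffX j (e_cvg z) (e_deriv z)).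
by apply: cvgcM; [exact: cvgc_cst | exact: (cvgc_diffX k cc cdc)].
Qed.

(** Leibniz's rule re-expanded on the monomials of the same degree: the derivation defined by the
    drift has matrix [sym_entry]. *)
Lemma monomial_deriv_sym K j z : (j <= K)%N ->
  j%:R * z ^+ j.-1 * Z z * z^* ^+ (K - j) +
    z ^+ j * ((K - j)%:R * z^* ^+ (K - j).-1 * (Z z)^*) =
  \sum_(i < K.+1) z ^+ i * z^* ^+ (K - i) * M K i j.
Proof.
move=> jK.
pose h i := z ^+ i * z^* ^+ (K - i).
transitivity (h j * (j%:R * A + (K - j)%:R * A^*) +
  (if j is j'.+1 then h j' * (j%:R * B) else 0) + h j.+1 * ((K - j)%:R * B^*)); last first.
  rewrite /sym_entry; under eq_bigr do rewrite mulrDr [X in X + _]mulrDr.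
  rewrite !big_split /=; congr (_ + _ + _).
  - rewrite (bigD1 (inord j)) //= inordK ?ltnS // eqxx mul1r big1 ?addr0 // => i ij.
    rewrite (_ : (_ == _) = false) ?mul0r ?mulr0 //; apply/negbTE; apply: contraNneq ij => <-.
    by rewrite inord_val.
  - case: j jK => [|j] jK.
      by rewrite big1 // => i _; rewrite mul0r mulr0.
    rewrite (bigD1 (inord j)) //= inordK ?eqxx ?mul1r; last exact: ltnW.
    rewrite big1 ?addr0 // => i ij.
    rewrite (_ : (_ == _) = false) ?mul0r ?mulr0 //; apply/negbTE; apply: contraNneq ij => -[->].
    by rewrite inord_val.
  have [jK'|] := ltnP j K; last first.
    rewrite -subn_eq0 => /eqP ->.
    by rewrite mul0r mulr0 big1 // => i _; rewrite !mulr0.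
  rewrite (bigD1 (inord j.+1)) //= inordK ?eqxx ?mul1r ?ltnS //.
  rewrite big1 ?addr0 // => i ij.
  rewrite (_ : (_ == _) = false) ?mul0r ?mulr0 //; apply/negbTE; apply: contraNneq ij => <-.
  by rewrite inord_val.
rewrite /h conjD !conjM conjCK subnS.
have -> : (z ^+ j * ((K - j)%:R * z^* ^+ (K - j).-1 * (A^* * z^* + B^* * z))) =
   (z ^+ j * z^* ^+ (K - j) * ((K - j)%:R * A^*)) + z ^+ j.+1 * z^* ^+ (K - j).-1 * ((K - j)%:R * B^*).
  case: (K - j)%N => [|n] /=; first by rewrite !mul0r !mulr0 addr0.
  by rewrite !exprS; ring.
case: j jK => [|j] jK; first by rewrite !expr0; ring.
rewrite -[(K - j)%N](_ : (K - j.+1).+1 = _)%N ?exprS; last by rewrite subnSK.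
by rewrite /= ?exprS; ring.
Qed.

(** Interpolation is linear, so the derivative may be taken node by node; the inverse of [node_mx]
    then extracts the coefficient of the resulting form. *)
Lemma flow_coef_deriv K i j : (i <= K)%N -> (j <= K)%N ->
  cvgc (0 : R)^'+ (fun t => (t^-1)%:C * (flow_coef K t i j - (i == j)%:R)) (M K i j).
Proof.
move=> iK jK.
have E (c : nat -> C) : \sum_(y < K.+1) invmx (node_mx R K) (inord i) y *
    (\sum_(l < K.+1) node R y ^+ l * (node R y)^* ^+ (K - l) * c l) = c i.
  transitivity (\sum_(l < K.+1) (1%:M : 'M[C]_K.+1) (inord i) l * c l).
    rewrite -(mulVmx (node_mx_unit R K)); under [RHS]eq_bigr do rewrite mxE mulr_suml.
    rewrite exchange_big; apply: eq_bigr => y _; rewrite mulr_sumr.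
    by apply: eq_bigr => l _; rewrite !mxE mulrA.
  rewrite (bigD1 (inord i)) //= mxE eqxx mul1r inordK ?ltnS // big1 ?addr0 // => l li.
  by rewrite mxE eq_sym (negPf li) mul0r.
have E1 : (i == j)%:R = \sum_(y < K.+1) invmx (node_mx R K) (inord i) y *
    (node R y ^+ j * (node R y)^* ^+ (K - j)).
  rewrite -[LHS](E (fun l => (l == j)%:R)); apply: eq_bigr => y _; congr (_ * _).
  rewrite (bigD1 (inord j)) //= inordK ?ltnS // eqxx mulr1 big1 ?addr0 // => l lj.
  rewrite (_ : (_ == _) = false) ?mulr0 //; apply/negbTE; apply: contraNneq lj => <-.
  by rewrite inord_val.
have h y := monomial_deriv (node R y) j (K - j).
have S : cvgc (0 : R)^'+ (fun t => \sum_(y < K.+1) invmx (node_mx R K) (inord i) y *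
   ((t^-1)%:C * (e t (node R y) ^+ j * (e t (node R y))^* ^+ (K - j) -
    node R y ^+ j * (node R y)^* ^+ (K - j)))) (M K i j).
  rewrite -[M K i j](E (fun l => M K l j)); apply: cvgc_sum => y; apply: cvgcM (cvgc_cst _) _.
  by rewrite -monomial_deriv_sym.
apply: cvgc_ext S => t; rewrite E1 /flow_coef -sumrB mulr_sumr.
by apply: eq_bigr => y _; ring.
Qed.

Lemma cvgc_near (f h : R -> C) a :
  (forall t, 0 < t -> f t = h t) -> cvgc (0 : R)^'+ f a -> cvgc (0 : R)^'+ h a.
Proof.
move=> fh /cvgcP cf; apply/cvgcP; apply: cvg_trans cf; apply: near_eq_cvg; near=> t.
by rewrite fh //; near: t; exact: nbhs_right_gt.
Unshelve. all: by end_near. Qed.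

Lemma cvg0_near_le (f h : R -> R) : (forall t, 0 < t -> 0 <= f t <= h t) ->
  h t @[t --> (0 : R)^'+] --> (0 : R) -> f t @[t --> (0 : R)^'+] --> (0 : R).
Proof.
move=> fh ch; apply: (@squeeze_cvgr _ _ _ _ (fun=> 0) h) => //; last exact: cvg_cst.
by near=> t; apply: fh; near: t; exact: nbhs_right_gt.
Unshelve. all: by end_near. Qed.

Definition hom_comb K (x : nat -> C) : hs R := \sum_(i < K.+1) x i *: g i (K - i).

(** Coordinates along the rescaled vectors [homv]: in these the generator acts by [sym_mx] itself,
    with no conjugation by the weights [coh_coef]. *)
Definition hcoord K (j : nat) (X : hs R) : C := hs_inner (E (j, K - j)%N) X / (gc j (K - j))%:C.

Lemma hcoord_functional K j : bounded_functional (hcoord K j).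
Proof.
have [l [N hN]] := inner_functional (E (j, K - j)%N).
split=> [c X Y|]; first by rewrite /hcoord l mulrDl mulrA.
exists (normc (gc j (K - j))%:C^-1 * N) => X.
by rewrite /hcoord normcM mulrC -mulrA ler_wpM2l ?normc_ge0.
Qed.

Lemma hcoord_homv K j m n : (j <= K)%N ->
  hcoord K j (g m n) = ((m + n)%N == K)%:R * (m == j)%:R.
Proof.
move=> jK; rewrite /hcoord /homv hs_innerZr (sqb_orthonormal r0 r1 sg0 sgE) xpair_eqE.
have [->|ne] := eqVneq m j; last first.
  by rewrite mulr0 mul0r mulr0.
rewrite andTb mulr1 (_ : (K - j == n)%N = (j + n == K)%N); last by apply/eqP/eqP; lia.
have [e'|] := eqVneq (j + n)%N K; last by rewrite mulr0 mul0r.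
by rewrite mulr1 (_ : (K - j)%N = n) ?divff ?coh_coef_neq0 //; lia.
Qed.

Lemma hcoord_comb K j x : (j <= K)%N -> hcoord K j (hom_comb K x) = x j.
Proof.
move=> jK; rewrite /hom_comb (functional_sum _ _ _ (hcoord_functional K j)).
rewrite (bigD1 (inord j)) //= (functionalZ _ _ (hcoord_functional K j)) hcoord_homv //.
rewrite inordK ?ltnS // subnKC // !eqxx !mulr1 big1 ?addr0 // => i ij.
rewrite (functionalZ _ _ (hcoord_functional K j)) hcoord_homv //.
rewrite [(i == j :> nat)](_ : _ = false) ?mulr0 //; apply/negbTE; apply: contraNneq ij => <-.
by rewrite inord_val.
Qed.

Lemma hcoord_eq0 K j X : (hcoord K j X == 0) = (hs_inner (E (j, K - j)%N) X == 0).
Proof. by rewrite /hcoord mulf_eq0 invr_eq0 (negPf (coh_coef_neq0 _ _)) orbF. Qed.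

Lemma homv_functional_eq0 phi : bounded_functional phi ->
  (forall K i, (i <= K)%N -> phi (g i (K - i)) = 0) -> forall X, phi X = 0.
Proof.
move=> hp h; apply: (functional_eq0 r0 r1 sg0 sgE hp) => -[m n].
have := h (m + n)%N m (leq_addr _ _); rewrite addKn /homv (functionalZ _ _ hp) => /eqP.
by rewrite mulf_eq0 (negPf (coh_coef_neq0 _ _)) => /eqP.
Qed.

(** Both sides are bounded functionals of [X] that agree on every [homv], and these span a dense
    subspace. The block form thus reaches arbitrary [X], not only finite combinations. *)
Lemma hcoord_T K t j X : 0 <= t -> (j <= K)%N ->
  hcoord K j (T t X) = \sum_(i < K.+1) flow_coef K t i j * hcoord K i X.
Proof.
move=> t0 jK; apply/eqP; rewrite -subr_eq0; apply/eqP; move: X.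
have hT := functional_comp t0 (hcoord_functional K j).
have hS : bounded_functional (fun X => \sum_(i < K.+1) flow_coef K t i j * hcoord K i X).
  split=> [c X Y|].
    rewrite mulr_sumr -big_split; apply: eq_bigr => i _ /=.
    by rewrite (hcoord_functional K i).1 mulrDr mulrCA.
  have hM i : exists N, forall X, normc (hcoord K i X) <= N * hs_norm X.
    exact: (hcoord_functional K i).2.
  have [N hN] := choice hM.
  exists (\sum_(i < K.+1) normc (flow_coef K t i j) * N i) => X.
  apply: le_trans (normc_sum _ _ _) _; rewrite mulr_suml; apply: ler_sum => i _.
  by rewrite normcM -mulrA ler_wpM2l ?normc_ge0.
apply: homv_functional_eq0.
  split=> [c X Y|].
    by rewrite hT.1 hS.1 mulrBr opprD addrACA.
  have [N1 h1] := hT.2; have [N2 h2] := hS.2; exists (N1 + N2) => X.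
  by rewrite mulrDl; apply: le_trans (normcD _ _) _; rewrite normc_opp lerD.
move=> L i iL; rewrite (T_homv t0 iL) -/(hom_comb _ _).
apply/eqP; rewrite subr_eq0; apply/eqP.
have [KE|KL] := eqVneq K L.
  rewrite -{L}KE in iL *.
  rewrite [LHS](hcoord_comb (fun j => flow_coef K t i j)) // (bigD1 (inord i)) //= inordK ?ltnS //.
  rewrite hcoord_homv // subnKC // !eqxx !mulr1 big1 ?addr0 // => l li.
  rewrite hcoord_homv ?subnKC //; last by rewrite -ltnS.
  rewrite [(i == l :> nat)](_ : _ = false) ?mulr0 //; apply/negbTE; apply: contraNneq li => ->.
  by rewrite inord_val.
rewrite (functional_sum _ _ _ (hcoord_functional K j)) !big1 // => l _.
  have lK : (l <= K)%N by rewrite -ltnS.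
  by rewrite (hcoord_homv _ _ lK) (subnKC iL) eq_sym (negPf KL) mul0r mulr0.
have lL : (l <= L)%N by rewrite -ltnS.
rewrite (functionalZ _ _ (hcoord_functional K j)) (hcoord_homv _ _ jK) (subnKC lL).
by rewrite eq_sym (negPf KL) mul0r mulr0.
Qed.

Lemma generator_hom_comb K (x : nat -> C) :
  generator T (hom_comb K x) (hom_comb K (fun j => \sum_(i < K.+1) x i * M K i j)).
Proof.
pose a (t : R) (j : nat) := \sum_(i < K.+1) x i * ((t^-1)%:C * (flow_coef K t i j - (i == j :> nat)%:R) - M K i j).
have ca j : (j <= K)%N -> cvgc (0 : R)^'+ (a^~ j) 0.
  move=> jK.
  rewrite -[X in cvgc _ _ X](_ : \sum_(i < K.+1) x i * (M K i j - M K i j) = 0); last first.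
    by rewrite big1 // => i _; rewrite subrr mulr0.
  apply: cvgc_sum => i; apply: cvgcM; first exact: cvgc_cst.
  apply: cvgcB; last exact: cvgc_cst.
  by apply: flow_coef_deriv => //; rewrite -ltnS.
have c0 : \sum_(j < K.+1) normc (a t j) * hs_norm (g j (K - j)) @[t --> (0 : R)^'+] --> (0 : R).
  rewrite -[X in _ --> X](_ : \sum_(j < K.+1) normc (0 : C) * hs_norm (g j (K - j)) = 0); last first.
    by rewrite big1 // => i _; rewrite normc0 mul0r.
  apply: cvg_bigsum => j; apply: cvgMl; apply: cvgc_normc; apply: ca.
  by rewrite -ltnS.
rewrite /generator; apply: cvg0_near_le c0 => t t0; rewrite hs_norm_ge0 andTb.
have -> : (t^-1)%:C *: (T t (hom_comb K x) - hom_comb K x) -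
    hom_comb K (fun j => \sum_(i < K.+1) x i * M K i j) =
    \sum_(j < K.+1) a t j *: g j (K - j).
  have -> : T t (hom_comb K x) = hom_comb K (fun j => \sum_(i < K.+1) x i * flow_coef K t i j).
    rewrite /hom_comb (T_sum _ _ _ (ltW t0)).
    under [RHS]eq_bigr do rewrite scaler_suml.
    rewrite exchange_big; apply: eq_bigr => i _.
    have iK : (i <= K)%N by rewrite -ltnS.
    rewrite (T_scale _ _ (ltW t0)) (T_homv (ltW t0) iK) scaler_sumr.
    by apply: eq_bigr => j _; rewrite [LHS]scalerA.
  rewrite /hom_comb -sumrB scaler_sumr -sumrB; apply: eq_bigr => j _.
  rewrite -scalerBl [X in X - _]scalerA -scalerBl; congr (_ *: _).
  have -> : x j = \sum_(i < K.+1) x i * (i == j :> nat)%:R.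
    rewrite (bigD1 j) //= eqxx mulr1 big1 ?addr0 // => i ij.
    by rewrite [(i == j :> nat)](_ : _ = false) ?mulr0 //; apply/negbTE.
  by rewrite -sumrB mulr_sumr -sumrB; apply: eq_bigr => i _; ring.
apply: le_trans (hs_norm_sum _ _ _) _; apply: ler_sum => j _.
by rewrite hs_normZ.
Qed.

(** Norm convergence of the difference quotient implies convergence of its coordinates, and
    [hcoord_T] involves only finitely many of them. So the generator acts block by block on its
    whole domain. *)
Lemma hcoord_generator K j X Y : (j <= K)%N -> generator T X Y ->
  hcoord K j Y = \sum_(i < K.+1) hcoord K i X * M K i j.
Proof.
move=> jK gXY.
pose f t := (t^-1)%:C *: (T t X - X).
have gf : hs_norm (f t - Y) @[t --> (0 : R)^'+] --> (0 : R) by exact: gXY.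
have h1 : cvgc (0 : R)^'+ (fun t => hcoord K j (f t)) (hcoord K j Y).
  by apply: cvgcM (cvgc_cst _); exact: hs_inner_cvg gf.
have h2 : cvgc (0 : R)^'+ (fun t => \sum_(i < K.+1) hcoord K i X *
    ((t^-1)%:C * (flow_coef K t i j - (i == j :> nat)%:R))) (\sum_(i < K.+1) hcoord K i X * M K i j).
  apply: cvgc_sum => i; apply: cvgcM; first exact: cvgc_cst.
  by apply: flow_coef_deriv => //; rewrite -ltnS.
apply: (cvgc_unique h1); apply: cvgc_near h2 => t t0.
rewrite /f (functionalZ _ _ (hcoord_functional K j)) (functionalB _ _ (hcoord_functional K j)).
rewrite hcoord_T ?(ltW t0) //.
have -> : hcoord K j X = \sum_(i < K.+1) hcoord K i X * (i == j :> nat)%:R.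
  rewrite (bigD1 (inord j)) //= inordK ?ltnS // eqxx mulr1 big1 ?addr0 // => i ij.
  rewrite [(i == j :> nat)](_ : _ = false) ?mulr0 //; apply/negbTE; apply: contraNneq ij => <-.
  by rewrite inord_val.
by rewrite -sumrB mulr_sumr; apply: eq_bigr => i _; ring.
Qed.

(** * Point spectra and eigenspaces of the generator and its adjoint *)

Section Spectrum.
Variables lam mu : C.
Hypothesis sum_lm : lam + mu = A + A^*.
Hypothesis prod_lm : lam * mu = A * A^* - B * B^*.
Local Notation L := (generator T).
Local Notation S K := (sym_mx A A^* B B^* K).

Let conj_eq0_imp : B^* = 0 -> B = 0.
Proof. by move=> h; rewrite -[B]conjCK h conj0. Qed.

(** The coordinates of [X] in the block containing [p] form a row eigenvector of [sym_mx], nonzero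
    because the component at [p] is. *)
Lemma generator_block X a p : L X (a *: X) -> hs_inner (E p) X != 0 ->
  exists2 d, (d <= p.1 + p.2)%N & a = d%:R * lam + (p.1 + p.2 - d)%:R * mu.
Proof.
move: p => [m n] LX nX; set K := (m + n)%N; have mK : (m <= K)%N by exact: leq_addr.
apply/(@sym_mx_eigen_row C A A^* B B^* lam mu K sum_lm prod_lm conj_eq0_imp).
exists (\row_i hcoord K i X).
  apply/eqP => /rowP /(_ (inord m)); rewrite !mxE inordK ?ltnS // => /eqP.
  by rewrite hcoord_eq0 addKn (negPf nX).
apply/rowP => j; have jK : (j <= K)%N by rewrite -ltnS.
rewrite !mxE; under eq_bigr do rewrite !mxE.
by rewrite -(hcoord_generator jK LX) (functionalZ _ _ (hcoord_functional K j)).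
Qed.

Lemma hs_inner_homvr X m n : hs_inner X (g m n) = (gc m n)%:C * hs_inner X (E (m, n)).
Proof. exact: hs_innerZr. Qed.

(** The adjoint relation is tested on the vectors [g i (K - i)] of the domain. Their inner products
    with [X] form a column eigenvector, for the conjugate of [b] since [hs_inner] is
    conjugate-linear on the left. *)
Lemma adjoint_block X b p : adjoint L X (b *: X) -> hs_inner (E p) X != 0 ->
  exists2 d, (d <= p.1 + p.2)%N & b = d%:R * lam^* + (p.1 + p.2 - d)%:R * mu^*.
Proof.
move: p => [m n] LX nX; set K := (m + n)%N; have mK : (m <= K)%N by exact: leq_addr.
suff [d dK e1] : exists2 d, (d <= K)%N & b^* = d%:R * lam + (K - d)%:R * mu.
  by exists d; rewrite // -[b]conjCK e1 conjD !conjM !rmorph_nat.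
apply/(@sym_mx_eigen_col C A A^* B B^* lam mu K sum_lm prod_lm conj_eq0_imp).
exists (\col_i hs_inner X (g i (K - i))).
  apply/eqP => /colP /(_ (inord m)); rewrite !mxE inordK ?ltnS // addKn hs_inner_homvr.
  by apply/eqP; rewrite mulf_neq0 ?coh_coef_neq0 // -hs_inner_conj conjC_eq0.
apply/colP => i; have iK : (i <= K)%N by rewrite -ltnS.
rewrite !mxE; under eq_bigr do rewrite !mxE.
have := LX _ _ (generator_hom_comb K (fun l => (l == i :> nat)%:R)).
have -> : hom_comb K (fun l => (l == i :> nat)%:R) = g i (K - i).
  rewrite /hom_comb (bigD1 i) //= eqxx scale1r big1 ?addr0 // => l li.
  by rewrite [(l == i :> nat)](_ : _ = false) ?scale0r //; apply/negbTE.
rewrite hs_innerZl => <-; rewrite /hom_comb hs_inner_sumr; apply: eq_bigr => j _.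
rewrite [RHS]hs_innerZr; congr (_ * _).
rewrite (bigD1 i) //= eqxx mul1r big1 ?addr0 // => l li.
by rewrite [(l == i :> nat)](_ : _ = false) ?mul0r //; apply/negbTE.
Qed.

Lemma generator_point_spectrum :
  point_spectrum L = [set a | exists K d, (d <= K)%N /\ a = d%:R * lam + (K - d)%:R * mu].
Proof.
apply/seteqP; split=> a /=.
  move=> [X nX LX]; apply: contrapT => h; case/eqP: nX; apply: (hs_eq0 r0 r1 sg0 sgE) => p.
  apply/eqP/negPn/negP => nX; apply: h.
  by have [d dK ->] := generator_block LX nX; exists (p.1 + p.2)%N, d.
move=> [K [d [dK ->]]].
have /(@sym_mx_eigen_row C A A^* B B^* lam mu K sum_lm prod_lm conj_eq0_imp) [x nx ex] :
  exists2 d', (d' <= K)%N & d%:R * lam + (K - d)%:R * mu = d'%:R * lam + (K - d')%:R * mu.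
  by exists d.
exists (hom_comb K (fun i => x 0 (inord i))).
  apply: contra_neq nx => h; apply/rowP => j; have jK : (j <= K)%N by rewrite -ltnS.
  have := hcoord_comb (fun i => x 0 (inord i)) jK.
  by rewrite h (functional0 (hcoord_functional K j)) inord_val mxE.
have := generator_hom_comb K (fun i => x 0 (inord i)); rewrite /eigenspace_of /=.
suff -> : hom_comb K (fun j => \sum_(i < K.+1) x 0 (inord i) * M K i j) =
  (d%:R * lam + (K - d)%:R * mu) *: hom_comb K (fun i => x 0 (inord i)) by [].
rewrite /hom_comb scaler_sumr; apply: eq_bigr => j _; rewrite [RHS]scalerA; congr (_ *: _).
have := congr1 (fun m : 'rV[C]_K.+1 => m 0 j) ex; rewrite !mxE inord_val => <-.
by apply: eq_bigr => i _; rewrite inord_val !mxE.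
Qed.

Lemma adjoint_point_spectrum : point_spectrum (adjoint L) =
  [set a | exists K d, (d <= K)%N /\ a = d%:R * lam^* + (K - d)%:R * mu^*].
Proof.
apply/seteqP; split=> a /=.
  move=> [X nX LX]; apply: contrapT => h; case/eqP: nX; apply: (hs_eq0 r0 r1 sg0 sgE) => p.
  apply/eqP/negPn/negP => nX; apply: h.
  by have [d dK ->] := adjoint_block LX nX; exists (p.1 + p.2)%N, d.
move=> [K [d [dK ->]]]; set b := _ + _.
have /(@sym_mx_eigen_col C A A^* B B^* lam mu K sum_lm prod_lm conj_eq0_imp) [c nc ec] :
  exists2 d', (d' <= K)%N & b^* = d'%:R * lam + (K - d')%:R * mu.
  by exists d; rewrite // /b conjD !conjM !conjCK !rmorph_nat.
(* [X] represents the functional with coefficients [c] in the coordinates [hcoord], as stated by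
   [XE]; the conjugation compensates for the left argument of [hs_inner]. *)
pose X := \sum_(j < K.+1) (c j 0 / (gc j (K - j))%:C)^* *: E (nat_of_ord j, (K - j)%N).
have XE V : hs_inner X V = \sum_(j < K.+1) c j 0 * hcoord K j V.
  rewrite /X hs_inner_suml; apply: eq_bigr => j _.
  by rewrite hs_innerZl conjCK /hcoord mulrAC mulrA.
exists X.
  apply: contra_neq nc => h; apply/colP => j; rewrite mxE.
  have jK : (j <= K)%N by rewrite -ltnS.
  have := XE (hom_comb K (fun l => (l == j :> nat)%:R)).
  rewrite h hs_inner0l (bigD1 j) //= hcoord_comb // eqxx mulr1 big1 ?addr0 // => l lj.
  rewrite hcoord_comb; last by rewrite -ltnS.
  by rewrite [(l == j :> nat)](_ : _ = false) ?mulr0 //; apply/negbTE.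
move=> V W LVW; rewrite hs_innerZl !XE.
under eq_bigr => j _.
  have jK : (j <= K)%N by rewrite -ltnS.
  rewrite (hcoord_generator jK LVW) mulr_sumr.
over.
rewrite exchange_big mulr_sumr; apply: eq_bigr => i _ /=.
have := congr1 (fun m : 'cV[C]_K.+1 => m i 0) ec; rewrite !mxE mulrA => <-.
by rewrite mulr_suml; apply: eq_bigr => j _; rewrite !mxE; ring.
Qed.

(** An index outside the square grid of side [N] has degree at least [N], so the expansion over the
    grid is already exact. *)
Lemma finite_dimensional_block (D : set (hs R)) N :
  (forall X p, D X -> (N <= p.1 + p.2)%N -> hs_inner (E p) X = 0) -> finite_dimensional D.
Proof.
move=> h; exists (size (grid N N)), (fun i => E (nth (0, 0)%N (grid N N) i)) => X DX.
exists (fun i => hs_inner (E (nth (0, 0)%N (grid N N) i)) X).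
rewrite -(big_mkord xpredT (fun i => hs_inner (E (nth (0, 0)%N (grid N N) i)) X *:
  E (nth (0, 0)%N (grid N N) i))).
rewrite -(big_nth (0, 0)%N xpredT (fun p => hs_inner (E p) X *: E p)).
apply/eqP; rewrite -subr_eq0; apply/eqP; apply: (hs_eq0 r0 r1 sg0 sgE) => q.
rewrite hs_innerBr hs_inner_sumr.
under eq_bigr do rewrite hs_innerZr (sqb_orthonormal r0 r1 sg0 sgE).
have [qg|qg] := boolP (q \in grid N N).
  rewrite (bigD1_seq q) ?grid_uniq //= eqxx mulr1 big1 ?addr0 ?subrr // => p.
  by rewrite eq_sym => /negPf ->; rewrite mulr0.
rewrite big1_seq ?subr0 => [|p /andP[_ pg]].
  apply: h DX _; rewrite leqNgt; apply: contra qg => qN; apply/allpairsP.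
  by exists q; rewrite !mem_iota !add0n /=; split; [lia | lia | case: (q)].
by rewrite [q == p](_ : _ = false) ?mulr0 //; apply: contraNF qg => /eqP ->.
Qed.

Hypotheses (lam_lt0 : Re lam < 0) (mu_lt0 : Re mu < 0).

(** Both real parts are at most -c for some c > 0, so an eigenvalue from the block of degree K has
    real part at most -c K. *)
Lemma block_degree_bound a : exists N, forall K d, (d <= K)%N ->
  Re a = d%:R * Re lam + (K - d)%:R * Re mu -> (K < N)%N.
Proof.
pose c := Num.min (- Re lam) (- Re mu).
have c0 : 0 < c by rewrite lt_min !oppr_gt0 lam_lt0.
have h1 : c <= - Re lam by rewrite ge_min lexx.
have h2 : c <= - Re mu by rewrite ge_min lexx orbT.
exists (Num.bound `|- Re a / c|).+1 => K d dK e1; rewrite ltnS -(ler_nat R).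
apply: (@le_trans _ _ (- Re a / c)); last first.
  by apply: le_trans (ler_norm _) _; exact/ltW/archi_boundP.
rewrite ler_pdivlMr // e1 -[K in K%:R](subnKC dK) natrD mulrDl.
have d0 := ler0n R d; have e0 := ler0n R (K - d).
have := ler_wpM2l d0 h1; have := ler_wpM2l e0 h2; lra.
Qed.

Lemma generator_eigenspace_finite a : finite_dimensional (eigenspace_of L a).
Proof.
have [N hN] := block_degree_bound a; apply: (@finite_dimensional_block _ N) => X p LX Np.
apply/eqP/negPn/negP => nX; have [d dK ea] := generator_block LX nX.
suff : (p.1 + p.2 < N)%N by rewrite ltnNge Np.
by apply: hN dK _; rewrite ea ReD !ReM_nat.
Qed.

Lemma adjoint_eigenspace_finite a : finite_dimensional (eigenspace_of (adjoint L) a).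
Proof.
have [N hN] := block_degree_bound a; apply: (@finite_dimensional_block _ N) => X p LX Np.
apply/eqP/negPn/negP => nX; have [d dK ea] := adjoint_block LX nX.
suff : (p.1 + p.2 < N)%N by rewrite ltnNge Np.
by apply: hN dK _; rewrite ea ReD !ReM_nat !Re_conjc.
Qed.

End Spectrum.

End HomogeneousSemigroup.

(** * Characteristic polynomials of two-by-two matrices *)

Section TwoByTwo.
Variable F : fieldType.
Implicit Types (M : 'M[F]_2) (a b : F).

Lemma det_mx2 M : \det M = M 0 0 * M 1 1 - M 0 1 * M 1 0.
Proof.
have e1 : lift ord0 (ord0 : 'I_1) = 1 :> 'I_2 by exact/val_inj.
have e0 : lift 1 (0 : 'I_1) = 0 :> 'I_2 by exact/val_inj.
rewrite (expand_det_row _ 0) !big_ord_recl big_ord0 addr0 /cofactor !det_mx11 !mxE e1 e0.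
by rewrite /= expr0 expr1; ring.
Qed.

Lemma char_poly2_roots M a b : char_poly M = ('X - a%:P) * ('X - b%:P) ->
  a + b = M 0 0 + M 1 1 /\ a * b = M 0 0 * M 1 1 - M 0 1 * M 1 0.
Proof.
move=> h; have E : ('X - a%:P) * ('X - b%:P) = 'X^2 - (a + b)%:P * 'X + (a * b)%:P.
  by rewrite !polyCD !polyCM; ring.
split.
  have := char_poly_trace M isT; rewrite h E /mxtrace !big_ord_recl big_ord0 addr0.
  have e1 : lift ord0 (ord0 : 'I_1) = 1 :> 'I_2 by exact/val_inj.
  rewrite e1 coefD coefB coefXn coefCM coefX coefC /= mulr1 sub0r addr0 => /oppr_inj.
  exact.
have := char_poly_det M; rewrite h E coefD coefB coefXn coefCM coefX coefC /= mulr0 subr0 add0r.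
by rewrite det_mx2 sqrrN expr1n mul1r.
Qed.

Lemma diagonalizable_of_distinct M a b : char_poly M = ('X - a%:P) * ('X - b%:P) ->
  a != b -> diagonalizable M.
Proof.
move=> h ab; apply/diagonalizableP; exists [:: a; b]; first by rewrite /= inE ab.
by rewrite !big_cons big_nil mulr1 -h mxminpoly_dvd_char.
Qed.

End TwoByTwo.

(** * Weyl operators between powers of the Gibbs state *)

Section GibbsEmbedding.
Variables (R : realType) (beta s : R).
Hypotheses (beta0 : 0 < beta) (s01 : 0 <= s <= 1).
Local Notation C := R[i].
Local Notation r := (expR (- (beta / 2))).
Local Notation sg := (Num.sqrt (1 - r ^+ 2)).
Local Notation w := (expR (- (beta * s / 2))).
Local Notation embed A := (bop_comp (gibbs_pow beta (s / 2))
                   (bop_comp A (gibbs_pow beta ((1 - s) / 2)))).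
Local Notation cfac := ((1 + r ^+ 2) / sg ^+ 2).

Lemma boltz_lt1 : r < 1.
Proof. by rewrite -expR0 ltr_expR oppr_lt0 divr_gt0. Qed.

Lemma boltz_sqr : r ^+ 2 = expR (- beta).
Proof. by rewrite -expRM_natl -mulr_natl; congr expR; field. Qed.

Lemma boltz_sqr_lt1 : r ^+ 2 < 1.
Proof. by rewrite boltz_sqr -expR0 ltr_expR oppr_lt0. Qed.

Lemma sqrt_gap_gt0 : 0 < sg.
Proof. by rewrite sqrtr_gt0 subr_gt0 boltz_sqr_lt1. Qed.

Lemma sqrt_gapE : sg ^+ 2 = 1 - r ^+ 2.
Proof. by rewrite sqr_sqrtr // subr_ge0 ltW // boltz_sqr_lt1. Qed.

Lemma gibbs_weight_pow p n :
  gibbs_weight beta n `^ p = (1 - r ^+ 2) `^ p * expR (- (beta * n%:R * p)).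
Proof.
rewrite /gibbs_weight -boltz_sqr powRM ?expR_ge0 //; last by rewrite subr_ge0 ltW // boltz_sqr_lt1.
by rewrite -expRM mulNr.
Qed.

Lemma gibbs_powE p (x : fock R) n : 0 <= p ->
  gibbs_pow beta p x n = (gibbs_weight beta n `^ p)%:C * x n.
Proof.
move=> p0; apply: (@number_calcE _ _ ((1 - r ^+ 2) `^ p)) => k.
rewrite ger0_norm ?powR_ge0 // gibbs_weight_pow ler_piMr ?powR_ge0 // -expR0 ler_expR oppr_le0.
by rewrite !mulr_ge0 // ltW.
Qed.

(** The Boltzmann factors are w^j and (r / w)^k. The normalization 1 - r^2 occurs with exponents
    adding up to 1/2, which gives [sg]. *)
Lemma embed_weight j k :
  gibbs_weight beta j `^ (s / 2) * gibbs_weight beta k `^ ((1 - s) / 2) =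
  sg * r ^+ k * (w ^+ j / w ^+ k).
Proof.
have g0 : 0 < 1 - r ^+ 2 by rewrite subr_gt0 boltz_sqr_lt1.
rewrite !gibbs_weight_pow.
have -> : sg = (1 - r ^+ 2) `^ (s / 2) * (1 - r ^+ 2) `^ ((1 - s) / 2).
  rewrite -powRD; last by rewrite (gt_eqF g0) implybT.
  by rewrite -powR12_sqrt ?(ltW g0) //; congr (_ `^ _); field.
rewrite -!expRM_natl -expRN mulrACA -!mulrA; congr (_ * (_ * _)).
by rewrite -!expRD; congr expR; field.
Qed.

Lemma embed_ent (A : bop R) j k : embed A (Defs.basis R k) j =
  (sg * r ^+ k * (w ^+ j / w ^+ k))%:C * A (Defs.basis R k) j.
Proof.
have [s0 s1] := andP s01.
have p1 : 0 <= s / 2 by rewrite divr_ge0.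
have p2 : 0 <= (1 - s) / 2 by rewrite divr_ge0 // subr_ge0.
rewrite -embed_weight rCM [LHS](gibbs_powE _ _ p1) -mulrA; congr (_ * _) => /=.
have -> : gibbs_pow beta ((1 - s) / 2) (Defs.basis R k) =
    (gibbs_weight beta k `^ ((1 - s) / 2))%:C *: Defs.basis R k.
  apply: val_inj; apply/funext => n; rewrite [LHS](gibbs_powE _ _ p2).
  transitivity ((gibbs_weight beta k `^ ((1 - s) / 2))%:C * Defs.basis R k n); last by [].
  rewrite basisE; case: (eqVneq n k) => [-> //|_].
  by rewrite [LHS]mulr0 [RHS]mulr0.
by rewrite bopZ.
Qed.

(** Writes a coherent vector as the embedding of a bounded operator, the form in which
    [induced_semigroup] prescribes the evolution. *)
Lemma coh_embed z : coh r sg w z =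
  embed ((expR (cfac / 2 * normc z ^+ 2))%:C *: weyl z) :> bop R.
Proof.
apply: bop_ext => k j; rewrite embed_ent.
transitivity ((sg * r ^+ k * (w ^+ j / w ^+ k))%:C *
  ((expR (cfac / 2 * normc z ^+ 2))%:C * weyl z (Defs.basis R k) j)); last by [].
rewrite weylE.
have := ent_coh w (expR_gt0 _) boltz_lt1 sqrt_gap_gt0 sqrt_gapE z j k.
rewrite /ent => ->; rewrite (coh_arrE (expR_gt0 _) boltz_lt1 sqrt_gap_gt0 sqrt_gapE (expR_gt0 _)).
by ring.
Qed.

(** [cfac] is coth (beta / 2), written in terms of r = e^(-beta/2). *)
Lemma coth_tanh : cfac * tanh (beta / 2) = 1.
Proof.
rewrite /tanh sqrt_gapE.
have r0 := expR_gt0 (- (beta / 2)); have h := boltz_sqr_lt1.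
have -> : expR (beta / 2) = r^-1 by rewrite -expRN opprK.
field; rewrite ?gt_eqF //; nra.
Qed.

End GibbsEmbedding.

(** * Consequences of the standardized parameters *)

Section GaussianParameters.
Variables (R : realType) (Omega beta : R) (kappa : R[i]) (u v : 'I_2 -> R[i]).
Local Notation C := R[i].
Local Notation U := (\sum_l normc (u l) ^+ 2).
Local Notation V := (\sum_l normc (v l) ^+ 2).
Local Notation Q := (\sum_l u l * v l).
Local Notation A := (- gamma u v +i* Omega).
Local Notation B := ((0 +i* 1) * kappa).
Local Notation r := (expR (- (beta / 2))).
Local Notation sg := (Num.sqrt (1 - r ^+ 2)).
Hypotheses (hbeta : beta = - ln (U / V)) (hbeta0 : 0 < beta).
Hypothesis hkappa : kappa = (0 +i* 1) * (tanh (beta / 2))%:C * Q.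

Lemma thermal_ratio : U = r ^+ 2 * V.
Proof.
(* [ln] is 0 at nonpositive arguments, so a positive [beta] forces a positive quotient, and in
   particular a nonzero [V]. *)
have q0 : 0 < U / V.
  rewrite ltNge; apply/negP => /ln0 e1.
  by move: hbeta0; rewrite hbeta e1 oppr0 ltxx.
have V0 : V != 0 by apply: contraTneq q0 => ->; rewrite invr0 mulr0 ltxx.
by rewrite boltz_sqr hbeta opprK lnK ?posrE // divfK.
Qed.

(** A fluctuation-dissipation relation. The terms in |y|^2 match by [thermal_ratio], since coth
    (beta / 2) (V - U) = U + V; the terms in the square of the conjugate match because the factor
    tanh (beta / 2) in [kappa] cancels the coth. *)
Lemma noise_drift y : Re (y^* * noise_map u v y) =
  - ((1 + r ^+ 2) / sg ^+ 2) * (2 * Re (y^* * drift_map Omega kappa u v y)).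
Proof.
have eN : y^* * noise_map u v y = (U + V)%:C * (normc y ^+ 2)%:C + 2%:R * (Q * y^* ^+ 2).
  rewrite -conj_mulE /noise_map rCD !rC_sum !big_ord_recl !big_ord0 !rCD.
  by ring.
have ii : (0 +i* 1) * (0 +i* 1) = -1 :> C by apply: complex_ext => /=; ring.
have eD : y^* * drift_map Omega kappa u v y =
    A * (normc y ^+ 2)%:C - (tanh (beta / 2))%:C * (Q * y^* ^+ 2).
  rewrite -conj_mulE /drift_map hkappa.
  have -> : (0 +i* 1) * ((0 +i* 1) * (tanh (beta / 2))%:C * Q) = - ((tanh (beta / 2))%:C * Q) :> C.
    by rewrite !mulrA ii mulN1r mulNr.
  by ring.
rewrite eN eD ReD ReB -rCM ReM_real ReM_nat.
have -> : Re (A * (normc y ^+ 2)%:C) = - gamma u v * normc y ^+ 2.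
  by rewrite mulrC ReM_real mulrC.
have g : gamma u v = 2^-1 * (V - U) by rewrite /gamma sumrB.
have ct := coth_tanh hbeta0; have sE := sqrt_gapE hbeta0.
have s0 : 1 - r ^+ 2 != 0 by rewrite subr_eq0 gt_eqF // boltz_sqr_lt1.
have cV : (1 + r ^+ 2) / sg ^+ 2 * (V - U) = U + V.
  by rewrite thermal_ratio sE; field.
rewrite g; move: (Re (Q * _)) (normc y ^+ 2) => D N /=.
move: ct cV; move: (_ / _) (tanh _) => c t.
move=> ct cV.
have -> : - c * (2 * (- (2^-1 * (V - U)) * N - t * D)) = c * (V - U) * N + 2 * (c * t) * D by field.
by rewrite cV ct mulr1.
Qed.

(** In the coordinates z and conj z the drift has rows (A, B) and (conj B, conj A); it keeps the
    trace and determinant of the real matrix. *)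
Lemma drift_char_poly lambda mu :
  char_poly (complexify (drift_mx Omega kappa u v)) = ('X - lambda%:P) * ('X - mu%:P) ->
  lambda + mu = A + A^* /\ lambda * mu = A * A^* - B * B^*.
Proof.
move=> /char_poly2_roots [-> ->]; rewrite !mxE /=.
by split; apply: complex_ext => /=; case: kappa => k1 k2 /=; ring.
Qed.

Lemma drift_stable_roots lambda mu : stable (drift_mx Omega kappa u v) ->
  char_poly (complexify (drift_mx Omega kappa u v)) = ('X - lambda%:P) * ('X - mu%:P) ->
  Re lambda < 0 /\ Re mu < 0.
Proof.
move=> st h; split; apply: st; rewrite eigenvalue_root_char h rootM !root_XsubC eqxx ?orbT //.
Qed.

(** The Gaussian factor is the quotient of the normalizations of [coh] at e^(tZ) z and at z, so it
    turns one into the other. *)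
Lemma induced_coh s (T : R -> bop R -> bop R) (Ts : R -> hs R -> hs R) t z :
  0 <= s <= 1 -> gaussian_qms Omega kappa 0 u v T -> induced_semigroup T beta s Ts -> 0 <= t ->
  Ts t (coh r sg (expR (- (beta * s / 2))) z) =
  coh r sg (expR (- (beta * s / 2))) (rexp (drift_map Omega kappa u v) t z).
Proof.
move=> s01 [qT gT] [_ hTs] t0; apply: val_inj.
rewrite [LHS](hTs _ _ _ t0 (coh_embed hbeta0 s01 z)) [RHS](coh_embed hbeta0 s01).
congr (bop_comp _ (bop_comp _ _)).
have l := qms_linear qT t0.
have T0 : T t 0 = 0 by have := l (-1) 0 0; rewrite scaler0 addr0 scaleN1r addNr.
have := l (expR ((1 + r ^+ 2) / sg ^+ 2 / 2 * normc z ^+ 2))%:C (weyl z) 0.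
rewrite T0 !addr0 => ->; rewrite (gT _ _ t0) scalerA; congr (_ *: _).
rewrite (weyl_factorE noise_drift _ t0) -rCM -expRD; congr ((expR _)%:C); ring.
Qed.

End GaussianParameters.

Theorem proposition3p10 (R : realType)
  (Omega : R) (kappa zeta : R[i]) (u v : 'I_2 -> R[i])
  (T : R -> bop R -> bop R)
  (hT : gaussian_qms Omega kappa zeta u v T)
  (hstable : stable (drift_mx Omega kappa u v))
  (rho : bop R)
  (hrho : unique_normal_invariant_state T rho)
  (hfaithful : faithful rho)
  (beta : R)
  (hbeta : beta =
    - ln ((\sum_l normc (u l) ^+ 2) / (\sum_l normc (v l) ^+ 2)))
  (hbeta0 : 0 < beta)
  (hzeta : zeta = 0)
  (hkappa : kappa = (0 +i* 1) * (tanh (beta / 2))%:C * \sum_l u l * v l)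
  (hgibbs : rho = gibbs beta)
  (s : R) (hs01 : 0 <= s <= 1)
  (Ts : R -> hs R -> hs R)
  (hTs : induced_semigroup T beta s Ts)
  (lambda mu : R[i])
  (hlm : char_poly (complexify (drift_mx Omega kappa u v)) =
    ('X - lambda%:P) * ('X - mu%:P)) :
  let Z := complexify (drift_mx Omega kappa u v) in
  let L := generator Ts in
  let Lstar := adjoint L in
  [/\ diagonalizable Z ->
        point_spectrum L =
          [set z | exists n m : nat, z = n%:R * lambda + m%:R * mu] /\
        point_spectrum Lstar =
          [set z | exists n m : nat, z = n%:R * lambda^* + m%:R * mu^*],
      ~ diagonalizable Z ->
        [/\ lambda = mu,
            point_spectrum L = [set z | exists n : nat, z = n%:R * lambda] &
            point_spectrum Lstar =
              [set z | exists n : nat, z = n%:R * lambda^*]] &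
      (forall z, point_spectrum L z ->
        finite_dimensional (eigenspace_of L z)) /\
      (forall z, point_spectrum Lstar z ->
        finite_dimensional (eigenspace_of Lstar z))].
Proof.
move=> Z L Lstar; subst zeta.
have r0 := expR_gt0 (- (beta / 2)); have r1 := boltz_lt1 hbeta0.
have sg0 := sqrt_gap_gt0 hbeta0; have sgE := sqrt_gapE hbeta0.
have w0 := expR_gt0 (- (beta * s / 2)).
have cT := hTs.1.
have Tc := fun t z t0 => @induced_coh _ _ _ _ _ _ hbeta hbeta0 hkappa s T Ts t z hs01 hT hTs t0.
have [tr dt] := drift_char_poly hlm.
have [l0 m0] := drift_stable_roots hstable hlm.
have er := rexp_real (- gamma u v +i* Omega) ((0 +i* 1) * kappa).
have ed := rexp_right_derivative (- gamma u v +i* Omega) ((0 +i* 1) * kappa).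
have sL := generator_point_spectrum r0 r1 sg0 sgE w0 cT Tc er ed tr dt.
have sA := adjoint_point_spectrum r0 r1 sg0 sgE w0 cT Tc er ed tr dt.
have fL := generator_eigenspace_finite r0 r1 sg0 sgE w0 cT Tc er ed tr dt l0 m0.
have fA := adjoint_eigenspace_finite r0 r1 sg0 sgE w0 cT Tc er ed tr dt l0 m0.
have pairs (a b : R[i]) :
    [set z | exists K d, (d <= K)%N /\ z = d%:R * a + (K - d)%:R * b] =
    [set z | exists n m : nat, z = n%:R * a + m%:R * b].
  apply/seteqP; split=> z /=.
    by move=> [K [d [_ ->]]]; exists d, (K - d)%N.
  by move=> [n [m ->]]; exists (n + m)%N, n; rewrite leq_addr addKn.
have single (a : R[i]) :
    [set z | exists n m : nat, z = n%:R * a + m%:R * a] = [set z | exists n : nat, z = n%:R * a].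
  apply/seteqP; split=> z /=.
    by move=> [n [m ->]]; exists (n + m)%N; rewrite natrD mulrDl.
  by move=> [n ->]; exists n, 0%N; rewrite mul0r addr0.
split.
- by move=> _; rewrite /Lstar /L sL sA !pairs.
- move=> nd; have lm : lambda = mu.
    by apply/eqP/negPn/negP => h; apply: nd; exact: diagonalizable_of_distinct hlm h.
  by rewrite /Lstar /L sL sA !pairs -lm !single.
- by split=> z _; [exact: fL | exact: fA].
Qed.
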